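(* For any convex body $K\subset\mathbb{E}^3$, $C(K,\operatorname{int}(K))\le 14$.
   Context: $\mathbb{E}^n$ is the $n$-dimensional Euclidean space. A convex body in $\mathbb{E}^n$ is a convex compact set having non-empty interior. For $A,B\subset\mathbb{E}^n$, $C(A,B)$ denotes the smallest number of translates of $B$ required to cover $A$ (i.e. such that $A$ is contained in the union of these translates). $\operatorname{int}(A)$ denotes the interior of $A$. *)

(* Defs.v *)
From HB Require Import structures.
From mathcomp Require Import all_boot all_order all_algebra.
From mathcomp Require Import all_classical all_reals all_analysis.

Set Implicit Arguments.
Unset Strict Implicit.
Unset Printing Implicit Defensive.

Import Order.TTheory GRing.Theory Num.Theory.
Import numFieldNormedType.Exports.

Local Open Scope classical_set_scope.
Local Open Scope ring_scope.

(* The row vectors 'rV[R]_n carry the sup norm, not the Euclidean norm. Only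
   the linear structure and the topology are used below, and that topology is
   the Euclidean one since all norms on R^n are equivalent. *)
Definition convex_body (R : realType) (n : nat) (K : set 'rV[R]_n) : Prop :=
  [/\ convex_set K, compact K & K° !=set0].

Definition translate (V : zmodType) (t : V) (B : set V) : set V :=
  [set t + b | b in B].

Definition covered_by_translates (V : zmodType) (A B : set V) (m : nat) :
    Prop :=
  exists t : 'I_m -> V, A `<=` \bigcup_i translate (t i) B.

(* An infimum of natural numbers, hence a minimum whenever some finite number
   of translates suffices; it is +oo when no finite number does. *)
Definition covering_number (R : realType) (V : zmodType) (A B : set V) :
    \bar R :=
  ereal_inf [set (m%:R)%:E | m in covered_by_translates A B].

(* Main.v *)
(* It suffices to illuminate K by 14 directions: every point of K must be moved
   into the interior by a small multiple of one of them; compactness then turns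
   the directions into translation vectors. Choose three differences of points
   of K that span a parallelepiped of maximal volume. In the corresponding
   affine coordinates K lies in the unit cube and contains three chords of the
   cube, parallel to the axes and joining opposite faces.

   The set of illuminated points is open and star-shaped in the sense that the
   half-open segment from a point of K to an illuminated point is illuminated.
   Hence K is illuminated as soon as the 12 edges of the cube and the 6 ends of
   the chords are. Each edge is translated onto the chord parallel to it; a
   small tilt of this translation towards an interior point illuminates the
   edge up to one end. So, starting from one illuminated vertex, 12 directions
   illuminate all edges along a spanning tree of the cube. Tilted directions of
   edges left out of the tree can be chosen so as to illuminate chord ends as
   well.

   A chord end is exposed if neither edge of its face parallel to the next axis
   (hex and nonhex) illuminates it; then the supporting planes at the end give
   inequalities between the coordinates of the chords, and adding the
   inequalities of two faces bounds the sum of the two coordinates of one chord.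
   An exposed end gets either a direction of its own, which can be chosen so as
   to illuminate a vertex too and thus start the tree, or a tilted direction of
   its hex or nonhex edge when that direction is a limit of illuminating ones;
   or else a supporting plane at the end cuts off an edge of its face, which
   then need not be illuminated and saves a direction. That some combination of
   these choices always works with 14 directions is a finite check. *)
Require Import Defs.
From HB Require Import structures.
From mathcomp Require Import finmap.
From mathcomp Require Import all_boot all_order all_algebra.
From mathcomp Require Import all_classical all_reals all_analysis.
From mathcomp Require Import ring lra.
Import Order.TTheory GRing.Theory Num.Theory.
Import numFieldNormedType.Exports.
Local Open Scope classical_set_scope.
Local Open Scope ring_scope.

Set Implicit Arguments.
Unset Strict Implicit.
Unset Printing Implicit Defensive.

(** * Separation of convex sets in three dimensions *)

Section Separation.
Variable R : realType.

(** The budget: the twelve edges leave two directions, either a separate starting vertex and one own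
    direction of a chord end, or two own directions of which one starts the tree. The own direction
    of an end whose plane cuts off an edge is paid for by that edge. A tilt that must also
    illuminate a chord end is prescribed by that end and may leave both ends of its edge dark. Such
    edges therefore stay out of the tree, and the cube must remain connected without them and
    without the dropped edges. Whether a tilt can reach a chord end is decided by the supporting
    planes there: either the direction of the edge is a limit of illuminating ones ([weakI]), or it
    strictly leaves some supporting half-space. The second case yields strict inequalities between
    coordinates, and strictness is what makes an own direction able to start the tree. Once the box
    and the chords are found, the estimates concern six real numbers. Points are triples, and body
    and interior are predicates with algebraic properties, so that changes of coordinates involve no
    topology. *)

Definition pt : Type := (R * R * R)%type.

Definition mv (p : pt) (s : R) (d : pt) : pt :=
  (p.1.1 + s * d.1.1, p.1.2 + s * d.1.2, p.2 + s * d.2).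

Definition cmb (l : R) (p q : pt) : pt :=
  ((1 - l) * p.1.1 + l * q.1.1, (1 - l) * p.1.2 + l * q.1.2,
   (1 - l) * p.2 + l * q.2).

Definition dot (n p : pt) : R := n.1.1 * p.1.1 + n.1.2 * p.1.2 + n.2 * p.2.

Definition convex_pt (C : pt -> Prop) : Prop :=
  forall l p q, 0 <= l -> l <= 1 -> C p -> C q -> C (cmb l p q).

(* For convex sets in R^3 this is openness. *)
Definition line_open (C : pt -> Prop) : Prop :=
  forall p d, C p -> exists2 e, 0 < e & forall s, `|s| <= e -> C (mv p s d).

Lemma pt_eq (p q : pt) :
  p.1.1 = q.1.1 -> p.1.2 = q.1.2 -> p.2 = q.2 -> p = q.
Proof. by move: p q => [[? ?] ?] [[? ?] ?] /= -> -> ->. Qed.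

Lemma conv_eq {C : pt -> Prop} {p q} : C p -> p = q -> C q.
Proof. by move=> Cp <-. Qed.

(** The slopes [t] for which a positive multiple of [w + t c] lies in [C] form an up-set [P], those
    for which a negative one does a down-set [N]. Convexity and the absence of 0 make them disjoint;
    line-openness makes both nonempty and keeps the supremum of [N] out of both. *)
Lemma avoid_line (C : pt -> Prop) (c w : pt) :
  convex_pt C -> line_open C -> ~ C (0, 0, 0) -> C c ->
  exists t, forall s, ~ C (mv (0, 0, 0) s (mv w t c)).
Proof.
move=> cC oC nC0 Cc.
pose P := [set t | exists2 s, 0 < s & C (mv (0, 0, 0) s (mv w t c))].
pose N := [set t | exists2 s, 0 < s & C (mv (0, 0, 0) (- s) (mv w t c))].
have up t t' : P t -> t <= t' -> P t'.
  move=> [s s0 Ct]; rewrite le_eqVlt => /orP[/eqP <-|tt']; first by exists s.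
  have h0 : 0 < 1 + s * (t' - t) by nra.
  pose l := s * (t' - t) / (1 + s * (t' - t)).
  exists (s / (1 + s * (t' - t))); first exact: divr_gt0.
  have l0 : 0 <= l by apply: divr_ge0; nra.
  have l1 : l <= 1 by rewrite ler_pdivrMr; nra.
  apply: conv_eq (cC l _ _ l0 l1 Ct Cc) _.
  by apply: pt_eq; rewrite /l /=; field; rewrite gt_eqF.
have down t t' : N t -> t' <= t -> N t'.
  move=> [s s0 Ct]; rewrite le_eqVlt => /orP[/eqP ->|tt']; first by exists s.
  have h0 : 0 < 1 + s * (t - t') by nra.
  pose l := s * (t - t') / (1 + s * (t - t')).
  exists (s / (1 + s * (t - t'))); first exact: divr_gt0.
  have l0 : 0 <= l by apply: divr_ge0; nra.
  have l1 : l <= 1 by rewrite ler_pdivrMr; nra.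
  apply: conv_eq (cC l _ _ l0 l1 Ct Cc) _.
  by apply: pt_eq; rewrite /l /=; field; rewrite gt_eqF.
have disj t : P t -> N t -> False.
  move=> [s s0 Cs] [r r0 Cr]; apply: nC0.
  have h0 : 0 < s + r by lra.
  have l0 : 0 <= s / (s + r) by apply: divr_ge0; lra.
  have l1 : s / (s + r) <= 1 by rewrite ler_pdivrMr; lra.
  apply: conv_eq (cC _ _ _ l0 l1 Cs Cr) _.
  by apply: pt_eq => /=; field; rewrite gt_eqF.
have [e e0 eC] := oC c w Cc.
have Pe : P e^-1.
  exists e => //; apply: conv_eq (eC e _) _; first by rewrite gtr0_norm.
  by apply: pt_eq => /=; field; rewrite gt_eqF.
have Ne : N (- e^-1).
  exists e => //; apply: conv_eq (eC (- e) _) _.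
    by rewrite normrN gtr0_norm.
  by apply: pt_eq => /=; field; rewrite gt_eqF.
have NP t t' : N t -> P t' -> t <= t'.
  by move=> Nt Pt'; rewrite leNgt; apply/negP => /ltW /(up _ _ Pt') /disj; apply.
have hN : has_sup N by split; [exists (- e^-1)|exists e^-1 => t Nt; exact: NP].
have nN : ~ N (sup N).
  move=> [s s0 Cs]; have [f f0 fC] := oC _ c Cs.
  have : N (sup N + f / s).
    exists s => //; apply: conv_eq (fC (- f) _) _.
      by rewrite normrN gtr0_norm.
    by apply: pt_eq => /=; field; rewrite gt_eqF.
  move=> /(sup_upper_bound hN); have := divr_gt0 f0 s0; lra.
have nP : ~ P (sup N).
  move=> [s s0 Cs]; have [f f0 fC] := oC _ c Cs.
  have Pf : P (sup N - f / s).
    exists s => //; apply: conv_eq (fC (- f) _) _.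
      by rewrite normrN gtr0_norm.
    by apply: pt_eq => /=; field; rewrite gt_eqF.
  have : sup N <= sup N - f / s.
    apply: ge_sup; first by exists (- e^-1).
    by move=> t Nt; exact: NP.
  have := divr_gt0 f0 s0; lra.
exists (sup N) => s Cs.
have [s0|s0|s0] := ltgtP s 0.
- apply: nN; exists (- s); first by rewrite oppr_gt0.
  by rewrite opprK.
- by apply: nP; exists s.
- by apply: nC0; apply: conv_eq Cs _; rewrite s0; apply: pt_eq => /=; ring.
Qed.

Lemma open_sum_line (C : pt -> Prop) (v : pt) :
  convex_pt C -> line_open C ->
  let D := fun p => exists s, C (mv p s v) in convex_pt D /\ line_open D.
Proof.
move=> cC oC; split.
  move=> l p q l0 l1 [s Cp] [r Cq]; exists ((1 - l) * s + l * r).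
  by apply: conv_eq (cC _ _ _ l0 l1 Cp Cq) _; apply: pt_eq => /=; ring.
move=> p d [s Cp]; have [e e0 eC] := oC _ d Cp; exists e => // r re.
by exists s; apply: conv_eq (eC _ re) _; apply: pt_eq => /=; ring.
Qed.

Definition cross (u v : pt) : pt :=
  (u.1.2 * v.2 - u.2 * v.1.2, u.2 * v.1.1 - u.1.1 * v.2,
   u.1.1 * v.1.2 - u.1.2 * v.1.1).

Lemma norm2_gt0 (p : pt) : p <> (0, 0, 0) -> 0 < dot p p.
Proof.
move: p => [[x y] z] nz; rewrite /dot /= lt_neqAle; apply/andP; split; last nra.
apply/negP => /eqP h; apply: nz; apply: pt_eq => /=; nra.
Qed.

(* The line Rv avoids C, and then the plane spanned by v and v' does: the
   cross product of v and v' has constant sign on C. *)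
Lemma sep0 (C : pt -> Prop) :
  convex_pt C -> line_open C -> ~ C (0, 0, 0) ->
  exists2 n : pt, n <> (0, 0, 0) & forall p, C p -> 0 <= dot n p.
Proof.
move=> cC oC nC0.
have [[c Cc]|nC] := pselect (exists c, C c); last first.
  exists (1, 0, 0); first by case => /eqP; rewrite oner_eq0.
  by move=> p Cp; case: nC; exists p.
have indep (u : pt) : u <> (0, 0, 0) -> exists w, cross w u <> (0, 0, 0).
  move: u => [[x y] z] nz; apply: contrapT => h; apply: nz.
  have nh w : cross w (x, y, z) = (0, 0, 0).
    by apply: contrapT => h'; apply: h; exists w.
  have := nh (1, 0, 0); have := nh (0, 1, 0); rewrite /cross /=.
  by move=> [? ? ?] [? ? ?]; apply: pt_eq => /=; lra.
have c_neq0 : c <> (0, 0, 0) by move=> c0; apply: nC0; rewrite -c0.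
have [w hw] := indep c c_neq0.
have [t ht] := avoid_line w cC oC nC0 Cc.
set v := mv w t c in ht.
have v0 : cross v c <> (0, 0, 0).
  move=> h; apply: hw; move: h; rewrite /v /cross /=.
  by move=> [h1 h2 h3]; apply: pt_eq => /=; lra.
have [cD oD] := open_sum_line v cC oC.
set D := (fun p => _) in cD oD.
have nD0 : ~ D (0, 0, 0) by move=> [s]; exact: ht.
have Dc : D c by exists 0; apply: conv_eq Cc _; apply: pt_eq => /=; ring.
have [t' ht'] := avoid_line (cross v c) cD oD nD0 Dc.
set v' := mv (cross v c) t' c in ht'.
have npos := norm2_gt0 v0.
pose n := cross v v'.
have nn : n <> (0, 0, 0).
  move=> h; move: npos.
  have -> : dot (cross v c) (cross v c) = dot (cross v c) v'
    by rewrite /v' /dot /cross /=; ring.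
  have [v10 [v20 v30]] : v.1.2 * v'.2 = v.2 * v'.1.2 /\
     v.2 * v'.1.1 = v.1.1 * v'.2 /\ v.1.1 * v'.1.2 = v.1.2 * v'.1.1.
    by move: h; rewrite /n /cross => -[h1 h2 h3]; do !split; apply/eqP;
       rewrite -subr_eq0 ?h1 ?h2 ?h3.
  have vv : 0 < dot v v.
    apply: norm2_gt0 => v00; apply: v0; rewrite v00 /cross /=.
    by apply: pt_eq => /=; ring.
  have e1 : dot v v * v'.1.1 = dot v v' * v.1.1.
    transitivity (dot v v' * v.1.1 + v.1.2 * (v.1.2 * v'.1.1 - v.1.1 * v'.1.2)
      + v.2 * (v.2 * v'.1.1 - v.1.1 * v'.2)); first by rewrite /dot; ring.
    by rewrite v20 v30; ring.
  have e2 : dot v v * v'.1.2 = dot v v' * v.1.2.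
    transitivity (dot v v' * v.1.2 + v.1.1 * (v.1.1 * v'.1.2 - v.1.2 * v'.1.1)
      + v.2 * (v.2 * v'.1.2 - v.1.2 * v'.2)); first by rewrite /dot; ring.
    by rewrite v10 v30; ring.
  have e3 : dot v v * v'.2 = dot v v' * v.2.
    transitivity (dot v v' * v.2 + v.1.1 * (v.1.1 * v'.2 - v.2 * v'.1.1)
      + v.1.2 * (v.1.2 * v'.2 - v.2 * v'.1.2)); first by rewrite /dot; ring.
    by rewrite v10 v20; ring.
  have : dot v v * dot (cross v c) v' = 0.
    transitivity ((v.1.2 * c.2 - v.2 * c.1.2) * (dot v v * v'.1.1) +
      (v.2 * c.1.1 - v.1.1 * c.2) * (dot v v * v'.1.2) +
      (v.1.1 * c.1.2 - v.1.2 * c.1.1) * (dot v v * v'.2)).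
      by rewrite /dot /=; ring.
    by rewrite e1 e2 e3; ring.
  by move=> /eqP; rewrite mulf_eq0 (gt_eqF vv) /= => /eqP ->; rewrite ltxx.
clearbody v'; clearbody v.
have n2 := norm2_gt0 nn.
have avoid p : C p -> dot n p <> 0.
  move=> Cp np; pose a := dot (cross p v') n / dot n n.
  pose b := dot (cross v p) n / dot n n.
  apply: (ht' b); exists a; apply: conv_eq Cp _.
  have key (x : R) : x * dot n n = x * dot n n by [].
  have n0 : dot n n != 0 by rewrite gt_eqF.
  (* Cramer's rule for [p] in the basis [v], [v'], [n], one coordinate [f] at a time. *)
  have lag : forall (f : pt -> R), (forall q, f q = q.1.1) \/
      (forall q, f q = q.1.2) \/ (forall q, f q = q.2) ->
      f p * dot n n = dot (cross p v') n * f v + dot (cross v p) n * f v'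
        + dot n p * f n.
    by move=> f [hf|[hf|hf]]; rewrite !hf /n /dot /cross /=; ring.
  apply: pt_eq => /=; apply: (mulIf n0).
  - rewrite (lag (fun q => q.1.1)) ?np; last by left.
    by rewrite /a /b; field.
  - rewrite (lag (fun q => q.1.2)) ?np; last by right; left.
    by rewrite /a /b; field.
  - rewrite (lag (fun q => q.2)) ?np; last by right; right.
    by rewrite /a /b; field.
have same p q : C p -> C q -> 0 < dot n p -> 0 <= dot n q.
  move=> Cp Cq np; rewrite leNgt; apply/negP => nq.
  have d0 : 0 < dot n p - dot n q by lra.
  have l0 : 0 <= dot n p / (dot n p - dot n q) by apply: divr_ge0; lra.
  have l1 : dot n p / (dot n p - dot n q) <= 1 by rewrite ler_pdivrMr; lra.
  apply: (avoid _ (cC _ _ _ l0 l1 Cp Cq)).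
  rewrite [LHS](_ : _ = (1 - dot n p / (dot n p - dot n q)) * dot n p
    + dot n p / (dot n p - dot n q) * dot n q); last by rewrite /dot /=; ring.
  by field; rewrite gt_eqF.
have [c0|c0|c0] := ltgtP (dot n c) 0.
- exists (mv (0, 0, 0) (-1) n).
    move=> h; apply: nn; move: h => [h1 h2 h3]; apply: pt_eq => /=; lra.
  move=> p Cp; have -> : dot (mv (0, 0, 0) (-1) n) p = - dot n p
    by rewrite /dot /=; ring.
  rewrite oppr_ge0 leNgt; apply/negP => np.
  by have := same _ _ Cp Cc np; lra.
- by exists n => // p Cp; exact: same c0.
- by have := avoid _ Cc.
Qed.

(** [sep0] is applied to the Minkowski difference [Q - P], which is line-open because [P] is. *)
Lemma sep_sets (P Q : pt -> Prop) :
  convex_pt P -> line_open P -> convex_pt Q -> (forall p, P p -> ~ Q p) ->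
  exists2 n : pt, n <> (0, 0, 0) &
    forall p q, P p -> Q q -> dot n p <= dot n q.
Proof.
move=> cP oP cQ dis.
pose C z := exists q, Q q /\ P (mv q (-1) z).
have cC : convex_pt C.
  move=> l z z' l0 l1 [q [Qq Pq]] [q' [Qq' Pq']].
  exists (cmb l q q'); split; first exact: cQ.
  by apply: conv_eq (cP _ _ _ l0 l1 Pq Pq') _; apply: pt_eq => /=; ring.
have oC : line_open C.
  move=> z d [q [Qq Pq]]; have [e e0 he] := oP _ d Pq; exists e => // s se.
  exists q; split => //; apply: conv_eq (he (- s) _) _; first by rewrite normrN.
  by apply: pt_eq => /=; ring.
have nC0 : ~ C (0, 0, 0).
  move=> [q [Qq Pq]]; apply: (dis _ Pq); apply: conv_eq Qq _.
  by apply: pt_eq => /=; ring.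
have [n n0 hn] := sep0 cC oC nC0; exists n => // p q Pp Qq.
have : C (mv q (-1) p).
  by exists q; split => //; apply: conv_eq Pp _; apply: pt_eq => /=; ring.
by move=> /hn; rewrite /dot /=; lra.
Qed.

End Separation.

(** * Illumination, supporting planes and tilted directions *)

Section Illumination.
Variable R : realType.
Notation pt := (pt R).
Implicit Types (K I : pt -> Prop) (p q d u m n : pt) (s t l : R).

(** [I] plays the interior of [K]. These properties are stable under invertible affine maps and
    mention no topology. *)
Record body K I : Prop := Body {
  body_conv : convex_pt K;
  body_sub : forall p, I p -> K p;
  body_star : forall l p q, 0 < l -> l <= 1 -> K p -> I q -> I (cmb l p q);
  body_open : line_open I;
  body_ne : exists m, I m }.

Definition illum I d p : Prop := exists2 s, 0 < s & I (mv p s d).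

(** [h] will be the size of a tilt; finitely many requirements of this form can be met by one
    size. *)
Definition ev (P : R -> Prop) : Prop :=
  exists2 e, 0 < e & forall h, 0 < h -> h <= e -> P h.

Lemma ev_and (P Q : R -> Prop) : ev P -> ev Q -> ev (fun h => P h /\ Q h).
Proof.
move=> [e e0 eP] [f f0 fQ]; exists (Num.min e f); first by rewrite lt_min e0.
by move=> h h0; rewrite le_min => /andP[he hf]; split; [exact: eP|exact: fQ].
Qed.

Lemma ev_mono (P Q : R -> Prop) : (forall h, 0 < h -> P h -> Q h) -> ev P -> ev Q.
Proof. by move=> PQ [e e0 eP]; exists e => // h h0 he; apply/PQ/eP. Qed.

Lemma ev_true (P : R -> Prop) : (forall h, 0 < h -> P h) -> ev P.
Proof. by move=> hP; exists 1 => // h h0 _; exact: hP. Qed.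

Lemma ev_ex (P : R -> Prop) : ev P -> exists h, P h.
Proof. by move=> [e e0 eP]; exists e; exact: eP. Qed.

Lemma ev_seq (T : Type) (s : seq T) (Q : T -> R -> Prop) :
  (forall x, List.In x s -> ev (Q x)) ->
  ev (fun h => forall x, List.In x s -> Q x h).
Proof.
elim: s => [|x s IH] hs; first exact: ev_true.
have h1 := hs x (or_introl erefl).
have h2 := IH (fun y ys => hs y (or_intror ys)).
by apply: ev_mono (ev_and h1 h2) => h _ [? h3] y [<-|/h3].
Qed.

Section Body.
Variables K I : pt -> Prop.
Hypothesis hB : body K I.

Lemma I_conv : convex_pt I.
Proof.
move=> l p q; rewrite le_eqVlt => /orP[/eqP <- _ Ip _|l0 l1 Ip Iq].
  by apply: conv_eq Ip _; apply: pt_eq => /=; ring.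
by apply: (body_star hB) => //; exact: body_sub Ip.
Qed.

(* A point of K need not be illuminated itself: it is enough that it is
   mapped into K by a nonnegative multiple of d. *)
Lemma illum_wstar d r l c p : 0 < l -> l <= 1 -> 0 <= r -> K (mv c r d) ->
  illum I d p -> illum I d (cmb l c p).
Proof.
move=> l0 l1 r0 Kc [s s0 Ip]; exists ((1 - l) * r + l * s); first by nra.
apply: conv_eq (body_star hB l0 l1 Kc Ip) _; by apply: pt_eq => /=; ring.
Qed.

Lemma illum_star d l c p : 0 < l -> l <= 1 -> K c ->
  illum I d p -> illum I d (cmb l c p).
Proof.
move=> l0 l1 Kc; apply: illum_wstar (lexx 0) _ => //.
by apply: conv_eq Kc _; apply: pt_eq => /=; ring.
Qed.

Lemma illum_conv d : convex_pt (illum I d).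
Proof.
move=> l p q l0 l1 [s s0 Ip] [r r0 Iq].
exists ((1 - l) * s + l * r); first by nra.
by apply: conv_eq (I_conv l0 l1 Ip Iq) _; apply: pt_eq => /=; ring.
Qed.

Lemma illum_open d : line_open (illum I d).
Proof.
move=> p u [s s0 Ip]; have [e e0 he] := body_open hB u Ip; exists e => // r re.
by exists s => //; apply: conv_eq (he _ re) _; apply: pt_eq => /=; ring.
Qed.

Lemma illum_dir_open d u p : illum I d p ->
  ev (fun h => illum I (mv d h u) p).
Proof.
move=> [s s0 Ip]; have [e e0 he] := body_open hB u Ip.
exists (e / s); first exact: divr_gt0.
move=> h h0; rewrite ler_pdivlMr // => hs; exists s => //.
apply: conv_eq (he (s * h) _) _; first by rewrite gtr0_norm ?mulr_gt0 //; lra.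
by apply: pt_eq => /=; ring.
Qed.

Lemma ge_lim (a b : R) : (forall s, 0 < s -> s <= 1 -> 0 <= a + s * b) -> 0 <= a.
Proof.
move=> h; rewrite leNgt; apply/negP => a0.
have [b0|b0] := leP b 0; first by have := h 1 ltr01 (lexx _); lra.
have ab : 0 < - a / (2 * b - a) by apply: divr_gt0; lra.
have := h _ ab; rewrite ler_pdivrMr; last lra.
have -> : a + - a / (2 * b - a) * b = a * (b - a) / (2 * b - a).
  by field; rewrite gt_eqF //; lra.
move=> /(_ ltac:(lra)); rewrite pmulr_lge0 ?invr_gt0; last lra.
nra.
Qed.

Lemma support_strict n p : n <> (0, 0, 0) ->
  (forall k, K k -> dot n k <= dot n p) -> forall m, I m -> dot n m < dot n p.
Proof.
move=> n0 sup m Im; have [e e0 he] := body_open hB n Im.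
have := sup _ (body_sub hB (he e _)).
rewrite gtr0_norm // lexx => /(_ isT).
have -> : dot n (mv m e n) = dot n m + e * dot n n by rewrite /dot /=; ring.
have := norm2_gt0 n0; nra.
Qed.

Lemma support_of_I n p : (forall k, I k -> dot n k <= dot n p) ->
  forall k, K k -> dot n k <= dot n p.
Proof.
move=> h k Kk; rewrite -subr_ge0; have [m Im] := body_ne hB.
apply: (@ge_lim _ (dot n k - dot n m)) => s s0 s1.
have := h _ (body_star hB s0 s1 Kk Im).
have -> : dot n (cmb s k m) = (1 - s) * dot n k + s * dot n m
  by rewrite /dot /=; ring.
lra.
Qed.

Lemma cone_sep p d u :
  (forall s r, 0 < s -> 0 < r -> ~ I (mv (mv p s d) r u)) ->
  exists n, [/\ n <> (0, 0, 0), forall k, K k -> dot n k <= dot n p,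
    0 <= dot n d & 0 <= dot n u].
Proof.
move=> hI; pose Q q := exists s r, [/\ 0 < s, 0 < r & q = mv (mv p s d) r u].
have cQ : convex_pt Q.
  move=> l q q' l0 l1 [s [r [s0 r0 ->]]] [s' [r' [s0' r0' ->]]].
  exists ((1 - l) * s + l * s'), ((1 - l) * r + l * r').
  by split; [nra|nra|apply: pt_eq => /=; ring].
have [q Iq [s [r [s0 r0 eq]]]|n n0 hn] :=
  sep_sets I_conv (body_open hB) cQ _.
  by apply: (hI _ _ s0 r0); rewrite -eq.
have hn' k s r : I k -> 0 < s -> 0 < r ->
    dot n k <= dot n p + s * dot n d + r * dot n u.
  move=> Ik s0 r0; have := hn k (mv (mv p s d) r u) Ik.
  have -> : dot n (mv (mv p s d) r u) = dot n p + s * dot n d + r * dot n u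
    by rewrite /dot /=; ring.
  by apply; exists s, r.
have [m Im] := body_ne hB.
have big (a b c : R) : (forall s, 0 < s -> a <= b + s * c) -> 0 <= c.
  move=> h; rewrite leNgt; apply/negP => c0.
  have s0 : 0 < (`|b - a| + 1) / - c.
    by apply: divr_gt0; [have := normr_ge0 (b - a); lra|lra].
  have := h _ s0.
  have -> : (`|b - a| + 1) / - c * c = - (`|b - a| + 1).
    by field; rewrite lt_eqF.
  have := ler_norm (b - a); lra.
exists n; split => //.
- apply: support_of_I => k Ik; rewrite -subr_ge0.
  apply: (@ge_lim _ (dot n d + dot n u)) => s s0 _.
  by have := hn' k s s Ik s0 s0; lra.
- by apply: (big (dot n m) (dot n p + dot n u)) => s s0;
    have := hn' m s 1 Im s0 ltr01; lra.
- by apply: (big (dot n m) (dot n p + dot n d)) => s s0;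
    have := hn' m 1 s Im ltr01 s0; lra.
Qed.

Lemma illum_sep d p : ~ illum I d p ->
  exists n, [/\ n <> (0, 0, 0), forall k, K k -> dot n k <= dot n p
    & 0 <= dot n d].
Proof.
move=> hI; have [|n [n0 hn nd _]] := @cone_sep p d d; last by exists n.
move=> s r s0 r0 Ip; apply: hI; exists (s + r); first lra.
by apply: conv_eq Ip _; apply: pt_eq => /=; ring.
Qed.

(** The closure of the set of directions illuminating [p], described dually by supporting planes. *)
Definition weak d p : Prop := forall n, n <> (0, 0, 0) ->
  (forall k, K k -> dot n k <= dot n p) -> dot n d <= 0.

Lemma weak_mix d d' p t : weak d p -> illum I d' p -> 0 < t -> t <= 1 ->
  illum I (cmb t d d') p.
Proof.
move=> wd [s s0 Id'] t0 t1; apply: contrapT => /illum_sep [n [n0 hn]].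
have := support_strict n0 hn Id'.
have := wd n n0 hn.
have -> : dot n (mv p s d') = dot n p + s * dot n d' by rewrite /dot /=; ring.
have -> : dot n (cmb t d d') = (1 - t) * dot n d + t * dot n d'
  by rewrite /dot /=; ring.
move=> h1 h2 h3; have : dot n d' < 0 by nra.
nra.
Qed.

(** If no size worked, [cone_sep] would give a normal with [dot n d = 0] and [0 <= dot n u]. From
    one working size all smaller ones follow, because they are mixtures with [d]. *)
Lemma weak_tilt d u q : weak d q ->
  (forall n, n <> (0, 0, 0) -> (forall k, K k -> dot n k <= dot n q) ->
     dot n d = 0 -> dot n u < 0) ->
  ev (fun h => illum I (mv d h u) q).
Proof.
move=> wd hu.
have [[h0 h00 Ih]|] := pselect (exists2 h, 0 < h & illum I (mv d h u) q).
  exists h0 => // h hp hh.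
  have t0 : 0 < h / h0 by exact: divr_gt0.
  have t1 : h / h0 <= 1 by rewrite ler_pdivrMr ?mul1r.
  have := weak_mix wd Ih t0 t1; congr illum.
  by apply: pt_eq => /=; field; rewrite gt_eqF.
move=> nh; have [|n [n0 hn nd nu]] := @cone_sep q d u.
  move=> s r s0 r0 Iq; apply: nh; exists (r / s); first exact: divr_gt0.
  exists s => //; apply: conv_eq Iq _; apply: pt_eq => /=; field;
    by rewrite gt_eqF.
have nd0 : dot n d = 0 by have := wd n n0 hn; lra.
by have := hu n n0 hn nd0; lra.
Qed.

Section Edge.
Variables e0 w d : pt.
Hypothesis Kd : forall t, 0 <= t -> t <= 1 -> K (mv (mv e0 t w) 1 d).

Definition tilt m t0 : pt := mv m (-1) (mv (mv e0 t0 w) 1 d).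

(** The moved point is [(1 - h) c + h m], where [c] is the point of the chord at parameter
    [(t - h * t0) / (1 - h)]. The dark parts at the two ends have lengths [h * t0] and
    [h * (1 - t0)], so the choice of [t0] decides which end is lost. *)
Lemma edge_tilt m t0 h t : I m -> 0 < h -> h < 1 ->
  h * t0 <= t -> t <= 1 - h * (1 - t0) ->
  illum I (mv d h (tilt m t0)) (mv e0 t w).
Proof.
move=> Im h0 h1 ht th; exists 1 => //.
have g0 : 0 < 1 - h by lra.
pose r := (t - h * t0) / (1 - h).
have r0 : 0 <= r by apply: divr_ge0; lra.
have r1 : r <= 1 by rewrite ler_pdivrMr; lra.
apply: conv_eq (body_star hB h0 (ltW h1) (Kd r0 r1) Im) _.
by apply: pt_eq; rewrite /r /=; field; rewrite gt_eqF.
Qed.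

Lemma edge_cover (Cov : pt -> Prop) m t0 : line_open Cov -> I m ->
  0 <= t0 -> t0 <= 1 -> t0 = 0 \/ Cov e0 -> t0 = 1 \/ Cov (mv e0 1 w) ->
  ev (fun h => forall t, 0 <= t -> t <= 1 ->
    illum I (mv d h (tilt m t0)) (mv e0 t w) \/ Cov (mv e0 t w)).
Proof.
move=> oC Im t00 t01 c0 c1.
have [a a0 ha] : ev (fun h => forall t, 0 <= t -> t < h * t0 -> Cov (mv e0 t w)).
  case: c0 => [->|C0]; first by apply: ev_true => h h0 t; rewrite mulr0; lra.
  have [e ep he] := oC _ w C0; exists e => // h h0 hle t tp th.
  by apply: he; rewrite ger0_norm //; nra.
have [b b0 hb] : ev (fun h => forall t, t <= 1 -> 1 - h * (1 - t0) < t ->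
    Cov (mv e0 t w)).
  case: c1 => [->|C1].
    by apply: ev_true => h h0 t; rewrite subrr mulr0; lra.
  have [e ep he] := oC _ w C1; exists e => // h h0 hle t tp th.
  apply: conv_eq (he (t - 1) _) _; last by apply: pt_eq => /=; ring.
  by rewrite ler0_norm; [nra|lra].
exists (Num.min (1 / 2) (Num.min a b)).
  by rewrite !lt_min a0 b0 !andbT; lra.
move=> h h0; rewrite !le_min => /andP[h1 /andP[h2 h3]] t t_ge0 t_le1.
have [lt1|ge1] := ltP t (h * t0); first by right; apply: (ha h).
have [lt2|ge2] := ltP (1 - h * (1 - t0)) t; first by right; apply: (hb h).
by left; apply: edge_tilt => //; lra.
Qed.

Lemma detour_cover (Cov : pt -> Prop) m t0 (b : R) P : line_open Cov -> I m ->
  0 <= t0 -> t0 <= 1 -> b = 0 \/ b = 1 ->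
  illum I d P -> t0 = b \/ Cov (mv e0 b w) ->
  ev (fun h => forall l, 0 <= l -> l <= 1 ->
    illum I (mv d h (tilt m t0)) (cmb l (mv e0 b w) P) \/
    Cov (cmb l (mv e0 b w) P)).
Proof.
move=> oC Im t00 t01 b01 IP cb.
have bb : 0 <= b /\ b <= 1 by case: b01 => ->; lra.
case: cb => [tb|Cb].
  have [e ep he] := illum_dir_open (tilt m t0) IP.
  exists (Num.min e (1 / 2)); first by rewrite lt_min ep; lra.
  move=> h h0; rewrite le_min => /andP[h1 h2] l l0 l1; left.
  apply: illum_conv => //; last exact: he.
  by case: bb => ? ?; apply: edge_tilt => //; rewrite ?tb; nra.
have [r rp hr] : exists2 r, 0 < r & forall l, 0 <= l -> l <= r ->
    Cov (cmb l (mv e0 b w) P).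
  have [r rp hr] := oC _ (mv P (-1) (mv e0 b w)) Cb; exists r => // l l0 lr.
  apply: conv_eq (hr l _) _; first by rewrite ger0_norm.
  by apply: pt_eq => /=; ring.
have [s s0 Is] := IP.
have [e ep he] := body_open hB (tilt m t0) Is.
(* For [l > r] the tilt displaces the point that [P] contributes by at most [h * (1 + s) / r] times
   the tilt vector; this must stay within the margin [e] around it. *)
exists (e * r / (1 + s)); first by apply: divr_gt0; [exact: mulr_gt0|lra].
move=> h h0; rewrite ler_pdivlMr; last lra.
move=> hle l l0 l1; have [lr|lr] := leP l r; first by right; exact: hr.
left; have lp : 0 < l by lra.
exists ((1 - l) * 1 + l * s); first by nra.
have hs : `|h * ((1 - l) * 1 + l * s) / l| <= e.
  have s'0 : 0 <= (1 - l) * 1 + l * s by nra.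
  rewrite ger0_norm; last by apply: divr_ge0; [exact: mulr_ge0 (ltW h0) _|exact: ltW].
  rewrite ler_pdivrMr //; apply: (@le_trans _ _ (h * (1 + s))).
    by rewrite ler_pM2l //; nra.
  by apply: (le_trans hle); rewrite ler_pM2l // ltW.
apply: conv_eq (body_star hB lp l1 (Kd bb.1 bb.2) (he _ hs)) _.
by apply: pt_eq => /=; field; rewrite gt_eqF.
Qed.

(** A point of [I] of the form (edge point) [+ r d + v (k - q)] serves as [m]: against a normal at
    [q] orthogonal to [d], its tilt has the sign of [dot n k - dot n q]. If [I] misses all these
    points, a separating plane has, up to sign, the excluded normal. *)
Lemma mark_tilt q : weak d q ->
  (forall n, n <> (0, 0, 0) -> dot n d = 0 ->
    (forall k, K k -> dot n k <= dot n q) ->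
    (forall k t, K k -> 0 <= t -> t <= 1 -> dot n (mv e0 t w) <= dot n k) ->
    False) ->
  exists m t0, [/\ I m, 0 <= t0, t0 <= 1 &
    ev (fun h => illum I (mv d h (tilt m t0)) q)].
Proof.
move=> wd hn.
pose Q p := exists t v r k, [/\ 0 <= t, t <= 1, 0 < v, I k &
  p = mv (mv (mv (mv e0 t w) r d) v k) (- v) q].
have cQ : convex_pt Q.
  move=> l p p' l0 l1 [t [v [r [k [t0 t1 v0 Ik ->]]]]].
  move=> [t' [v' [r' [k' [t0' t1' v0' Ik' ->]]]]].
  pose V := (1 - l) * v + l * v'.
  have V0 : 0 < V by rewrite /V; nra.
  exists ((1 - l) * t + l * t'), V, ((1 - l) * r + l * r'),
    (cmb (l * v' / V) k k').
  split=> //; [by nra|by nra| |].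
    apply: I_conv => //; first by apply: divr_ge0; nra.
    by rewrite ler_pdivrMr // /V; nra.
  by apply: pt_eq; rewrite /V /=; field; exact: lt0r_neq0 V0.
have [[p [Ip [t [v [r [k [t0 t1 v0 Ik ep]]]]]]]|dis] :=
    pselect (exists p, I p /\ Q p).
  exists p, t; split => //; apply: weak_tilt => // n n0 sup nd.
  have := support_strict n0 sup Ik.
  have -> : dot n (tilt p t) = (r - 1) * dot n d + v * (dot n k - dot n q).
    by rewrite /tilt ep /dot /=; ring.
  by rewrite nd; nra.
have [p Ip Qp|n n0 hn'] := sep_sets I_conv (body_open hB) cQ _.
  by apply: dis; exists p.
have H i t v r k : I i -> 0 <= t -> t <= 1 -> 0 < v -> I k ->
    dot n i <= dot n (mv e0 t w) + r * dot n d + v * (dot n k - dot n q).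
  move=> Ii t0 t1 v0 Ik.
  have := hn' i (mv (mv (mv (mv e0 t w) r d) v k) (- v) q) Ii.
  have -> : dot n (mv (mv (mv (mv e0 t w) r d) v k) (- v) q) =
    dot n (mv e0 t w) + r * dot n d + v * (dot n k - dot n q).
    by rewrite /dot /=; ring.
  by apply; exists t, v, r, k.
have [m Im] := body_ne hB.
have big (a b c : R) : (forall s, 0 < s -> a <= b + s * c) -> 0 <= c.
  move=> h; rewrite leNgt; apply/negP => c0.
  have s0 : 0 < (`|b - a| + 1) / - c.
    by apply: divr_gt0; [have := normr_ge0 (b - a); lra|lra].
  have := h _ s0.
  have -> : (`|b - a| + 1) / - c * c = - (`|b - a| + 1).
    by field; rewrite lt_eqF.
  have := ler_norm (b - a); lra.
have nd : dot n d = 0.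
  have h1 : 0 <= dot n d.
    apply: (big (dot n m) (dot n (mv e0 0 w) + (dot n m - dot n q))) => s s0.
    by have := H m 0 1 s m Im (lexx _) ler01 ltr01 Im; lra.
  have h2 : 0 <= - dot n d.
    apply: (big (dot n m) (dot n (mv e0 0 w) + (dot n m - dot n q))) => s s0.
    by have := H m 0 1 (- s) m Im (lexx _) ler01 ltr01 Im; lra.
  lra.
pose n' := mv (0, 0, 0) (-1) n.
have n'E p : dot n' p = - dot n p by rewrite /n' /dot /=; ring.
exfalso; apply: (hn n').
- move=> h; apply: n0; move: h => [h1 h2 h3]; apply: pt_eq => /=; lra.
- by rewrite n'E nd oppr0.
- apply: support_of_I => k Ik; rewrite !n'E lerN2 -subr_ge0.
  apply: (big (dot n m) (dot n (mv e0 0 w))) => s s0.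
  by have := H m 0 s 0 k Im (lexx _) ler01 s0 Ik; lra.
- move=> k t Kk t0 t1; rewrite !n'E lerN2.
  apply: support_of_I Kk => i Ii; rewrite -subr_ge0.
  apply: (@ge_lim _ (dot n m - dot n q)) => s s0 _.
  by have := H i t s 0 m Ii t0 t1 s0 Im; lra.
Qed.

End Edge.
End Body.
End Illumination.

(** * Chords of the unit cube and changes of coordinates *)

Section Frames.
Variable R : realType.
Notation pt := (pt R).
Implicit Types (K I : pt -> Prop) (p q d u m n : pt) (s t l : R).

Record par : Type := Par { a2 : R; a3 : R; b1 : R; b3 : R; c1 : R; c2 : R }.

(* Three chords of the unit cube, parallel to the axes; [a2] and [a3] are the
   constant coordinates of the first one, and so on. *)
Record cbody K I (P : par) : Prop := CBody {
  cb_body :> body K I;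
  cb_box : forall p, K p ->
    [/\ 0 <= p.1.1 <= 1, 0 <= p.1.2 <= 1 & 0 <= p.2 <= 1];
  cb_A : forall t, 0 <= t -> t <= 1 -> K (t, a2 P, a3 P);
  cb_B : forall t, 0 <= t -> t <= 1 -> K (b1 P, t, b3 P);
  cb_C : forall t, 0 <= t -> t <= 1 -> K (c1 P, c2 P, t) }.

Inductive gen : Type := Cyc | Sig | Tau | Rho | Xi.

(* Old coordinates in terms of the new ones. *)
Definition gmap1 g p : pt :=
  let: (x, y, z) := p in
  match g with
  | Cyc => (z, x, y)
  | Sig => (1 - y, 1 - x, 1 - z)
  | Tau => (x, 1 - z, 1 - y)
  | Rho => (x, y, 1 - z)
  | Xi => (1 - x, y, z)
  end.

Definition glin1 g p : pt :=
  let: (x, y, z) := p in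
  match g with
  | Cyc => (z, x, y)
  | Sig => (- y, - x, - z)
  | Tau => (x, - z, - y)
  | Rho => (x, y, - z)
  | Xi => (- x, y, z)
  end.

Definition gpar1 g P : par :=
  match g with
  | Cyc => Par (b3 P) (b1 P) (c2 P) (c1 P) (a2 P) (a3 P)
  | Sig => Par (1 - b1 P) (1 - b3 P) (1 - a2 P) (1 - a3 P) (1 - c2 P) (1 - c1 P)
  | Tau => Par (1 - a3 P) (1 - a2 P) (c1 P) (1 - c2 P) (b1 P) (1 - b3 P)
  | Rho => Par (a2 P) (1 - a3 P) (b1 P) (1 - b3 P) (c1 P) (c2 P)
  | Xi => Par (a2 P) (a3 P) (1 - b1 P) (b3 P) (1 - c1 P) (c2 P)
  end.

Definition gmap (w : seq gen) p : pt := foldr gmap1 p w.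
Definition glin (w : seq gen) p : pt := foldr glin1 p w.
(** A left fold, because parameters are pulled back: the first letter of [w] is the outermost map in
    [gmap w] and is the first to act on the body. *)
Definition gpar (w : seq gen) P : par := foldl (fun P g => gpar1 g P) P w.

Lemma gmap1_mv g p s d : gmap1 g (mv p s d) = mv (gmap1 g p) s (glin1 g d).
Proof.
by case: g p d => [] [[x y] z] [[x' y'] z']; apply: pt_eq => /=; ring.
Qed.

Lemma gmap1_cmb g l p q : gmap1 g (cmb l p q) = cmb l (gmap1 g p) (gmap1 g q).
Proof.
by case: g p q => [] [[x y] z] [[x' y'] z']; apply: pt_eq => /=; ring.
Qed.

Lemma gmap_mv w p s d : gmap w (mv p s d) = mv (gmap w p) s (glin w d).
Proof. by elim: w => //= g w ->; exact: gmap1_mv. Qed.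

Lemma gmap_cmb w l p q : gmap w (cmb l p q) = cmb l (gmap w p) (gmap w q).
Proof. by elim: w => //= g w ->; exact: gmap1_cmb. Qed.

Lemma gmap1_surj g p : exists q, gmap1 g q = p.
Proof.
move: p => [[x y] z]; case: g; [exists (y, z, x)|exists (1 - y, 1 - x, 1 - z)
  |exists (x, 1 - z, 1 - y)|exists (x, y, 1 - z)|exists (1 - x, y, z)];
  by apply: pt_eq => /=; ring.
Qed.

Lemma glin1_surj g p : exists q, glin1 g q = p.
Proof.
move: p => [[x y] z]; case: g; [exists (y, z, x)|exists (- y, - x, - z)
  |exists (x, - z, - y)|exists (x, y, - z)|exists (- x, y, z)];
  by apply: pt_eq => /=; ring.
Qed.

Lemma gmap_surj w p : exists q, gmap w q = p.
Proof.
elim: w p => [|g w IH] p; first by exists p.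
by have [q <-] := gmap1_surj g p; have [r <-] := IH q; exists r.
Qed.

Lemma glin_surj w p : exists q, glin w q = p.
Proof.
elim: w p => [|g w IH] p; first by exists p.
by have [q <-] := glin1_surj g p; have [r <-] := IH q; exists r.
Qed.

Lemma illum_frame I w d p :
  illum (fun x => I (gmap w x)) d p <-> illum I (glin w d) (gmap w p).
Proof.
by split=> -[s s0]; rewrite ?gmap_mv => h; exists s => //; rewrite gmap_mv.
Qed.

Lemma cbody1 g K I P : cbody K I P ->
  cbody (fun x => K (gmap1 g x)) (fun x => I (gmap1 g x)) (gpar1 g P).
Proof.
move=> [[cK IK st oI [m Im]] bx cA cB cC]; split.
- split.
  + by move=> l p q l0 l1 Kp Kq; rewrite gmap1_cmb; exact: cK.
  + by move=> p; exact: IK.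
  + by move=> l p q l0 l1 Kp Iq; rewrite gmap1_cmb; exact: st.
  + move=> p d Ip; have [e e0 he] := oI _ (glin1 g d) Ip; exists e => // s se.
    by rewrite gmap1_mv; exact: he.
  + by have [q eq] := gmap1_surj g m; exists q; rewrite eq.
- move=> [[x y] z] /bx; case: g => /= -[h1 h2 h3]; split=> //; lra.
- move=> t t0 t1; case: g => /=.
  + exact: cB.
  + by apply: conv_eq (cB (1 - t) _ _) _; [lra|lra|apply: pt_eq => /=; ring].
  + by apply: conv_eq (cA t _ _) _; [lra|lra|apply: pt_eq => /=; ring].
  + by apply: conv_eq (cA t _ _) _; [lra|lra|apply: pt_eq => /=; ring].
  + by apply: conv_eq (cA (1 - t) _ _) _; [lra|lra|apply: pt_eq => /=; ring].
- move=> t t0 t1; case: g => /=.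
  + exact: cC.
  + by apply: conv_eq (cA (1 - t) _ _) _; [lra|lra|apply: pt_eq => /=; ring].
  + by apply: conv_eq (cC (1 - t) _ _) _; [lra|lra|apply: pt_eq => /=; ring].
  + by apply: conv_eq (cB t _ _) _; [lra|lra|apply: pt_eq => /=; ring].
  + by apply: conv_eq (cB t _ _) _; [lra|lra|apply: pt_eq => /=; ring].
- move=> t t0 t1; case: g => /=.
  + exact: cA.
  + by apply: conv_eq (cC (1 - t) _ _) _; [lra|lra|apply: pt_eq => /=; ring].
  + by apply: conv_eq (cB (1 - t) _ _) _; [lra|lra|apply: pt_eq => /=; ring].
  + by apply: conv_eq (cC (1 - t) _ _) _; [lra|lra|apply: pt_eq => /=; ring].
  + by apply: conv_eq (cC t _ _) _; [lra|lra|apply: pt_eq => /=; ring].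
Qed.

Lemma cbody_frame w K I P : cbody K I P ->
  cbody (fun x => K (gmap w x)) (fun x => I (gmap w x)) (gpar w P).
Proof.
elim: w K I P => [|g w IH] K I P hP //=.
exact: IH _ _ _ (cbody1 g hP).
Qed.

(* Axes are encoded by [None], [Some false], [Some true]; an edge by its axis
   and the values of the two other coordinates; a face (or the end of a chord
   on this face) by its axis and the value of the coordinate. *)
Definition axis : Type := option bool.
Definition edge : Type := (axis * bool * bool)%type.
Definition face : Type := (axis * bool)%type.
Notation X := (None : axis).
Notation Y := (Some false : axis).
Notation Z := (Some true : axis).

Definition bit (b : bool) : R := if b then 1 else 0.

Definition ept (e : edge) t : pt :=
  match e with
  | (None, u, v) => (t, bit u, bit v)
  | (Some false, u, v) => (bit u, t, bit v)
  | (Some true, u, v) => (bit u, bit v, t)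
  end.

Definition edir P (e : edge) : pt :=
  match e with
  | (None, u, v) => (0, a2 P - bit u, a3 P - bit v)
  | (Some false, u, v) => (b1 P - bit u, 0, b3 P - bit v)
  | (Some true, u, v) => (c1 P - bit u, c2 P - bit v, 0)
  end.

Definition qpt P (f : face) : pt :=
  match f with
  | (None, b) => (bit b, a2 P, a3 P)
  | (Some false, b) => (b1 P, bit b, b3 P)
  | (Some true, b) => (c1 P, c2 P, bit b)
  end.

(** Unlike [gpar1], this goes from new to old: it names, in the old coordinates, an edge given in
    the new ones. *)
Definition acte1 g (e : edge) : edge :=
  match g, e with
  | Cyc, (None, u, v) => (Y, v, u)
  | Cyc, (Some false, u, v) => (Z, v, u)
  | Cyc, (Some true, u, v) => (X, u, v)
  | Sig, (None, u, v) => (Y, ~~ u, ~~ v)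
  | Sig, (Some false, u, v) => (X, ~~ u, ~~ v)
  | Sig, (Some true, u, v) => (Z, ~~ v, ~~ u)
  | Tau, (None, u, v) => (X, ~~ v, ~~ u)
  | Tau, (Some false, u, v) => (Z, u, ~~ v)
  | Tau, (Some true, u, v) => (Y, u, ~~ v)
  | Rho, (None, u, v) => (X, u, ~~ v)
  | Rho, (Some false, u, v) => (Y, u, ~~ v)
  | Rho, (Some true, u, v) => (Z, u, v)
  | Xi, (None, u, v) => (X, u, v)
  | Xi, (Some false, u, v) => (Y, ~~ u, v)
  | Xi, (Some true, u, v) => (Z, ~~ u, v)
  end.

Definition actf1 g (f : face) : face :=
  match g, f with
  | Cyc, (None, b) => (Y, b)
  | Cyc, (Some false, b) => (Z, b)
  | Cyc, (Some true, b) => (X, b)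
  | Sig, (None, b) => (Y, ~~ b)
  | Sig, (Some false, b) => (X, ~~ b)
  | Sig, (Some true, b) => (Z, ~~ b)
  | Tau, (None, b) => (X, b)
  | Tau, (Some false, b) => (Z, ~~ b)
  | Tau, (Some true, b) => (Y, ~~ b)
  | Rho, (None, b) => (X, b)
  | Rho, (Some false, b) => (Y, b)
  | Rho, (Some true, b) => (Z, ~~ b)
  | Xi, (None, b) => (X, ~~ b)
  | Xi, (Some a, b) => (Some a, b)
  end.

Definition flip1 g (e : edge) : bool :=
  match g, e with
  | Sig, _ => true
  | Tau, (Some _, _, _) => true
  | Rho, (Some true, _, _) => true
  | Xi, (None, _, _) => true
  | _, _ => false
  end.

Definition flip (b : bool) t : R := if b then 1 - t else t.

Lemma bitN b : bit (~~ b) = 1 - bit b.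
Proof. by case: b; rewrite /bit /= ?subrr ?subr0. Qed.

Lemma gmap1_ept g e t : gmap1 g (ept e t) = ept (acte1 g e) (flip (flip1 g e) t).
Proof.
by move: e => [[[[]|] u] v]; case: g; apply: pt_eq; rewrite /flip /= ?bitN.
Qed.

Lemma glin1_edir g P e : glin1 g (edir (gpar1 g P) e) = edir P (acte1 g e).
Proof.
by move: e => [[[[]|] u] v]; case: g; apply: pt_eq; rewrite /= ?bitN; ring.
Qed.

Lemma gmap1_qpt g P f : gmap1 g (qpt (gpar1 g P) f) = qpt P (actf1 g f).
Proof.
by move: f => [[[]|] b]; case: g; apply: pt_eq; rewrite /= ?bitN; ring.
Qed.

Definition acte (w : seq gen) e : edge := foldr acte1 e w.
Definition actf (w : seq gen) f : face := foldr actf1 f w.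

End Frames.

(** * Transport of illumination along coordinate changes *)

Section Transport.
Variable R : realType.
Notation pt := (pt R).
Notation par := (par R).
Implicit Types (K I : pt -> Prop) (P : par) (p q d u m n : pt) (s t l : R).

Lemma gmap_ept w e : exists b, forall t : R,
  gmap w (ept e t) = ept (acte w e) (flip b t).
Proof.
elim: w => [|g w [b hb]] /=; first by exists false.
exists (flip1 g (acte w e) (+) b) => t; rewrite hb gmap1_ept.
by case: (flip1 _ _) b {hb} => [] []; rewrite /flip //=; congr ept; ring.
Qed.

Lemma glin_edir w P e : glin w (edir (gpar w P) e) = edir P (acte w e).
Proof. by elim: w P => //= g w IH P; rewrite IH glin1_edir. Qed.

Lemma gmap_qpt w P f : gmap w (qpt (gpar w P) f) = qpt P (actf w f).
Proof. by elim: w P => //= g w IH P; rewrite IH gmap1_qpt. Qed.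

Lemma glin1_cmb g l p q : glin1 g (cmb l p q) = cmb l (glin1 g p) (glin1 g q).
Proof.
by case: g p q => [] [[x y] z] [[x' y'] z']; apply: pt_eq => /=; ring.
Qed.

Lemma glin_cmb w l p q : glin w (cmb l p q) = cmb l (glin w p) (glin w q).
Proof. by elim: w => //= g w ->; exact: glin1_cmb. Qed.

Lemma glin1_mv g p s d : glin1 g (mv p s d) = mv (glin1 g p) s (glin1 g d).
Proof.
by case: g p d => [] [[x y] z] [[x' y'] z']; apply: pt_eq => /=; ring.
Qed.

Lemma glin_mv w p s d : glin w (mv p s d) = mv (glin w p) s (glin w d).
Proof. by elim: w => //= g w ->; exact: glin1_mv. Qed.

Lemma glin1_diff g p q : glin1 g (mv p (-1) q) = mv (gmap1 g p) (-1) (gmap1 g q).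
Proof.
by case: g p q => [] [[x y] z] [[x' y'] z']; apply: pt_eq => /=; ring.
Qed.

Lemma glin_diff w p q : glin w (mv p (-1) q) = mv (gmap w p) (-1) (gmap w q).
Proof.
elim: w => //= g w IH; rewrite IH.
by rewrite -glin1_diff.
Qed.

(* The direction d is a limit of directions illuminating q. *)
Definition weakI I d q : Prop := forall d' t,
  illum I d' q -> 0 < t -> t <= 1 -> illum I (cmb t d d') q.

(** Given a normal with [0 < dot n d], the inward direction [d'] is mixed with [d] in the ratio that
    makes the mixture orthogonal to [n]. The mixture would illuminate [q] although it stays in the
    supporting plane. *)
Lemma weakI_weak K I d q : body K I -> weakI I d q -> weak K d q.
Proof.
move=> hB wI n n0 sup; rewrite leNgt; apply/negP => nd.
have [m Im] := body_ne hB.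
pose d' := mv m (-1) q.
have Id' : illum I d' q.
  by exists 1 => //; apply: conv_eq Im _; apply: pt_eq => /=; ring.
have nd' := support_strict hB n0 sup Im.
pose t := dot n d / (dot n d + (dot n q - dot n m)).
have D0 : 0 < dot n d + (dot n q - dot n m) by lra.
have t0 : 0 < t by exact: divr_gt0.
have t1 : t <= 1 by rewrite ler_pdivrMr //; lra.
have [s s0 Is] := wI _ t Id' t0 t1.
have := support_strict hB n0 sup Is.
have -> : dot n (mv q s (cmb t d d')) = dot n q +
   s * ((1 - t) * dot n d - t * (dot n q - dot n m)).
  by rewrite /d' /dot /=; ring.
have -> : (1 - t) * dot n d - t * (dot n q - dot n m) = 0.
  by rewrite /t; field; rewrite gt_eqF.
by rewrite mulr0 addr0 ltxx.
Qed.

Lemma not_weakI K I d q : body K I -> ~ weakI I d q ->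
  exists n, [/\ n <> (0, 0, 0), forall k, K k -> dot n k <= dot n q
    & 0 < dot n d].
Proof.
move=> hB nw; apply: contrapT => hn; apply: nw => d' t; apply: (weak_mix hB).
by move=> n n0 sup; rewrite leNgt; apply/negP => nd; apply: hn; exists n.
Qed.

Lemma weakI_frame I w d p :
  weakI (fun x => I (gmap w x)) d p <-> weakI I (glin w d) (gmap w p).
Proof.
split=> h d' t.
  have [d'' <-] := glin_surj w d'; rewrite -glin_cmb -!illum_frame.
  exact: h.
rewrite !illum_frame glin_cmb; exact: h.
Qed.

(** In the second case the chord end lies on a half-open segment from [K] to the edge, so that
    whatever covers the edge covers it. *)
Definition covers K I P e f : Prop := illum I (edir P e) (qpt P f) \/
  exists k t l, [/\ K k, 0 <= t <= 1, 0 < l <= 1 & qpt P f = cmb l k (ept e t)].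

Lemma covers_frame K I P w e f : covers K I P (acte w e) (actf w f) <->
  covers (fun x => K (gmap w x)) (fun x => I (gmap w x)) (gpar w P) e f.
Proof.
rewrite /covers illum_frame glin_edir gmap_qpt.
have [b hb] := gmap_ept w e.
have fl t : 0 <= t <= 1 -> 0 <= flip b t <= 1.
  by case: (b); rewrite /flip //; lra.
have flK t : flip b (flip b t) = t by case: (b); rewrite /flip //; ring.
split=> -[h|[k [t [l [Kk ht hl e1]]]]]; [by left| |by left|]; right.
  have [k' ek] := gmap_surj w k; exists k', (flip b t), l; split=> //.
  - by rewrite ek.
  - exact: fl.
  - have inj : injective (@gmap R w).
      elim: (w) => // g w' IH x y /= h; apply: IH; move: h.
      case: (gmap w' x) (gmap w' y) => [[? ?] ?] [[? ?] ?].
      by case: g => /= -[] h1 h2 h3; apply: pt_eq => /=; lra.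
    by apply: inj; rewrite gmap_qpt gmap_cmb hb flK ek.
exists (gmap w k), (flip b t), l; split=> //; first exact: fl.
by rewrite -gmap_qpt e1 gmap_cmb hb.
Qed.

(* Directions by which the direction of an edge may be perturbed. *)
Definition tilting I P e u : Prop := exists m t0,
  [/\ I m, 0 <= t0 <= 1 & u = mv m (-1) (mv (ept e t0) 1 (edir P e))].

Lemma tilting_frame I P w e u :
  tilting (fun x => I (gmap w x)) (gpar w P) e u ->
  tilting I P (acte w e) (glin w u).
Proof.
move=> [m [t0 [Im h ->]]]; have [b hb] := gmap_ept w e.
exists (gmap w m), (flip b t0); split=> //.
  by case: (b); rewrite /flip //; lra.
by rewrite glin_diff gmap_mv hb glin_edir.
Qed.

End Transport.

(** * Eliminating the normal from the inequalities at a chord end *)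

Section CornerAlgebra.
Variable R : realType.
Implicit Types a b c u v r n D E : R.

(* The shape common to the two corner inequalities: D + r b is the coefficient
   left after eliminating one coordinate of the normal. *)
Lemma corner_le u v r b D n1 n : 0 <= b -> 0 < n1 -> 0 < D + r * b ->
  n1 * u <= n * b -> n * (D + r * b) <= n1 * (v + r * u) -> u * D <= b * v.
Proof.
move=> b0 n10 E0 h1 /(ler_wpM2l b0) h2; rewrite -(ler_pM2l n10).
have := ler_wpM2r (ltW E0) h1; lra.
Qed.

Lemma corner_lt u v r b D n1 n : 0 <= b -> 0 < n1 -> 0 < D + r * b ->
  n1 * u < n * b -> n * (D + r * b) <= n1 * (v + r * u) -> u * D < b * v.
Proof.
move=> b0 n10 E0 h1 /(ler_wpM2l b0) h2; rewrite -(ltr_pM2l n10).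
have : n1 * u * (D + r * b) < n * b * (D + r * b) by rewrite ltr_pM2r.
lra.
Qed.

(** The weights [a2 - c2] and [1 - a2] on the two inequalities eliminate [n2]. *)
Lemma hex_key a2 a3 b1 b3 c1 c2 n1 n2 n3 : c2 <= a2 -> a2 <= 1 ->
  - n1 * (1 - b1) + n2 * (1 - a2) + n3 * (b3 - a3) <= 0 ->
  - n1 * (1 - c1) + n2 * (c2 - a2) + n3 * (1 - a3) <= 0 ->
  n3 * (1 - a2 - a3 * (1 - c2) + (a2 - c2) * b3) <=
    n1 * ((1 - c1) * (1 - a2) + (a2 - c2) * (1 - b1)).
Proof.
rewrite -subr_ge0 -[a2 <= 1]subr_ge0 => /mulr_ge0_le0 h1 /mulr_ge0_le0 h2.
move=> /h1 e1 /h2 e2; clear h1 h2; lra.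
Qed.

Lemma hex_flat a2 a3 b3 n2 n3 : 0 < a2 -> a2 < 1 -> 0 < a3 -> n3 <= 0 ->
  - n2 * a2 + n3 * (b3 - a3) <= 0 -> n2 * (1 - a2) + n3 * (b3 - a3) <= 0 ->
  0 <= n3 * b3 -> n2 = 0 /\ n3 = 0.
Proof.
move=> a20 a21 a30 n30 B0 B1 nd.
have n3E : n3 = 0 by nra.
by split=> //; rewrite n3E in B0 B1; nra.
Qed.

End CornerAlgebra.

(** * Supporting planes at an end of the first chord *)

Section Corner.
Variable R : realType.
Notation pt := (pt R).
Notation par := (par R).
Variables (K I : pt -> Prop) (P : par).
Hypothesis hC : cbody K I P.
Local Notation a2 := (a2 P).
Local Notation a3 := (a3 P).
Local Notation b1 := (b1 P).
Local Notation b3 := (b3 P).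
Local Notation c1 := (c1 P).
Local Notation c2 := (c2 P).
Local Notation q0 := ((1, a2, a3) : pt).
Let hB : body K I := hC.

Lemma par_bounds : [/\ 0 <= a2 <= 1 /\ 0 <= a3 <= 1, 0 <= b1 <= 1 /\ 0 <= b3 <= 1
  & 0 <= c1 <= 1 /\ 0 <= c2 <= 1].
Proof.
have [_ h1 h2] := cb_box hC (cb_A hC (lexx 0) ler01).
have [h3 _ h4] := cb_box hC (cb_B hC (lexx 0) ler01).
have [h5 h6 _] := cb_box hC (cb_C hC (lexx 0) ler01).
by [].
Qed.

Lemma inner_x : exists2 m, I m & m.1.1 < 1.
Proof.
have [m Im] := body_ne hB; exists m => //.
have [e e0 he] := body_open hB (1, 0, 0) Im.
have [] := cb_box hC (body_sub hB (he e _)); first by rewrite gtr0_norm.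
by rewrite /=; lra.
Qed.

Lemma support_q0 (n : pt) : (forall k, K k -> dot n k <= dot n q0) ->
  [/\ 0 <= n.1.1,
     - n.1.1 * (1 - b1) - n.1.2 * a2 + n.2 * (b3 - a3) <= 0
   & - n.1.1 * (1 - b1) + n.1.2 * (1 - a2) + n.2 * (b3 - a3) <= 0] /\
  [/\ - n.1.1 * (1 - c1) + n.1.2 * (c2 - a2) - n.2 * a3 <= 0
   & - n.1.1 * (1 - c1) + n.1.2 * (c2 - a2) + n.2 * (1 - a3) <= 0].
Proof.
move=> sup; have := sup _ (cb_A hC (lexx 0) ler01).
have := sup _ (cb_B hC (lexx 0) ler01); have := sup _ (cb_B hC ler01 (lexx 1)).
have := sup _ (cb_C hC (lexx 0) ler01); have := sup _ (cb_C hC ler01 (lexx 1)).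
rewrite /dot /=; move=> *; split; split; lra.
Qed.

Lemma mark_hex : 0 < a3 -> a3 < 1 -> weakI I (edir P (Some false, true, false)) q0 ->
  exists2 u, tilting I P (Some false, true, false) u &
    ev (fun h => illum I (mv (edir P (Some false, true, false)) h u) q0).
Proof.
move=> h0 h1 wI.
pose w : pt := (0, 1, 0); pose e0 := ept (R := R) (Some false, true, false) 0.
have ew t : mv e0 t w = ept (Some false, true, false) t.
  by apply: pt_eq => /=; ring.
have [||m [t0 [Im t00 t01 hev]]] := @mark_tilt _ K I hB e0 w
    (edir P (Some false, true, false)) q0.
- exact: weakI_weak wI.
- move=> n n0 nd sup low.
  have [m Im m1] := inner_x.
  have := low _ 0 (body_sub hB Im) (lexx _) ler01.
  have := low _ 1 (cb_B hC (lexx 0) ler01) ler01 (lexx _).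
  have := low _ 0 (cb_B hC ler01 (lexx 1)) (lexx _) ler01.
  have := low _ 0 (cb_C hC (lexx 0) ler01) (lexx _) ler01.
  have [[n1 B0 B1] [C0 C1]] := support_q0 sup.
  move: nd; rewrite /dot /= /bit => nd l1 l2 l3 l4.
  (* As [dot n d = 0], the edge and the second chord have equal values under [n]; comparing each end
     of the edge with the opposite end of the chord makes [n] constant along them. The third chord
     then disposes of [n.2] and the interior point [m] of [n.1.1]. *)
  have n2 : n.1.2 = 0 by lra.
  rewrite n2 in C0 C1 l1 l2 l3 l4.
  have n3 : n.2 = 0 by nra.
  rewrite n3 in C0 C1 l1 l2 l3 l4.
  have n1' : n.1.1 = 0 by nra.
  by apply: n0; apply: pt_eq.
exists (tilt e0 w (edir P (Some false, true, false)) m t0) => //.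
by exists m, t0; split; rewrite ?t00 //; rewrite /tilt ew.
Qed.

(* With a bar for the complement to 1, this is the inequality
   1 <= a3 c2bar / a2bar + b3 c1bar / b1bar without denominators. *)
Lemma fail_le (n : pt) : a2 < 1 -> 0 < a3 -> a3 < 1 -> c2 <= a2 -> 0 < a2 ->
  n <> (0, 0, 0) -> (forall k, K k -> dot n k <= dot n q0) ->
  0 <= dot n (edir P (Some false, true, false)) ->
  (1 - b1) * (1 - a2 - a3 * (1 - c2)) <= b3 * ((1 - c1) * (1 - a2)).
Proof.
move=> h1 h2 h3 h4 h5 n0 sup; have [[n1 B0 B1] [C0 C1]] := support_q0 sup.
have [_ [/andP[_ b1u] /andP[b30 _]] [/andP[_ c1u] _]] := par_bounds.
rewrite /dot /= /bit => nd.
have nd' : n.1.1 * (1 - b1) <= n.2 * b3 by rewrite -subr_ge0; apply: le_trans nd _; lra.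
have key := hex_key h4 (ltW h1) B1 C1.
have u0 : 0 <= 1 - b1 by rewrite subr_ge0.
have c0 : 0 <= b3 * ((1 - c1) * (1 - a2)).
  by rewrite !mulr_ge0 // subr_ge0 // ltW.
have [D0|D0] := leP (1 - a2 - a3 * (1 - c2)) 0.
  exact: le_trans (mulr_ge0_le0 u0 D0) c0.
have E0 : 0 < 1 - a2 - a3 * (1 - c2) + (a2 - c2) * b3.
  by apply: ltr_pwDl => //; apply: mulr_ge0; rewrite ?subr_ge0.
move: n1; rewrite le_eqVlt => /orP[/eqP n10|n1]; last exact: corner_le key.
rewrite -n10 !(mul0r, oppr0, add0r) in B0 B1 key nd'.
have n3 : n.2 <= 0 by rewrite -(pmulr_lle0 _ E0).
rewrite -mulNr in B0.
have [m2 m3] := hex_flat h5 h1 h2 n3 B0 B1 nd'.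
by case: n0; apply: pt_eq.
Qed.

Lemma fail_lt (n : pt) : a2 < 1 -> 0 < a3 -> a3 < 1 -> c2 <= a2 -> 0 < a2 ->
  b1 < 1 ->
  (forall k, K k -> dot n k <= dot n q0) ->
  0 < dot n (edir P (Some false, true, false)) ->
  (1 - b1) * (1 - a2 - a3 * (1 - c2)) < b3 * ((1 - c1) * (1 - a2)).
Proof.
move=> h1 h2 h3 h4 h5 h6 sup; have [[n1 B0 B1] [C0 C1]] := support_q0 sup.
have [_ [/andP[_ b1u] /andP[b30 _]] [/andP[_ c1u] _]] := par_bounds.
rewrite /dot /= /bit => nd.
have nd' : n.1.1 * (1 - b1) < n.2 * b3 by rewrite -subr_gt0; apply: lt_le_trans nd _; lra.
have key := hex_key h4 (ltW h1) B1 C1.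
have u0 : 0 < 1 - b1 by rewrite subr_gt0.
have c0 : 0 <= b3 * ((1 - c1) * (1 - a2)).
  by rewrite !mulr_ge0 // subr_ge0 // ltW.
have nb : 0 < n.2 * b3 by apply: le_lt_trans nd'; rewrite mulr_ge0 // ltW.
have b3p : 0 < b3.
  by rewrite lt_neqAle b30 andbT eq_sym; apply: contraTneq nb => ->; rewrite mulr0 ltxx.
have n3 : 0 < n.2 by rewrite -(pmulr_lgt0 _ b3p).
have D1 : c2 = a2 -> 0 < 1 - a2 - a3 * (1 - c2).
  move=> ->; have -> : 1 - a2 - a3 * (1 - a2) = (1 - a2) * (1 - a3) by ring.
  by rewrite mulr_gt0 ?subr_gt0.
have [D0|D0] := ltP (1 - a2 - a3 * (1 - c2)) 0.
  by apply: lt_le_trans c0; rewrite pmulr_rlt0.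
have E0 : 0 < 1 - a2 - a3 * (1 - c2) + (a2 - c2) * b3.
  have [/eqP ca|ca] := boolP (c2 == a2).
    by rewrite {2}ca subrr mul0r addr0 D1.
  by apply: ltr_wpDl => //; apply: mulr_gt0 => //; rewrite subr_gt0 lt_neqAle ca.
have n1' : 0 < n.1.1.
  rewrite lt_neqAle n1 andbT eq_sym; apply/eqP => n10; rewrite n10 mul0r in key.
  by move: key; rewrite leNgt mulr_gt0.
exact: corner_lt key.
Qed.

End Corner.

(** * Algebra for a common direction of a chord end and a vertex, and for the edge [special] *)

Section RootAlgebra.
Variable R : realType.
Implicit Types a b c n : R.

Lemma root_weights a2 a3 b1 b3 c1 c2 : 0 <= c2 -> c2 < a2 -> a2 <= 1 ->
  0 < a3 -> a3 < 1 -> 0 <= b1 -> b1 < 1 -> 0 <= b3 <= 1 -> 0 <= c1 <= 1 ->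
  (1 - c1) * (1 - a2) * (1 - b3) < a3 * (1 - c2) * (1 - b1) ->
  exists lA lB lC th t, [/\ 0 < lA, 0 < lB, 0 < lC, 0 <= th & 0 <= t <= 1] /\
    [/\ lB * (1 - b1) + lC * (1 - c1) = th + (1 - c1),
        lC * (1 - c2) + lA * (1 - a2) = a2 - c2
      & lB * (1 - b3) + lA * (1 - a3) = a3 - t].
Proof.
move=> c20 ca a21 a30 a31 b10 b11 hb hc hlt.
have cc : 0 < 1 - c2 by lra.
have bb : 0 < 1 - b1 by lra.
have cb0 : 0 < (1 - c2) * (1 - b1) by exact: mulr_gt0.
(* [L0] is the value of [lB] forced in the limit case [lA = 0], [th = 0]. There [t] equals the
   number [g] below, positive by the last hypothesis; [lA = de] and [lB = L0 + e] deviate from the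
   limit within this margin. *)
pose L0 := (1 - c1) * (1 - a2) / ((1 - c2) * (1 - b1)).
have L0E : L0 * (1 - b1) * (1 - c2) = (1 - c1) * (1 - a2).
  by rewrite /L0; field; rewrite !gt_eqF.
have L00 : 0 <= L0 by apply: divr_ge0; [apply: mulr_ge0; lra|exact: ltW].
have g0 : 0 < a3 - L0 * (1 - b3) by rewrite subr_gt0 /L0 mulrAC ltr_pdivrMr //; lra.
move: L0 L0E L00 g0 => L0 L0E L00.
set g := a3 - L0 * (1 - b3) => g0.
pose e := g / 2; have e0 : 0 < e by rewrite /e; lra.
pose de := Num.min (g / 2) (Num.min ((a2 - c2) / 2) (e * ((1 - c2) * (1 - b1)))).
have de0 : 0 < de.
  by rewrite !lt_min; apply/and3P; split; [exact: e0|lra|exact: mulr_gt0].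
have de1 : de <= g / 2 by rewrite /de ge_min lexx.
have de2 : de <= (a2 - c2) / 2 by rewrite /de !ge_min lexx /= orbT.
have de3 : de <= e * ((1 - c2) * (1 - b1)) by rewrite /de !ge_min lexx !orbT.
clearbody de.
have ge : g = 2 * e by rewrite /e; lra.
have gE : g = a3 - L0 * (1 - b3) by [].
clearbody g e; clear hlt.
have lC0 : 0 < (a2 - c2 - de * (1 - a2)) / (1 - c2).
  apply: divr_gt0 => //; have : de * (1 - a2) <= de * 1 by apply: ler_wpM2l; lra.
  lra.
have lCE : (a2 - c2 - de * (1 - a2)) / (1 - c2) * (1 - c2) = a2 - c2 - de * (1 - a2).
  by rewrite divfK // gt_eqF.
move: (_ / (1 - c2)) lC0 lCE => lC lC0 lCE.
exists de, (L0 + e), lC, ((L0 + e) * (1 - b1) + lC * (1 - c1) - (1 - c1)),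
  (a3 - ((L0 + e) * (1 - b3) + de * (1 - a3))).
have h1 : 0 <= (L0 + e) * (1 - b3) by apply: mulr_ge0; lra.
have h2 : 0 <= de * (1 - a3) by apply: mulr_ge0; lra.
have h3 : de * (1 - a3) <= de * 1 by apply: ler_wpM2l; lra.
have h4 : e * (1 - b3) <= e * 1 by apply: ler_wpM2l; lra.
split; split=> //; first by apply: ltr_wpDl.
- rewrite -(pmulr_lge0 _ cc).
  have -> : ((L0 + e) * (1 - b1) + lC * (1 - c1) - (1 - c1)) * (1 - c2) =
     L0 * (1 - b1) * (1 - c2) + e * ((1 - c2) * (1 - b1)) +
     lC * (1 - c2) * (1 - c1) - (1 - c1) * (1 - c2) by ring.
  rewrite L0E lCE.
  have : de * ((1 - a2) * (1 - c1)) <= de * 1.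
    apply: ler_wpM2l; first exact: ltW.
    have a20 : 0 <= a2 by exact: le_trans c20 (ltW ca).
    by case/andP: hc => c10 c11; apply: mulr_ile1; rewrite ?subr_ge0 ?gerBl.
  lra.
- by apply/andP; split; lra.
- by rewrite subrK.
- by rewrite lCE; ring.
- by rewrite opprB addrCA subrr addr0.
Qed.

Lemma sum3_eq0 (lA lB lC uA uB uC : R) : 0 < lA -> 0 < lB -> 0 < lC ->
  0 <= uA -> 0 <= uB -> 0 <= uC -> 0 <= - (lB * uB + lC * uC + lA * uA) ->
  [/\ uA = 0, uB = 0 & uC = 0].
Proof.
move=> A0 B0 C0 uA0 uB0 uC0; have := mulr_ge0 (ltW A0) uA0.
have := mulr_ge0 (ltW B0) uB0; have := mulr_ge0 (ltW C0) uC0 => h1 h2 h3 h4.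
by split; [apply: (mulfI (lt0r_neq0 A0))|apply: (mulfI (lt0r_neq0 B0))
  |apply: (mulfI (lt0r_neq0 C0))]; rewrite mulr0; lra.
Qed.

(** The determinant of the system is a sum of two products of nonnegative numbers, the second of
    them positive. *)
Lemma three_planes a2 a3 b1 b3 c1 c2 (n1 n2 n3 : R) :
  0 <= 1 - a2 -> 0 < 1 - a3 -> 0 < 1 - b1 -> 0 <= 1 - b3 -> 0 <= 1 - c1 ->
  0 < 1 - c2 ->
  n2 * (1 - a2) + n3 * (1 - a3) = 0 -> n1 * (1 - b1) + n3 * (1 - b3) = 0 ->
  n1 * (1 - c1) + n2 * (1 - c2) = 0 -> [/\ n1 = 0, n2 = 0 & n3 = 0].
Proof.
move: (1 - a2) (1 - a3) (1 - b1) (1 - b3) (1 - c1) (1 - c2).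
move=> A2 A3 B1 B3 C1 C2 hA2 hA3 hB1 hB3 hC1 hC2 eA eB eC.
have D0 : 0 < A2 * B3 * C1 + A3 * B1 * C2.
  by apply: ltr_wpDl; [do !apply: mulr_ge0|do !apply: mulr_gt0].
have n10 : n1 = 0.
  apply: (mulIf (lt0r_neq0 D0)).
  transitivity (A2 * B3 * (n1 * C1 + n2 * C2) + A3 * C2 * (n1 * B1 + n3 * B3)
     - B3 * C2 * (n2 * A2 + n3 * A3)); first by ring.
  by rewrite eA eB eC; ring.
have n20 : n2 = 0.
  by apply: (mulIf (lt0r_neq0 hC2)); move: eC; rewrite n10; lra.
by split=> //; apply: (mulIf (lt0r_neq0 hA3)); move: eA; rewrite n20; lra.
Qed.

(** The weights [a3] and [b3 - a3] eliminate [n3]. *)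
Lemma special_key a2 a3 b1 b3 c1 c2 (n1 n2 n3 : R) : 0 < a3 -> a3 <= b3 ->
  - n1 * (1 - b1) + n2 * (1 - a2) + n3 * (b3 - a3) <= 0 ->
  - n1 * (1 - c1) + n2 * (c2 - a2) - n3 * a3 <= 0 ->
  n2 * ((1 - a2) * a3 - (b3 - a3) * (a2 - c2)) <=
    n1 * ((1 - b1) * a3 + (b3 - a3) * (1 - c1)).
Proof.
rewrite -[a3 <= b3]subr_ge0 => /ltW /mulr_ge0_le0 h1 /mulr_ge0_le0 h2.
move=> /h1 e1 /h2 e2; clear h1 h2; lra.
Qed.

Lemma special_flat a2 a3 b3 c2 (n2 n3 : R) : 0 < a2 -> 0 < a3 -> a3 < 1 -> n2 <= 0 ->
  - (n2 * a2) + n3 * (b3 - a3) <= 0 -> n2 * (1 - a2) + n3 * (b3 - a3) <= 0 ->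
  n2 * (c2 - a2) - n3 * a3 <= 0 -> n2 * (c2 - a2) + n3 * (1 - a3) <= 0 ->
  0 <= n2 * c2 -> n2 = 0 /\ n3 = 0.
Proof.
move=> a20 a30 a31 n20 B0 B1 C0 C1 nd.
have n2E : n2 = 0.
  apply/eqP; rewrite eq_le n20 leNgt; apply/negP => n2l.
  have h : 0 < - (n2 * a2) by rewrite -mulNr mulr_gt0 ?oppr_gt0.
  have n30 : 0 < n3 by nra.
  nra.
by split=> //; rewrite n2E in C0 C1; nra.
Qed.

End RootAlgebra.

(** * One direction for a chord end and a vertex *)

Section CornerRoot.
Variable R : realType.
Notation pt := (pt R).
Notation par := (par R).
Variables (K I : pt -> Prop) (P : par).
Hypothesis hC : cbody K I P.
Local Notation a2 := (a2 P).
Local Notation a3 := (a3 P).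
Local Notation b1 := (b1 P).
Local Notation b3 := (b3 P).
Local Notation c1 := (c1 P).
Local Notation c2 := (c2 P).
Local Notation q0 := ((1, a2, a3) : pt).
Let hB : body K I := hC.

Lemma illum_into (q d m : pt) (s h : R) : 0 < s -> K (mv q s d) -> I m -> 0 < h ->
  illum I (mv d h (mv m (-1) q)) q.
Proof.
move=> s0 Kq Im h0; have D0 : 0 < 1 + h * s by have := mulr_gt0 h0 s0; lra.
pose l := h * s / (1 + h * s).
have l0 : 0 < l by apply: divr_gt0 => //; exact: mulr_gt0.
have l1 : l <= 1 by rewrite ler_pdivrMr //; lra.
exists (s / (1 + h * s)); first exact: divr_gt0.
apply: conv_eq (body_star hB l0 l1 Kq Im) _.
by apply: pt_eq; rewrite /l /=; field; rewrite gt_eqF.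
Qed.

(* Such a direction is a nonnegative combination of vectors from q0 into K
   (towards the other end of its chord and a point of the third one) and a
   positive combination of the vectors from (1,1,1) to the nearest ends of the
   three chords. *)
Lemma root_corner : c2 < a2 -> 0 < a3 -> a3 < 1 -> b1 < 1 ->
  (1 - c1) * (1 - a2) * (1 - b3) < a3 * (1 - c2) * (1 - b1) ->
  exists d, illum I d q0 /\ illum I d (1, 1, 1).
Proof.
move=> ca a30 a31 b11 hlt.
have [[/andP[A A'] _] [/andP[B0 B1] hb] [hc /andP[C0 C1]]] := par_bounds hC.
have [lA [lB [lC [th [t [[A0 hB0 hC0 th0 /andP[t0 t1]] [e1 e2 e3]]]]]]] :=
  root_weights C0 ca A' a30 a31 B0 b11 hb hc hlt.
pose d : pt := (- th - (1 - c1), c2 - a2, t - a3).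
have Kq : K (mv q0 (1 + th)^-1 d).
  have D0 : 0 < 1 + th by exact: ltr_pwDl ltr01 th0.
  have l0 : 0 <= (1 + th)^-1 by rewrite invr_ge0 ltW.
  have l1 : (1 + th)^-1 <= 1 by rewrite invf_le1 // lerDl.
  apply: conv_eq (body_conv hB l0 l1 (cb_A hC (lexx 0) ler01) (cb_C hC t0 t1)) _.
  by apply: pt_eq; rewrite /d /=; field; rewrite gt_eqF.
have Iv : illum I d (1, 1, 1).
  apply: contrapT => /(illum_sep hB) [n [n0 sup nd]].
  have hA := sup _ (cb_A hC ler01 (lexx 1)).
  have hB' := sup _ (cb_B hC ler01 (lexx 1)).
  have hC' := sup _ (cb_C hC ler01 (lexx 1)).
  have ndE : dot n d = - (lB * (n.1.1 * (1 - b1) + n.2 * (1 - b3)) +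
      lC * (n.1.1 * (1 - c1) + n.1.2 * (1 - c2)) +
      lA * (n.1.2 * (1 - a2) + n.2 * (1 - a3))).
    transitivity (- (n.1.1 * (th + (1 - c1)) + n.1.2 * (a2 - c2) + n.2 * (a3 - t))).
      by rewrite /d /dot /=; ring.
    by rewrite -e1 -e2 -e3; ring.
  rewrite ndE /dot /= in nd hA hB' hC'.
  have uA : 0 <= n.1.2 * (1 - a2) + n.2 * (1 - a3) by lra.
  have uB : 0 <= n.1.1 * (1 - b1) + n.2 * (1 - b3) by lra.
  have uC : 0 <= n.1.1 * (1 - c1) + n.1.2 * (1 - c2) by lra.
  have [zA zB zC] : [/\ n.1.2 * (1 - a2) + n.2 * (1 - a3) = 0,
     n.1.1 * (1 - b1) + n.2 * (1 - b3) = 0 & n.1.1 * (1 - c1) + n.1.2 * (1 - c2) = 0].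
    exact: sum3_eq0 A0 hB0 hC0 uA uB uC nd.
  have [||||||n1 n2 n3] := three_planes _ _ _ _ _ _ zA zB zC.
  - by rewrite subr_ge0.
  - by rewrite subr_gt0.
  - by rewrite subr_gt0.
  - by case/andP: hb; rewrite subr_ge0.
  - by case/andP: hc; rewrite subr_ge0.
  - by rewrite subr_gt0; exact: lt_le_trans A'.
  by apply: n0; apply: pt_eq.
have [m Im] := body_ne hB.
(* So far [d] only leads [q0] into [K]. The push towards [m] that leads it into [I] can be taken
   small enough to keep [(1, 1, 1)] illuminated. *)
have [h h0 /(_ h h0 (lexx h)) Ih] := illum_dir_open hB (mv m (-1) q0) Iv.
exists (mv d h (mv m (-1) q0)); split=> //.
by apply: illum_into Kq Im h0; rewrite invr_gt0 ltr_pwDl.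
Qed.

Local Notation special := ((Some true, true, false) : edge).

(** The counterpart of [fail_le] for the edge [special], with [n.2] eliminated instead of
    [n.1.2]. *)
Lemma special_le (n : pt) : 0 < a2 -> a2 < 1 -> 0 < a3 -> a3 < 1 ->
  c2 <= a2 -> a3 <= b3 -> n <> (0, 0, 0) ->
  (forall k, K k -> dot n k <= dot n q0) ->
  0 <= dot n (edir P special) ->
  (1 - c1) * (a3 - a2 * b3) <= c2 * ((1 - b1) * a3).
Proof.
move=> h1 h2 h3 h4 h5 h6 n0 sup; have [[n1 B0 B1] [C0 C1]] := support_q0 hC sup.
have [_ [/andP[_ b1u] _] [/andP[_ c1u] /andP[c20 _]]] := par_bounds hC.
rewrite /dot /= /bit => nd.
have nd' : n.1.1 * (1 - c1) <= n.1.2 * c2 by rewrite -subr_ge0; apply: le_trans nd _; lra.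
have EE : a3 - a2 * b3 + (b3 - a3) * c2 = (1 - a2) * a3 - (b3 - a3) * (a2 - c2).
  by ring.
have key := special_key h3 h6 B1 C0; rewrite -EE in key.
have u0 : 0 <= 1 - c1 by rewrite subr_ge0.
have c0 : 0 <= c2 * ((1 - b1) * a3).
  by rewrite !mulr_ge0 ?subr_ge0 // ltW.
have [D0|D0] := leP (a3 - a2 * b3) 0.
  exact: le_trans (mulr_ge0_le0 u0 D0) c0.
have E0 : 0 < a3 - a2 * b3 + (b3 - a3) * c2.
  by apply: ltr_pwDl => //; apply: mulr_ge0; rewrite ?subr_ge0.
move: n1; rewrite le_eqVlt => /orP[/eqP n10|n1]; last exact: corner_le key.
rewrite -n10 !(mul0r, oppr0, add0r) in B0 B1 C0 C1 key nd'.
have n2 : n.1.2 <= 0 by rewrite -(pmulr_lle0 _ E0).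
have [m2 m3] := special_flat h1 h3 h4 n2 B0 B1 C0 C1 nd'.
by case: n0; apply: pt_eq.
Qed.

End CornerRoot.

(** * Inequalities forced by exposed ends *)

Section Natural.
Variable R : realType.
Notation pt := (pt R).
Notation par := (par R).
Implicit Types (K I : pt -> Prop) (P : par).

Local Notation hex := ((Some false, true, false) : edge).
Local Notation nonhex := ((Some false, true, true) : edge).
Local Notation special := ((Some true, true, false) : edge).
Local Notation f0 := ((None, true) : face).

(* [hex] and [nonhex] are the edges parallel to the y-axis of the face x = 1,
   which contains the end q0 of the first chord. Under the symmetries that
   preserve [natural], the edges [hex] and [special] form the hexagon of edges
   that avoid (0,0,0) and (1,1,1). *)
Definition natural P : Prop := [/\ b1 P <= c1 P, c2 P <= a2 P & a3 P <= b3 P].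

Lemma natural_cyc P : natural P -> natural (gpar1 Cyc P).
Proof. by case. Qed.

Lemma natural_sig P : natural P -> natural (gpar1 Sig P).
Proof. by case=> h1 h2 h3; split => /=; lra. Qed.

Definition inner P : Prop := [/\ 0 < a2 P, a2 P < 1, 0 < a3 P & a3 P < 1].

Definition chord_le P : Prop :=
  (1 - b1 P) * (1 - a2 P - a3 P * (1 - c2 P)) <= b3 P * ((1 - c1 P) * (1 - a2 P)).

Definition chord_lt P : Prop :=
  (1 - b1 P) * (1 - a2 P - a3 P * (1 - c2 P)) < b3 P * ((1 - c1 P) * (1 - a2 P)).

Lemma hex_le K I P : cbody K I P -> inner P -> c2 P <= a2 P ->
  ~ illum I (edir P hex) (qpt P f0) -> chord_le P.
Proof.
move=> hC [h1 h2 h3 h4] h5 /(illum_sep hC) [n [n0 sup nd]].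
exact: (fail_le hC h2 h3 h4 h5 h1 n0 sup nd).
Qed.

Lemma hex_lt K I P : cbody K I P -> inner P -> c2 P <= a2 P -> b1 P < 1 ->
  ~ weakI I (edir P hex) (qpt P f0) -> chord_lt P.
Proof.
move=> hC [h1 h2 h3 h4] h5 h6 /(not_weakI (cb_body hC)) [n [n0 sup nd]].
exact: (fail_lt hC h2 h3 h4 h5 h1 h6 sup nd).
Qed.

Lemma inner_rho P : inner P -> inner (gpar1 Rho P).
Proof. by case=> *; split => /=; lra. Qed.

Lemma illum_rho I P : illum (fun x => I (gmap1 Rho x)) (edir (gpar1 Rho P) hex)
    (qpt (gpar1 Rho P) f0) <-> illum I (edir P nonhex) (qpt P f0).
Proof.
have := illum_frame I [:: Rho] (edir (gpar [:: Rho] P) hex)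
  (qpt (gpar [:: Rho] P) f0).
by rewrite glin_edir gmap_qpt.
Qed.

Lemma weakI_rho I P : weakI (fun x => I (gmap1 Rho x)) (edir (gpar1 Rho P) hex)
    (qpt (gpar1 Rho P) f0) <-> weakI I (edir P nonhex) (qpt P f0).
Proof.
have := weakI_frame I [:: Rho] (edir (gpar [:: Rho] P) hex)
  (qpt (gpar [:: Rho] P) f0).
by rewrite glin_edir gmap_qpt.
Qed.

Definition exposed K I P : Prop :=
  [/\ inner P, ~ covers K I P hex f0 & ~ covers K I P nonhex f0].

Definition hex_strict I P : Prop := ~ weakI I (edir P hex) (qpt P f0).
Definition nonhex_strict I P : Prop := ~ weakI I (edir P nonhex) (qpt P f0).

Section Facts.
Variables (K I : pt -> Prop) (P : par).
Hypotheses (hC : cbody K I P) (hN : natural P) (hT : exposed K I P).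

Lemma exposed_le : chord_le P /\ chord_le (gpar1 Rho P).
Proof.
have [iP nh nn] := hT; have [n1 n2 n3] := hN; split.
  by apply: (hex_le hC) => // h; apply: nh; left.
apply: (hex_le (cbody1 Rho hC) (inner_rho iP)) => //.
by move=> /illum_rho h; apply: nn; left.
Qed.

(* Otherwise the second and third chord lie in the face of q0; then either q0
   lies on a segment from the second chord to the edge, or the face is the only
   support of K at q0. *)
Lemma b1_lt1 : hex_strict I P \/ nonhex_strict I P -> b1 P < 1.
Proof.
have [[a20 a21 a30 a31] nh _] := hT; have [n1 n2 n3] := hN.
have [_ [hb hb3] [hc _]] := par_bounds hC => hw.
rewrite ltNge; apply/negP => b11.
have b1E : b1 P = 1 by lra.
have c1E : c1 P = 1 by lra.
have [lt|ge] := ltP (a3 P) (b3 P).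
  apply: nh; right; exists (1, a2 P, b3 P), (a2 P), (1 - a3 P / b3 P).
  have b30 : 0 < b3 P by lra.
  split.
  - by rewrite -{1}b1E; apply: (cb_B hC); lra.
  - by lra.
  - apply/andP; split; last by rewrite gerBl divr_ge0 // ltW.
    by rewrite subr_gt0 ltr_pdivrMr // mul1r.
  - by apply: pt_eq; rewrite /= /bit; field; rewrite gt_eqF.
have b3E : b3 P = a3 P by lra.
have key e : e = hex \/ e = nonhex -> weakI I (edir P e) (qpt P f0).
  move=> he; apply: contrapT => /(not_weakI (cb_body hC)) [n [n0 sup nd]].
  have [[m1 B0 B1] [C0 C1]] := support_q0 hC sup.
  rewrite b1E c1E b3E in B0 B1 C0 C1.
  have m2 : n.1.2 = 0.
    have [x0 x1] : n.1.2 <= 0 /\ 0 <= n.1.2 by split; nra.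
    by apply/eqP; rewrite eq_le x0 x1.
  rewrite m2 in C0 C1.
  have m3 : n.2 = 0.
    have [x0 x1] : n.2 <= 0 /\ 0 <= n.2 by split; nra.
    by apply/eqP; rewrite eq_le x0 x1.
  by case: he nd => ->; rewrite /dot /= b1E m2 m3 /bit; lra.
by case: hw; apply; apply: key; [left|right].
Qed.

Lemma hex_strict_lt : hex_strict I P -> chord_lt P.
Proof.
move=> h; have [iP _ _] := hT; have [n1 n2 n3] := hN.
by apply: (hex_lt hC) => //; apply: b1_lt1; left.
Qed.

Lemma nonhex_strict_lt : nonhex_strict I P -> chord_lt (gpar1 Rho P).
Proof.
move=> h; have [iP _ _] := hT; have [n1 n2 n3] := hN.
apply: (hex_lt (cbody1 Rho hC) (inner_rho iP)) => //.
  by apply: b1_lt1; right.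
by move=> /weakI_rho.
Qed.

(** In the sum of the inequalities for [hex] and [nonhex], one of them strict, [a3] and [b3] cancel;
    with [b1 <= c1], a factor [1 - b1] can be divided out. *)
Lemma strict_ca : hex_strict I P \/ nonhex_strict I P -> c2 P < a2 P.
Proof.
move=> hw; have [V V'] := exposed_le; have b11 := b1_lt1 hw.
have [[a20 a21 a30 a31] _ _] := hT; have [n1 n2 n3] := hN.
have [_ [hb hb3] [hc _]] := par_bounds hC.
have : (1 - b1 P) * (2 * (1 - a2 P) - (1 - c2 P)) < (1 - c1 P) * (1 - a2 P).
  case: hw => [/hex_strict_lt|/nonhex_strict_lt] h; move: V V' h; rewrite /chord_le /chord_lt /=; lra.
have : (1 - c1 P) * (1 - a2 P) <= (1 - b1 P) * (1 - a2 P).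
  by apply: ler_wpM2r; lra.
move=> h1 h2; have : (1 - b1 P) * (1 - a2 P - (1 - c2 P)) < 0 by lra.
by rewrite pmulr_rlt0; lra.
Qed.

Lemma hex_strict_root : hex_strict I P ->
  exists d, illum I d (qpt P f0) /\ illum I d (1, 1, 1).
Proof.
move=> h; have [[a20 a21 a30 a31] _ _] := hT; have [n1 n2 n3] := hN.
have [_ [hb hb3] [hc _]] := par_bounds hC.
apply: (root_corner hC) => //; [exact: strict_ca (or_introl h)
  |exact: b1_lt1 (or_introl h)|].
have := hex_strict_lt h; rewrite /chord_lt.
have : (1 - c1 P) * (1 - a2 P) <= (1 - b1 P) * (1 - a2 P).
  by apply: ler_wpM2r; lra.
lra.
Qed.

Lemma nonhex_strict_root : nonhex_strict I P ->
  exists d, illum I d (qpt P f0) /\ illum I d (1, 1, 0).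
Proof.
move=> h; have [[a20 a21 a30 a31] _ _] := hT; have [n1 n2 n3] := hN.
have [_ [hb hb3] [hc _]] := par_bounds hC.
have [||||| d [h1 h2]] := root_corner (cbody1 Rho hC).
- exact: strict_ca (or_intror h).
- by rewrite /=; lra.
- by rewrite /=; lra.
- exact: b1_lt1 (or_intror h).
- have := nonhex_strict_lt h; rewrite /chord_lt /=.
  have : (1 - c1 P) * (1 - a2 P) <= (1 - b1 P) * (1 - a2 P).
    by apply: ler_wpM2r; lra.
  lra.
exists (glin [:: Rho] d); split.
  have := (illum_frame I [:: Rho] d _).1 h1; congr illum.
  by apply: pt_eq; rewrite /= /bit; ring.
have := (illum_frame I [:: Rho] d _).1 h2; congr illum.
by apply: pt_eq; rewrite /=; ring.
Qed.

(** If [b1 = 1], the second chord lies in the face and [q0] is on a segment from it to [hex], which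
    is excluded, or to [special]. Otherwise failure of [special], multiplied with the inequality for
    [nonhex], bounds [F * G] by [c2 * a3 * (1 - b3) * (1 - a2)]; but [F * G] exceeds this by
    [a3 - a2] times a positive sum. *)
Lemma bad_special : a2 P < a3 P -> covers K I P special f0.
Proof.
move=> bad; have [[a20 a21 a30 a31] nh nn] := hT; have [n1 n2 n3] := hN.
have [_ [/andP[b10 b11] /andP[b30 b31]] [/andP[c10 c11] /andP[c20 c21]]] :=
  par_bounds hC.
have [b1E|b1N] := eqVneq (b1 P) 1.
  have [lt|ge] := ltP (a3 P) (b3 P).
    exfalso; apply: nh; right; exists (1, a2 P, b3 P), (a2 P), (1 - a3 P / b3 P).
    have b30' : 0 < b3 P by lra.
    split.
    - by rewrite -{1}b1E; apply: (cb_B hC); lra.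
    - by lra.
    - apply/andP; split; last by rewrite gerBl divr_ge0 // ltW.
      by rewrite subr_gt0 ltr_pdivrMr // mul1r.
    - by apply: pt_eq; rewrite /= /bit; field; rewrite gt_eqF.
  right; exists (1, 1, a3 P), (a3 P), (1 - a2 P); split.
  - have -> : a3 P = b3 P by lra.
    by rewrite -{1}b1E; apply: (cb_B hC).
  - by lra.
  - by lra.
  - by apply: pt_eq; rewrite /= /bit; ring.
have b1' : 0 < 1 - b1 P by rewrite subr_gt0 lt_neqAle b1N.
apply: contrapT => ns.
have [|n [n0 sup nd]] := illum_sep hC (d := edir P special) (p := qpt P f0).
  by move=> h; apply: ns; left.
have S := special_le hC a20 a21 a30 a31 n2 n3 n0 sup nd.
have [_] := exposed_le; rewrite /chord_le /= => V.
pose F := a3 P - a2 P * b3 P.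
pose G := 1 - a2 P - (1 - a3 P) * (1 - c2 P).
have F0 : 0 < F.
  have : a2 P * b3 P <= a2 P * 1 by apply: ler_wpM2l; lra.
  rewrite /F; lra.
have FG : c2 P * a3 P * ((1 - b3 P) * (1 - a2 P)) < F * G.
  have h1 : 0 <= (a2 P - c2 P) * (1 - b3 P) by apply: mulr_ge0; lra.
  have h2 : 0 <= (1 - a3 P) * c2 P by apply: mulr_ge0; lra.
  have D0 : 0 < a3 P - a2 P by lra.
  have : 0 < (a3 P - a2 P) * ((a3 P - a2 P) + (1 - a3 P) * c2 P +
     (a2 P - c2 P) * (1 - b3 P)) by apply: mulr_gt0; lra.
  rewrite /F /G; lra.
have h1 : F * ((1 - b1 P) * G) <= F * ((1 - b3 P) * ((1 - c1 P) * (1 - a2 P))).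
  by rewrite ler_pM2l // /G.
have h2 : (1 - b3 P) * (1 - a2 P) * ((1 - c1 P) * F) <=
    (1 - b3 P) * (1 - a2 P) * (c2 P * ((1 - b1 P) * a3 P)).
  by apply: ler_wpM2l => //; apply: mulr_ge0; lra.
have h3 : (1 - b1 P) * (c2 P * a3 P * ((1 - b3 P) * (1 - a2 P))) <
    (1 - b1 P) * (F * G) by rewrite ltr_pM2l.
lra.
Qed.

End Facts.

(** The inequalities at the ends on x = 1 and y = 1, weighted by [1 - b3] and [1 - b1]: the sum
    factors, and the second factor is positive for inner ends. *)
Lemma pair_sum P :
  (1 - b3 P) * ((1 - b1 P) * (1 - a2 P - a3 P * (1 - c2 P)) -
     b3 P * ((1 - c1 P) * (1 - a2 P))) +
  (1 - b1 P) * ((1 - c2 P) * (1 - b3 P - b1 P * (1 - a3 P)) -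
     c1 P * ((1 - a2 P) * (1 - b3 P))) =
  (1 - b1 P - b3 P) *
   ((1 - c1 P) * (1 - a2 P) * (1 - b3 P) + (1 - c2 P) * (1 - a3 P) * (1 - b1 P)).
Proof. by ring. Qed.

Lemma pair_le P : natural P -> 0 <= 1 - c1 P -> inner P -> inner (gpar1 Cyc P) ->
  chord_le P -> chord_le (gpar1 Cyc P) -> 1 - b1 P - b3 P <= 0.
Proof.
case=> n1 n2 n3 hc [h1 h2 h3 h4] [h5 h6 h7 h8]; rewrite /chord_le /= in h5 h6 h7 h8 *.
rewrite -subr_le0 => V; rewrite -subr_le0 => V'; have := pair_sum P.
have D0 : 0 < (1 - c1 P) * (1 - a2 P) * (1 - b3 P) + (1 - c2 P) * (1 - a3 P) * (1 - b1 P).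
  by apply: ltr_wpDl; [do !apply: mulr_ge0|do !apply: mulr_gt0]; lra.
have b3' : 0 <= 1 - b3 P by lra.
have b1' : 0 <= 1 - b1 P by lra.
have := mulr_ge0_le0 b3' V; have := mulr_ge0_le0 b1' V' => s1 s2 e.
by rewrite -(pmulr_lle0 _ D0) -e; lra.
Qed.

Lemma pair_lt P : natural P -> 0 <= 1 - c1 P -> inner P -> inner (gpar1 Cyc P) ->
  chord_le P -> chord_le (gpar1 Cyc P) -> chord_lt P \/ chord_lt (gpar1 Cyc P) ->
  1 - b1 P - b3 P < 0.
Proof.
case=> n1 n2 n3 hc [h1 h2 h3 h4] [h5 h6 h7 h8].
rewrite /chord_le /chord_lt /= in h5 h6 h7 h8 *.
rewrite -subr_le0 => V; rewrite -subr_le0 => V'; have := pair_sum P.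
have D0 : 0 < (1 - c1 P) * (1 - a2 P) * (1 - b3 P) + (1 - c2 P) * (1 - a3 P) * (1 - b1 P).
  by apply: ltr_wpDl; [do !apply: mulr_ge0|do !apply: mulr_gt0]; lra.
have b3' : 0 < 1 - b3 P by lra.
have b1' : 0 < 1 - b1 P by lra.
have := mulr_ge0_le0 (ltW b3') V; have := mulr_ge0_le0 (ltW b1') V' => s1 s2 e.
rewrite -(pmulr_llt0 _ D0) -e => -[] s.
  by rewrite -(ltr_pM2l b3') in s; lra.
by rewrite -(ltr_pM2l b1') in s; lra.
Qed.

End Natural.

(** * Covering the body from the edges and the chord ends *)

Section Assembly.
Variable R : realType.
Notation pt := (pt R).
Notation par := (par R).
Implicit Types (x y z s t l u v a b h : R).

Lemma exit1 a u : 0 <= a -> a <= 1 -> 0 <= u -> u <= 1 ->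
  exists r (e : bool), [/\ 0 <= r, r <= 1, u = (1 - r) * a + r * bit R e
    & r = 0 -> u = a].
Proof.
move=> a0 a1 u0 u1; have [ua|ua|ua] := ltgtP u a.
- have a0' : 0 < a by lra.
  exists ((a - u) / a), false; split; rewrite /bit.
  + by apply: divr_ge0; lra.
  + by rewrite ler_pdivrMr //; lra.
  + by field; rewrite gt_eqF.
  + by move=> /(congr1 (fun r => r * a)); rewrite divfK ?gt_eqF //; lra.
- have a1' : 0 < 1 - a by lra.
  exists ((u - a) / (1 - a)), true; split; rewrite /bit.
  + by apply: divr_ge0; lra.
  + by rewrite ler_pdivrMr //; lra.
  + by field; rewrite gt_eqF.
  + by move=> /(congr1 (fun r => r * (1 - a))); rewrite divfK ?gt_eqF //; lra.
- by exists 0, true; split => //; rewrite ?ler01 // ua; lra.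
Qed.

(** Radial projection from [(a, b)] onto the boundary of the square; [l] is the larger of the two
    ratios found by [exit1], that of the coordinate which leaves first. *)
Lemma exit2 a b u v : 0 <= a <= 1 -> 0 <= b <= 1 -> 0 <= u <= 1 -> 0 <= v <= 1 ->
  (u = a /\ v = b) \/ exists l u' v', [/\ 0 < l, l <= 1, 0 <= u' <= 1, 0 <= v' <= 1 &
    [/\ u = (1 - l) * a + l * u', v = (1 - l) * b + l * v' &
     (exists e, u' = bit R e) \/ (exists e, v' = bit R e)]].
Proof.
move=> /andP[a0 a1] /andP[b0 b1] /andP[u0 u1] /andP[v0 v1].
have [r [e [r0 r1 eu ru]]] := exit1 a0 a1 u0 u1.
have [s [f [s0 s1 ev sv]]] := exit1 b0 b1 v0 v1.
have bb (c : bool) : 0 <= bit R c <= 1 by case: c; rewrite /bit lexx ler01.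
have mix (x y : R) (c : bool) : 0 <= x -> x <= 1 -> 0 <= y -> y <= 1 ->
   0 <= (1 - x) * y + x * bit R c <= 1.
  move=> x0 x1 y0 y1; have := bb c; move: (bit R c) => w hw; apply/andP.
  by split; nra.
have [rs|sr] := leP s r.
  have [r00|rn0] := eqVneq r 0.
    by left; split; [exact: ru|apply: sv; lra].
  have rp : 0 < r by rewrite lt_neqAle eq_sym rn0.
  have m0 : 0 <= s / r by apply: divr_ge0.
  have m1 : s / r <= 1 by rewrite ler_pdivrMr // mul1r.
  right; exists r, (bit R e), ((1 - s / r) * b + s / r * bit R f).
  split=> //; first exact: mix.
  split=> //; last by left; exists e.
  by rewrite ev; field; rewrite gt_eqF.
have sp : 0 < s by lra.
have m0 : 0 <= r / s by apply: divr_ge0.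
have m1 : r / s <= 1 by rewrite ler_pdivrMr // mul1r ltW.
right; exists s, ((1 - r / s) * a + r / s * bit R e), (bit R f).
split=> //; first exact: mix.
split=> //; last by right; exists f.
by rewrite eu; field; rewrite gt_eqF.
Qed.

Lemma affine_root A B : A <= 0 -> 0 <= B -> exists t,
  [/\ 0 <= t, t <= 1, (1 - t) * A + t * B = 0
    & forall t', t <= t' -> 0 <= (1 - t') * A + t' * B].
Proof.
move=> A0 B0; have [->|An0] := eqVneq A 0.
  by exists 0; split=> // [|t' t'0]; [ring|rewrite mulr0 add0r; exact: mulr_ge0].
have D0 : 0 < B - A by rewrite subr_gt0; apply: lt_le_trans B0; rewrite lt_neqAle An0.
have tE : - A / (B - A) * (B - A) = - A by rewrite divfK // gt_eqF.
exists (- A / (B - A)); split.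
- by apply: divr_ge0; [rewrite oppr_ge0|exact: ltW].
- by rewrite ler_pdivrMr // mul1r; lra.
- by move: tE; move: (- A / _) => t; lra.
- move=> t' ht; have := ler_wpM2r (ltW D0) ht; rewrite tE; lra.
Qed.

(** An intermediate value theorem for the minimum of two affine functions: go to the root of one,
    and on to the root of the other if that is still negative. *)
Lemma affine_min A B C D : 0 <= B -> 0 <= D -> A <= 0 \/ C <= 0 ->
  exists t, [/\ 0 <= t, t <= 1 &
    (1 - t) * A + t * B = 0 /\ 0 <= (1 - t) * C + t * D \/
    (1 - t) * C + t * D = 0 /\ 0 <= (1 - t) * A + t * B].
Proof.
move=> B0 D0; wlog A0 : A B C D B0 D0 / A <= 0 => [hw|_].
  case=> h; first exact: hw _ _ _ _ B0 D0 h (or_introl h).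
  have [t [t0 t1 ht]] := hw C D A B D0 B0 h (or_introl h).
  by exists t; split=> //; case: ht; [right|left].
have [t [t0 t1 tz tm]] := affine_root A0 B0.
have [V0|V0] := leP 0 ((1 - t) * C + t * D); first by exists t; split=> //; left.
have [u [u0 u1 uz _]] := affine_root (ltW V0) D0.
have tu : t <= t + (1 - t) * u.
  by rewrite lerDl; apply: mulr_ge0 => //; rewrite subr_ge0.
exists (t + (1 - t) * u); split.
- exact: le_trans tu.
- by have : (1 - t) * u <= (1 - t) * 1; [apply: ler_wpM2l; rewrite ?subr_ge0|lra].
- by right; split; [rewrite -[RHS]uz; ring|exact: tm].
Qed.

(* The broken line through (0,0), (h,y) and (0,1) separates (f0,f1) from
   (0,eta). *)
Lemma crossing h y f0 f1 eta : 0 < h -> 0 < y -> y < 1 -> 0 <= eta -> eta <= 1 ->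
  0 <= f0 -> h * f1 <= y * f0 \/ h * (1 - f1) <= (1 - y) * f0 ->
  exists t l, [/\ 0 <= t, t <= 1, 0 <= l & l <= 1] /\
    ((1 - t) * f0 = l * h /\ (1 - t) * f1 + t * eta = l * y \/
     (1 - t) * f0 = l * h /\ (1 - t) * f1 + t * eta = 1 - l * (1 - y)).
Proof.
move=> h0 y0 y1 e0 e1 f00 hf.
have [||| t [t0 t1 ht]] := @affine_min (h * f1 - y * f0) (h * eta)
    (h * (1 - f1) - (1 - y) * f0) (h * (1 - eta)).
- by apply: mulr_ge0; lra.
- by apply: mulr_ge0; lra.
- by case: hf; [left|right]; lra.
have g0 : 0 <= (1 - t) * f0 by apply: mulr_ge0; lra.
exists t, ((1 - t) * f0 / h).
have lE : (1 - t) * f0 / h * h = (1 - t) * f0 by rewrite divfK // gt_eqF.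
have l0 : 0 <= (1 - t) * f0 / h by apply: divr_ge0 => //; exact: ltW.
move: (_ / h) lE l0 => l lE l0.
suff [l1 H] : l <= 1 /\ ((1 - t) * f1 + t * eta = l * y \/
    (1 - t) * f1 + t * eta = 1 - l * (1 - y)).
  by split=> //; case: H; [left|right].
rewrite -(ler_pM2l h0).
by case: ht => -[h1 h2]; split; nra.
Qed.

(** Makes [(x - l * h) / (1 - l)] a parameter of the first chord: from that point, one at coordinate
    [x] is met on the way to one at coordinate [h]. *)
Lemma slide_left (l x h : R) : l <= 1 -> 0 <= h <= 1 -> l * h <= x -> x < h ->
  [/\ x - l * h <= 1 - l, 0 <= x - l * h & l = 1 -> h = x].
Proof.
move=> l1 /andP[_ h1] bd lt; split; last by move=> le; rewrite le in bd; lra.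
  rewrite -subr_ge0 in l1; have := ler_wpM2l l1 h1; lra.
by rewrite subr_ge0.
Qed.

Lemma slide_right (l x h : R) : 0 <= l -> l <= 1 -> 0 <= h <= 1 ->
  l * h <= 1 - x -> 1 - x < h ->
  [/\ 0 <= 1 - h <= 1, x - l * (1 - h) <= 1 - l, 0 <= x - l * (1 - h)
    & l = 1 -> 1 - h = x].
Proof.
move=> l0 l1 /andP[h0 h1] bd lt; rewrite subr_ge0 gerBl h0 h1.
split=> //; first by lra.
  rewrite -[h <= 1]subr_ge0 in h1; have := ler_wpM2r h1 l1; lra.
by move=> le; rewrite le in bd; lra.
Qed.

Section Body.
Variables (K I : pt -> Prop) (P : par).
Hypothesis hC : cbody K I P.
Local Notation a2 := (a2 P).
Local Notation a3 := (a3 P).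
Local Notation b1 := (b1 P).
Local Notation b3 := (b3 P).
Local Notation c1 := (c1 P).
Local Notation c2 := (c2 P).
Variable Cov : pt -> Prop.
Hypothesis star : forall l c p, K c -> Cov p -> 0 < l -> l <= 1 -> Cov (cmb l c p).

(* In the second case a broken line with the same ends is covered instead of
   the edge {x = 1, z = 1} (or {x = 0, z = 1}), and a supporting plane of K
   through the end of the first chord cuts this edge off from K. *)
Definition side (s : bool) : Prop :=
  (forall t, 0 <= t -> t <= 1 -> Cov (flip s 0, t, 1)) \/
  exists v2 v3 h y, [/\ [/\ 0 < h, h <= 1, 0 < y & y < 1],
    forall p, K p -> v2 * (p.1.2 - a2) + v3 * (p.2 - a3) <= flip s p.1.1,
    [/\ 0 <= - v2 * a2 + v3 * (1 - a3), 0 <= v2 * (1 - a2) + v3 * (1 - a3) &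
      h <= v2 * (y - a2) + v3 * (1 - a3)]
  & forall l, 0 <= l -> l <= 1 ->
      Cov (flip s (l * h), l * y, 1) /\ Cov (flip s (l * h), 1 - l * (1 - y), 1)].

Hypothesis covq : forall f, Cov (qpt P f).
Hypothesis cove : forall e t, 0 <= t -> t <= 1 ->
  e <> (Some false, true, true) -> e <> (Some false, false, true) -> Cov (ept e t).
Hypothesis sideL : side false.
Hypothesis sideR : side true.

Lemma side_all (s : bool) : side s. Proof. by case: s. Qed.

Lemma cov_faceY (b : bool) x z : 0 <= x <= 1 -> 0 <= z <= 1 -> Cov (x, bit R b, z).
Proof.
move=> hx hz; have [_ [hb1 hb3] _] := par_bounds hC.
have Kq : K (qpt P (Some false, b)).
  by case: b; [exact: (cb_B hC ler01 (lexx 1))|exact: (cb_B hC (lexx 0) ler01)].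
have [[-> ->]|[l [u [v [l0 l1 hu hv [-> -> he]]]]]] := exit2 hb1 hb3 hx hz.
  exact: covq (Some false, b).
have Ce : Cov (u, bit R b, v).
  case: he => -[e ->].
    by apply: (cove (e := (Some true, e, b))) => //; case/andP: hv.
  by apply: (cove (e := (None, b, e))) => //; case/andP: hu.
apply: conv_eq (star Kq Ce l0 l1) _; apply: pt_eq => //=; ring.
Qed.

Lemma cov_faceZ0 x y : 0 <= x <= 1 -> 0 <= y <= 1 -> Cov (x, y, 0).
Proof.
move=> hx hy; have [_ _ [hc1 hc2]] := par_bounds hC.
have Kq : K (qpt P (Some true, false)) by exact: (cb_C hC (lexx 0) ler01).
have [[-> ->]|[l [u [v [l0 l1 hu hv [-> -> he]]]]]] := exit2 hc1 hc2 hx hy.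
  exact: covq (Some true, false).
have Ce : Cov (u, v, 0).
  case: he => -[e ->].
    by apply: (cove (e := (Some false, e, false))) => //; case/andP: hv.
  by apply: (cove (e := (None, e, false))) => //; case/andP: hu.
apply: conv_eq (star Kq Ce l0 l1) _; apply: pt_eq => //=; ring.
Qed.

(** [h] is the depth of the broken line at [y]. A point of the face z = 1 at least that deep, met on
    the way from [(q0, q1, 1)] to the missing edge, is covered because the rest of the way crosses
    the broken line. *)
Lemma side_at (s : bool) y : 0 <= y -> y <= 1 -> exists v2 v3 h, [/\ 0 <= h <= 1,
    forall p, K p -> v2 * (p.1.2 - a2) + v3 * (p.2 - a3) <= flip s p.1.1,
    h <= v2 * (y - a2) + v3 * (1 - a3), Cov (flip s h, y, 1) &
    forall x, h <= flip s x -> 0 <= flip s x -> forall q0 q1 m,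
      K (q0, q1, 1) -> 0 < m -> m <= 1 ->
      forall eta, 0 <= eta -> eta <= 1 ->
      (x, y, 1) = cmb m (q0, q1, 1) (flip s 0, eta, 1) -> Cov (x, y, 1)].
Proof.
move=> y0 y1; case: (side_all s) => [hs|].
  exists 0, 0, 0; split.
  - by rewrite lexx ler01.
  - move=> p Kp; have [/andP[? ?] _ _] := cb_box hC Kp.
    by rewrite !mul0r addr0 /flip; case: s {hs}; lra.
  - lra.
  - exact: hs.
  - move=> x _ _ q0 q1 m Kq m0 m1 eta e0 e1 ->.
    by apply: star => //; exact: hs.
move=> [v2 [v3 [h [w [[h0 h1 w0 w1] hcut [L0 L1 Lw] hcov]]]]].
have [l [k [l0 l1 kh [k0 k1]]]] : exists l k, [/\ 0 <= l, l <= 1, k = l * h &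
    0 <= k <= 1 /\ (y = l * w /\ y <= w \/ y = 1 - l * (1 - w) /\ w <= y)].
  have [yw|yw] := leP y w.
    exists (y / w), (y / w * h).
    have l0 : 0 <= y / w by apply: divr_ge0 => //; exact: ltW.
    have l1 : y / w <= 1 by rewrite ler_pdivrMr // mul1r.
    split=> //; split; last by left; rewrite divfK ?gt_eqF.
    by apply/andP; split; [apply: mulr_ge0 => //; exact: ltW|apply: mulr_ile1 => //; exact: ltW].
  have w1' : 0 < 1 - w by lra.
  exists ((1 - y) / (1 - w)), ((1 - y) / (1 - w) * h).
  have l0 : 0 <= (1 - y) / (1 - w) by apply: divr_ge0; lra.
  have l1 : (1 - y) / (1 - w) <= 1 by rewrite ler_pdivrMr // mul1r; lra.
  split=> //; split; last by right; rewrite divfK ?gt_eqF //; split; [ring|exact: ltW].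
  by apply/andP; split; [apply: mulr_ge0 => //; exact: ltW|apply: mulr_ile1 => //; exact: ltW].
exists v2, v3, k; split => //.
- have hl : l * h <= l * (v2 * (w - a2) + v3 * (1 - a3)) by apply: ler_wpM2l.
  have l0' : 0 <= 1 - l by lra.
  rewrite kh; case: k1 => -[-> _].
    have := mulr_ge0 l0' L0; lra.
  have := mulr_ge0 l0' L1; lra.
- by rewrite kh; case: k1 => -[-> _]; have [] := hcov l l0 l1.
- move=> x kx x0 q0 q1 m Kq m0 m1 eta e0 e1 e.
  have hf : h * y <= w * flip s x \/ h * (1 - y) <= (1 - w) * flip s x.
    case: k1 => -[ey _]; [left|right].
      by rewrite ey; have := ler_wpM2l (ltW w0) kx; rewrite kh; lra.
    have w1' : 0 <= 1 - w by lra.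
    by rewrite {1}ey; have := ler_wpM2l w1' kx; rewrite kh; lra.
  have [t [k' [[t0 t1 k'0 k'1] hk]]] := crossing h0 w0 w1 e0 e1 x0 hf.
  have Cg : Cov (flip s ((1 - t) * flip s x), (1 - t) * y + t * eta, 1).
    by case: hk => -[-> ->]; have [] := hcov k' k'0 k'1.
  have D0 : 0 < m + t * (1 - m).
    by apply: ltr_pwDl => //; rewrite mulr_ge0 ?subr_ge0.
  have r0 : 0 < m / (m + t * (1 - m)) by exact: divr_gt0.
  have r1 : m / (m + t * (1 - m)) <= 1.
    by rewrite ler_pdivrMr // mul1r lerDl mulr_ge0 ?subr_ge0.
  apply: conv_eq (star Kq Cg r0 r1) _; case: e => /= ex ey _.
  apply: pt_eq => /=.
  + by rewrite /flip in ex *; rewrite ex; case: s {ex kx x0 hcut hcov hf hk Cg};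
      field; rewrite gt_eqF.
  + by rewrite ey; field; rewrite gt_eqF.
  + by ring.
Qed.

(** The point is projected from the first chord onto the faces parallel to it, keeping [x] when
    possible. On z = 1 this fails near a missing edge; there the supporting plane bounds the depth
    of [p] below by [l * h], which allows projecting onto the broken line instead. *)
Lemma cov_all p : K p -> Cov p.
Proof.
move: p => [[x y] z] Kp; have [/= hx hy hz] := cb_box hC Kp.
have [[ha2 ha3] _ [hc1 hc2]] := par_bounds hC.
have A0 : K (0, a2, a3) by exact: (cb_A hC (lexx 0) ler01).
have [[-> ->]|[l [u [v [l0 l1 hu hv [ey ez he]]]]]] := exit2 ha2 ha3 hy hz.
  have [->|xn0] := eqVneq x 0; first exact: covq (None, false).
  have x0 : 0 < x by case/andP: hx => ? _; rewrite lt_neqAle eq_sym xn0.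
  have Cx := star A0 (covq (None, true)) x0 (proj2 (andP hx)).
  by apply: conv_eq Cx _; apply: pt_eq; rewrite /= /bit; ring.
have back w : 0 <= w <= 1 -> x - l * w <= (1 - l) -> 0 <= x - l * w ->
    (l = 1 -> w = x) -> Cov (w, u, v) -> Cov (x, y, z).
  move=> hw b1 b2 b3 Cw; have [le|ln] := eqVneq l 1.
    by rewrite (b3 le) in Cw; apply: conv_eq Cw _; apply: pt_eq => //=;
      rewrite ?ey ?ez le; ring.
  have D0 : 0 < 1 - l by rewrite subr_gt0 lt_neqAle ln.
  have h0 : 0 <= (x - l * w) / (1 - l) by apply: divr_ge0 => //; exact: ltW.
  have h1 : (x - l * w) / (1 - l) <= 1 by rewrite ler_pdivrMr // mul1r.
  apply: conv_eq (star (cb_A hC h0 h1) Cw l0 l1) _; apply: pt_eq => //=.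
  by field; rewrite gt_eqF.
have same : Cov (x, u, v) -> Cov (x, y, z).
  have [x0 x1] := andP hx; apply: back => //.
    by have : (1 - l) * x <= (1 - l) * 1; [apply: ler_wpM2l; lra|lra].
  by have : 0 <= (1 - l) * x; [apply: mulr_ge0; lra|lra].
case: he => -[[] eb].
- by apply: same; rewrite eb; apply: cov_faceY.
- by apply: same; rewrite eb; apply: cov_faceY.
- have v1 : v = 1 by rewrite eb.
  have [u0 u1] := andP hu.
  have [v2 [v3 [h [hh cut hL Ch far]]]] := side_at true u0 u1.
  have [v2' [v3' [h' [hh' cut' hL' Ch' far']]]] := side_at false u0 u1.
  have bd : l * h <= 1 - x.
    have := cut _ Kp; rewrite /= ey ez v1.
    have := ler_wpM2l (ltW l0) hL; lra.
  have bd' : l * h' <= x.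
    have := cut' _ Kp; rewrite /= ey ez v1.
    have := ler_wpM2l (ltW l0) hL'; lra.
  have [lt|ge] := ltP (1 - x) h.
    have [w01 w1 w2 w3] := slide_right (ltW l0) l1 hh bd lt.
    by apply: (back (1 - h)) => //; rewrite v1.
  have [lt'|ge'] := ltP x h'.
    have [w1 w2 w3] := slide_left l1 hh' bd' lt'.
    by apply: (back h') => //; rewrite v1.
  apply: same; rewrite v1.
  have Kq : K (c1, c2, 1) by exact: (cb_C hC ler01 (lexx 1)).
  have [[-> ->]|[m [e0 [e1 [m0 m1 he0 he1 [ex eu he]]]]]] := exit2 hc1 hc2 hx hu.
    exact: covq (Some true, true).
  have [x0 x1] := andP hx; have [e10 e11] := andP he1.
  case: he => -[b be].
    have e : (x, u, 1) = cmb m (c1, c2, 1) (bit R b, e1, 1).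
      by apply: pt_eq => /=; [rewrite ex be|rewrite eu|ring].
    case: b {be} e.
      rewrite (_ : bit R true = flip true 0); last by rewrite /flip /bit; ring.
      apply: far => //=; rewrite /flip; lra.
    apply: far' => //=; rewrite /flip; lra.
  have Ce : Cov (e0, e1, 1).
    by rewrite be; apply: (cove (e := (None, b, true))) => //; case/andP: he0.
  apply: conv_eq (star Kq Ce m0 m1) _; apply: pt_eq => //=; ring.
- apply: same; rewrite eb; exact: cov_faceZ0.
Qed.

End Body.

End Assembly.

(** * Dropping an edge that a supporting plane cuts off *)

Section DropEdge.
Variable R : realType.
Notation pt := (pt R).
Notation par := (par R).
Local Notation hex := ((Some false, true, false) : edge).
Local Notation bot := ((None, false, true) : edge).
Local Notation top := ((None, true, true) : edge).
Implicit Types (x y z t l u v a b h : R).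

(** Here [g] is [1 - b1], and the supporting plane is [x = 1 - v2 (y - a2) - v3 (z - a3)]. It cuts
    off both ends of the edge {x = 1, z = 1}; the third inequality, divided by [2 - t], is the one
    needed at the tip. *)
Lemma drop_ends (a2 a3 b3 g v2 v3 : R) : 0 < a2 -> a2 < 1 -> a3 <= a2 ->
  a2 + a3 <= 1 -> g < v3 * b3 -> 0 < v3 ->
  - (v2 * a2) <= g - v3 * (b3 - a3) ->
  v2 * (1 - a2) <= g - v3 * (b3 - a3) ->
  [/\ 0 < - v2 * a2 + v3 * (1 - a3),
  0 < v2 * (1 - a2) + v3 * (1 - a3) &
  g < v2 * (1 - 2 * a2) + v3 * ((1 - a3) + (b3 - a3))].
Proof.
move=> a20 a21 a32 a23 hv3 v30 hB0 hB1.
have A2 : 0 < 1 - a2 by lra.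
have gb0 := hv3; rewrite -(ltr_pM2r a20) in gb0.
have gb1 := hv3; rewrite -(ltr_pM2r A2) in gb1.
have h0 : 0 <= v3 * (1 - a2 - a3) by apply: mulr_ge0; lra.
have h1 : 0 <= v3 * (a2 - a3) by apply: mulr_ge0; lra.
have m0 := hB1; rewrite -(ler_pM2r a20) in m0.
have m1 := hB0; rewrite -(ler_pM2r A2) in m1.
have e0 : 0 < - v2 * a2 + v3 * (1 - a3) by rewrite -(pmulr_lgt0 _ A2); lra.
have e1 : 0 < v2 * (1 - a2) + v3 * (1 - a3) by rewrite -(pmulr_lgt0 _ a20); lra.
split=> //; have [h|h] := leP 0 (1 - 2 * a2).
  by have := ler_wpM2r h hB0; rewrite -(ltr_pM2r a20); lra.
by have := ler_wnM2r (ltW h) hB1; rewrite -(ltr_pM2r A2); lra.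
Qed.

(* y and h are the coordinates of the intersection of the two triangles
   illuminated from the edges {y = 0, z = 1} and {y = 1, z = 1}. *)
Lemma drop_tip (a2 a3 b3 g v2 v3 : R) : 0 < a2 -> a2 < 1 -> a3 < 1 ->
  a3 <= a2 -> a2 + a3 <= 1 -> a3 < b3 -> b3 <= 1 -> 0 < g ->
  g < v3 * b3 -> 0 < v3 ->
  - (v2 * a2) <= g - v3 * (b3 - a3) ->
  v2 * (1 - a2) <= g - v3 * (b3 - a3) ->
  exists t w y h, [/\ [/\ 0 <= t, 0 < w, w < 1 & 0 < y < 1],
  [/\ w * g < h, h < g & h <= v2 * (y - a2) + v3 * (1 - a3)],
  t * (1 - a3) = 1 - b3, y = w * (1 - t * a2) & 1 - y = w * (1 - t * (1 - a2))].
Proof.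
move=> a20 a21 a31 a32 a23 ab b31 g0 hv3 v30 hB0 hB1.
have [_ _ e] := drop_ends a20 a21 a32 a23 hv3 v30 hB0 hB1; have A3 : 0 < 1 - a3 by lra.
(* [t] is forced by the height z = 1 of the tip, and [w] by the agreement of the two triangles: the
   values they give for [y] and [1 - y] add up to [w * (2 - t)]. *)
pose t := (1 - b3) / (1 - a3).
have t0 : 0 <= t by apply: divr_ge0; lra.
have tE : t * (1 - a3) = 1 - b3 by rewrite divfK // gt_eqF.
have t1 : t < 1 by rewrite ltr_pdivrMr //; lra.
move: t t0 tE t1 => t t0 tE t1.
pose w := (2 - t)^-1.
have T0 : 0 < 2 - t by lra.
have wE : w * (2 - t) = 1 by rewrite mulVf // gt_eqF.
have w0 : 0 < w by rewrite invr_gt0.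
have w1 : w < 1 by rewrite invf_lt1 //; lra.
move: w wE w0 w1 => w wE w0 w1.
pose y := w * (1 - t * a2).
have yL : w * g < v2 * (y - a2) + v3 * (1 - a3).
  rewrite -(ltr_pM2r T0).
  have -> : w * g * (2 - t) = g by rewrite mulrAC wE mul1r.
  have -> : (v2 * (y - a2) + v3 * (1 - a3)) * (2 - t) =
    v2 * (w * (2 - t) * (1 - t * a2) - a2 * (2 - t)) +
    v3 * (2 * (1 - a3) - t * (1 - a3)) by rewrite /y; ring.
  rewrite wE tE; lra.
have ta : t * a2 < 1.
  by apply: le_lt_trans t1; rewrite -[leRHS]mulr1; apply: ler_wpM2l => //; lra.
have ta' : t * (1 - a2) < 1.
  by apply: le_lt_trans t1; rewrite -[leRHS]mulr1; apply: ler_wpM2l => //; lra.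
have y0 : 0 < y by apply: mulr_gt0; lra.
have y1 : 1 - y = w * (1 - t * (1 - a2)) by rewrite /y; lra.
have y1' : 0 < 1 - y by rewrite y1; apply: mulr_gt0; lra.
have wg : w * g < g by rewrite gtr_pMl.
(* [h] must not exceed the depth of the plane; between [w * g] and [g] it also leaves, by
   [mix_weight], a point strictly inside the first chord. *)
pose M := Num.min (v2 * (y - a2) + v3 * (1 - a3)) g.
have M0 : w * g < M by rewrite lt_min yL wg.
have M1 : M <= v2 * (y - a2) + v3 * (1 - a3) by rewrite /M ge_min lexx.
have M2 : M <= g by rewrite /M ge_min lexx orbT.
exists t, w, y, ((w * g + M) / 2); split=> //; split=> //; lra.
Qed.

Section Drop.
Variables (K I : pt -> Prop).
Implicit Type P : par.

Definition dropdata K I P (s : bool) : Prop :=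
  exists v2 v3 h y, [/\ [/\ 0 < h, h <= 1, 0 < y & y < 1],
    forall p, K p -> v2 * (p.1.2 - a2 P) + v3 * (p.2 - a3 P) <= flip s p.1.1,
    [/\ 0 < - v2 * a2 P + v3 * (1 - a3 P), 0 < v2 * (1 - a2 P) + v3 * (1 - a3 P) &
      h <= v2 * (y - a2 P) + v3 * (1 - a3 P)],
    illum I (edir P bot) (flip s h, y, 1) & illum I (edir P top) (flip s h, y, 1)].

(* p + (w r + 1 - w) d lies on the segment from E to a point of the first
   chord. *)
Lemma apex_illum P (p d E : pt) (w r t : R) : cbody K I P -> K E ->
  0 < w -> w < 1 -> 0 <= r -> 0 < t -> t < 1 ->
  p = mv (cmb w (t, a2 P, a3 P) E) (- (w * r + (1 - w))) d ->
  (forall n : pt, n.1.1 = 0 -> dot n d = 0 -> dot n E = dot n (0, a2 P, a3 P) ->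
     n = (0, 0, 0)) ->
  illum I d p.
Proof.
move=> hC KE w0 w1 r0 t0 t1 ep hn; apply: contrapT.
move=> /(illum_sep hC) [n [n0 sup nd]].
have s0 := sup _ (cb_A hC (lexx 0) ler01).
have s1 := sup _ (cb_A hC ler01 (lexx 1)); have sE := sup _ KE.
have eA x : dot n (x, a2 P, a3 P) = dot n (0, a2 P, a3 P) + x * n.1.1.
  by rewrite /dot /=; ring.
have e : dot n p = (1 - w) * (dot n (0, a2 P, a3 P) + t * n.1.1) + w * dot n E
    - (w * r + (1 - w)) * dot n d.
  by rewrite -eA ep /dot /=; ring.
rewrite (eA 1) mul1r in s1.
move: (dot n p) (dot n (0, a2 P, a3 P)) (dot n E) (dot n d) s0 s1 sE e nd
  (hn n) => np nA nE nD s0 s1 sE e nd {}hn.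
have W0 : 0 < 1 - w by lra.
have W1 : 0 < w * r + (1 - w) by apply: ltr_wpDl => //; apply: mulr_ge0 => //; lra.
have u1 : 0 <= (1 - w) * (1 - t) * (np - nA) by rewrite !mulr_ge0 ?subr_ge0 ?(ltW w1) ?(ltW t1).
have u2 : 0 <= (1 - w) * t * (np - nA - n.1.1) by do !apply: mulr_ge0; lra.
have u3 : 0 <= w * (np - nE) by rewrite mulr_ge0 ?subr_ge0 ?(ltW w0).
have u4 : 0 <= (w * r + (1 - w)) * nD by rewrite mulr_ge0 ?(ltW W1).
have z4 : (w * r + (1 - w)) * nD = 0 by lra.
have z3 : w * (np - nE) = 0 by lra.
have z2 : (1 - w) * t * (np - nA - n.1.1) = 0 by lra.
have z1 : (1 - w) * (1 - t) * (np - nA) = 0 by lra.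
have nD0 : nD = 0 by apply: (mulfI (lt0r_neq0 W1)); rewrite z4 mulr0.
have nE0 : np - nE = 0 by apply: (mulfI (lt0r_neq0 w0)); rewrite z3 mulr0.
have T0 : 0 < (1 - w) * t by exact: mulr_gt0.
have T1 : 0 < (1 - w) * (1 - t) by rewrite mulr_gt0 ?subr_gt0.
have nB0 : np - nA - n.1.1 = 0 by apply: (mulfI (lt0r_neq0 T0)); rewrite z2 mulr0.
have nA0 : np - nA = 0 by apply: (mulfI (lt0r_neq0 T1)); rewrite z1 mulr0.
by apply/n0/hn; lra.
Qed.

Lemma indep2 (A A' C r x2 x3 : R) : 0 < A -> 0 < A' -> 0 < C -> 0 <= r ->
  x2 * A = x3 * C -> x2 * A' + x3 * r = 0 -> x2 = 0 /\ x3 = 0.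
Proof.
move=> A0 A'0 C0 r0 e1 e2.
have D0 : 0 < C * A' + r * A by apply: ltr_pwDl; [exact: mulr_gt0|apply: mulr_ge0 => //; exact: ltW].
have x30 : x3 = 0.
  apply: (mulIf (lt0r_neq0 D0)); rewrite mul0r.
  transitivity (A * (x2 * A' + x3 * r) + A' * (x3 * C - x2 * A)); first by ring.
  by rewrite e1 e2 subrr !mulr0 addr0.
by split=> //; apply: (mulIf (lt0r_neq0 A0)); rewrite e1 x30 !mul0r.
Qed.

Lemma mix_weight (w g h b : R) : 0 <= b -> g = 1 - b -> 0 < w -> w < 1 ->
  w * g < h -> h < g -> exists r, [/\ 0 < r, r < 1 & (1 - w) * r + w * b = 1 - h].
Proof.
move=> b0 -> w0 w1 hw hg; have W0 : 0 < 1 - w by rewrite subr_gt0.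
exists ((1 - h - w * b) / (1 - w)); split.
- by apply: divr_gt0 => //; have : w * b <= 1 * b; [apply: ler_wpM2r; rewrite // ltW|lra].
- by rewrite ltr_pdivrMr // mul1r; lra.
- by rewrite mulrC divfK ?gt_eqF // subrK.
Qed.

Lemma normal_slopes P (n : pt) : cbody K I P -> inner P -> a3 P < b3 P ->
  (forall k, K k -> dot n k <= dot n (1, a2 P, a3 P)) ->
  0 < dot n (edir P hex) -> exists v2 v3 : R,
  [/\ 0 < v3, 0 < 1 - b1 P & 1 - b1 P < v3 * b3 P] /\
  [/\ - (v2 * a2 P) <= (1 - b1 P) - v3 * (b3 P - a3 P),
      v2 * (1 - a2 P) <= (1 - b1 P) - v3 * (b3 P - a3 P) &
      forall p, K p -> v2 * (p.1.2 - a2 P) + v3 * (p.2 - a3 P) <= 1 - p.1.1].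
Proof.
move=> hC [a20 a21 a30 a31] ab sup.
have [[n1 hB0 hB1] _] := support_q0 hC sup.
have [_ [/andP[_ b11] _] _] := par_bounds hC.
rewrite /dot /= /bit => nd.
have nb : 0 < n.2 * b3 P by have : 0 <= n.1.1 * (1 - b1 P); [apply: mulr_ge0; lra|lra].
have b3' : 0 < b3 P by lra.
have n3 : 0 < n.2 by move: nb; rewrite pmulr_lgt0.
have rp : 0 < n.2 * (b3 P - a3 P) by apply: mulr_gt0; lra.
have gp : n.2 * (b3 P - a3 P) <= n.1.1 * (1 - b1 P).
  have A2 : 0 < 1 - a2 P by lra.
  have := ler_wpM2r (ltW A2) hB0; have := ler_wpM2r (ltW a20) hB1; lra.
have n1' : 0 < n.1.1.
  rewrite lt_neqAle n1 andbT eq_sym; apply/eqP => n10.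
  by rewrite n10 mul0r in gp; lra.
exists (n.1.2 / n.1.1), (n.2 / n.1.1).
have v2E : n.1.2 = n.1.2 / n.1.1 * n.1.1 by rewrite divfK // gt_eqF.
have v3E : n.2 = n.2 / n.1.1 * n.1.1 by rewrite divfK // gt_eqF.
have v30 : 0 < n.2 / n.1.1 by exact: divr_gt0.
have dotE p : dot n p = n.1.1 * (p.1.1 + n.1.2 / n.1.1 * p.1.2 + n.2 / n.1.1 * p.2).
  by rewrite /dot {1}v2E {1}v3E; ring.
rewrite {}v2E {}v3E in nd hB0 hB1 gp rp.
move: (n.1.2 / _) (n.2 / _) v30 dotE nd hB0 hB1 gp rp => v2 v3 v30 dotE nd hB0 hB1 gp rp.
split; split=> //.
- by rewrite -(pmulr_rgt0 _ n1'); lra.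
- by rewrite -(ltr_pM2l n1'); lra.
- by rewrite -(ler_pM2l n1'); lra.
- by rewrite -(ler_pM2l n1'); lra.
- by move=> p Kp; have := sup _ Kp; rewrite !dotE ler_pM2l //=; lra.
Qed.

Lemma drop_right P (n : pt) : cbody K I P -> inner P ->
  a3 P <= a2 P -> a2 P + a3 P <= 1 -> a3 P < b3 P ->
  (forall k, K k -> dot n k <= dot n (1, a2 P, a3 P)) ->
  0 < dot n (edir P hex) -> dropdata K I P true.
Proof.
move=> hC iP a32 a23 ab sup nd.
have [v2 [v3 [[v30 g0 h3] [h1 h2 cut]]]] := normal_slopes hC iP ab sup nd.
have [a20 a21 a30 a31] := iP.
have [_ [/andP[b10 b11] /andP[b30 b31]] _] := par_bounds hC.
have [L0 L1 _] := drop_ends a20 a21 a32 a23 h3 v30 h1 h2.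
have [t [w [y [h [[t0 w0 w1 /andP[y0 y1]] [hw hg hL] tE yE yE']]]]] :=
  drop_tip a20 a21 a31 a32 a23 ab b31 g0 h3 v30 h1 h2.
have [r [r0 r1 rE]] := mix_weight b10 erefl w0 w1 hw hg.
have A2 : 0 < 1 - a2 P by rewrite subr_gt0.
have A3 : 0 < 1 - a3 P by rewrite subr_gt0.
have R0 : 0 <= b3 P - a3 P by rewrite subr_ge0 ltW.
have zE : 1 = (1 - w) * a3 P + w * b3 P + w * (t * (1 - a3 P)) + (1 - w) * (1 - a3 P).
  by rewrite tE; ring.
exists v2, v3, h, y; split=> //.
- split=> //; first by apply: lt_trans hw; exact: mulr_gt0.
  by apply: ltW; apply: lt_le_trans hg _; rewrite gerBl.
- apply: (apex_illum hC (cb_B hC ler01 (lexx 1)) w0 w1 t0 r0 r1).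
    apply: pt_eq; rewrite /= /bit /flip.
    + by rewrite mulr0 addr0 rE.
    + by rewrite yE; ring.
    + by rewrite [LHS]zE; ring.
  move=> [[x1 x2] x3] /= ->; rewrite /dot /= /bit => e1 e2.
  have [||-> -> //] := @indep2 (a2 P) (1 - a2 P) (1 - a3 P) (b3 P - a3 P) x2 x3 a20 A2 A3 R0.
    by apply/eqP; rewrite -subr_eq0 -[X in _ == X]e1; apply/eqP; ring.
  by apply/eqP; move/eqP: e2; rewrite -subr_eq0 => /eqP e2; apply/eqP; rewrite -[RHS]e2; ring.
- apply: (apex_illum hC (cb_B hC (lexx 0) ler01) w0 w1 t0 r0 r1).
    apply: pt_eq; rewrite /= /bit /flip.
    + by rewrite mulr0 addr0 rE.
    + have yT : y = 1 - w * (1 - t * (1 - a2 P)) by rewrite -yE' opprB addrC subrK.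
      by rewrite [LHS]yT; ring.
    + by rewrite [LHS]zE; ring.
  move=> [[x1 x2] x3] /= ->; rewrite /dot /= /bit => e1 e2.
  have [||/eqP + -> //] := @indep2 (1 - a2 P) (a2 P) (1 - a3 P) (b3 P - a3 P) (- x2) x3 A2 a20 A3 R0.
  + by apply/eqP; rewrite -subr_eq0 -[X in _ == X]e1; apply/eqP; ring.
  + by apply/eqP; move/eqP: e2; rewrite -subr_eq0 => /eqP e2; apply/eqP; rewrite -[RHS]e2; ring.
  by rewrite oppr_eq0 => /eqP ->.
Qed.

End Drop.

End DropEdge.

(** * The alternative between dropping an edge and tilting the opposite one *)

Section Resolve.
Variable R : realType.
Notation pt := (pt R).
Local Notation hex := ((Some false, true, false) : edge).

Lemma resolve (K I : pt -> Prop) P (s : bool) : cbody K I P -> inner P ->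
  a3 P <= a2 P -> a2 P + a3 P <= 1 -> a3 P < b3 P ->
  dropdata K I P s \/ weakI I (edir P (Some false, s, false)) (qpt P (None, s)).
Proof.
move=> hC iP h1 h2 h3.
have [wk|nw] := pselect (weakI I (edir P (Some false, s, false)) (qpt P (None, s)));
  [by right|left]; case: s nw => nw.
  have [n [n0 sup nd]] := not_weakI hC nw.
  exact: (drop_right hC iP h1 h2 h3 sup nd).
pose P' := gpar1 Xi P; have hC' := cbody1 Xi hC.
have nw' : ~ weakI (fun p => I (gmap1 Xi p)) (edir P' hex) (qpt P' (None, true)).
  have := weakI_frame I [:: Xi] (edir (gpar [:: Xi] P) hex)
    (qpt (gpar [:: Xi] P) (None, true)).
  by rewrite glin_edir gmap_qpt => h /h.
have [n [n0 sup nd]] := not_weakI hC' nw'.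
have [v2 [v3 [h [y [hh cut hL hbot htop]]]]] :=
  drop_right hC' (P := P') iP h1 h2 h3 sup nd.
exists v2, v3, h, y; split=> //.
- move=> [[x yy] z] Kp; have := cut (1 - x, yy, z); rewrite /flip /= opprB addrC subrK.
  exact.
- have := (illum_frame I [:: Xi] _ _).1 hbot; rewrite (glin_edir [:: Xi] P).
  by congr illum; apply: pt_eq; rewrite /= /flip; ring.
- have := (illum_frame I [:: Xi] _ _).1 htop; rewrite (glin_edir [:: Xi] P).
  by congr illum; apply: pt_eq; rewrite /= /flip; ring.
Qed.

End Resolve.

(** * The finite check *)

Section Combinatorics.
Local Open Scope nat_scope.
Local Notation X := (None : axis).
Local Notation Y := (Some false : axis).
Local Notation Z := (Some true : axis).

Definition vertex : Type := (bool * bool * bool)%type.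

Definition axes : seq axis := [:: X; Y; Z].
Definition faces : seq face :=
  [:: (X, true); (Y, true); (Z, true); (X, false); (Y, false); (Z, false)].
Definition edges : seq edge :=
  [seq (au, v) | au <- [seq (a, u) | a <- axes, u <- [:: true; false]],
                 v <- [:: true; false]].
Definition vertices : seq vertex :=
  [seq (uv, w) | uv <- [seq (u, v) | u <- [:: true; false], v <- [:: true; false]],
                 w <- [:: true; false]].

Definition eend (e : edge) (b : bool) : vertex :=
  match e with
  | (None, u, v) => (b, u, v)
  | (Some false, u, v) => (u, b, v)
  | (Some true, u, v) => (u, v, b)
  end.

(* A symmetry preserving [natural] and mapping the face x = 1 to f. *)
Definition fframe (f : face) : seq gen :=
  match f with
  | (None, true) => [::]
  | (Some false, true) => [:: Cyc]
  | (Some true, true) => [:: Cyc; Cyc]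
  | (None, false) => [:: Cyc; Cyc; Sig]
  | (Some false, false) => [:: Sig]
  | (Some true, false) => [:: Cyc; Sig]
  end.

Definition hexe (f : face) : edge := acte (fframe f) (Y, true, false).
Definition nonhexe (f : face) : edge := acte (fframe f) (Y, true, true).
Definition spece (f : face) : edge := acte (fframe f) (Z, true, false).

(* The two frames in which the chord of axis a plays the role of the first one
   and the edges to be dropped lie in the face z = 1. *)
Definition dframe (a : axis) (p : bool) : seq gen :=
  nseq (if a is Some b then if b then 2 else 1 else 0) Cyc ++
  (if p then [::] else [:: Tau]).

Definition drope (w : seq gen) (s : bool) : edge := acte w (Y, s, true).
Definition opposite (w : seq gen) (s : bool) : edge := acte w (Y, s, false).

(* A step (e, b) covers the edge e from its end at the value ~~ b. *)
Fixpoint vsteps (V : seq vertex) (s : seq (edge * bool)) : bool :=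
  if s is (e, b) :: s' then
    (eend e (~~ b) \in V) && vsteps (eend e b :: V) s'
  else true.

Fixpoint pass (V : seq vertex) (es : seq edge) :
    seq vertex * seq (edge * bool) * seq edge :=
  if es is e :: es' then
    if eend e false \in V then
      let: (W, s, l) := pass (eend e true :: V) es' in (W, (e, true) :: s, l)
    else if eend e true \in V then
      let: (W, s, l) := pass (eend e false :: V) es' in (W, (e, false) :: s, l)
    else let: (W, s, l) := pass V es' in (W, s, e :: l)
  else (V, [::], [::]).

(** [n] is fuel: edges left over by one pass are tried again in the next. [conn1] verifies the
    resulting steps. *)
Fixpoint passes (n : nat) V es : seq (edge * bool) :=
  if n is n'.+1 then
    let: (W, s, l) := pass V es in s ++ passes n' W l
  else [::].

Definition rest (R : seq edge) : seq edge := [seq e <- edges | e \notin R].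

Definition tree R v : seq (edge * bool) := passes 5 [:: v] (rest R).

Definition conn1 R v : bool :=
  let s := tree R v in
  [&& vsteps [:: v] s, size s == size (rest R),
      all (fun e => e \in [seq x.1 | x <- s]) (rest R) &
      all (fun u => (u == v) || (u \in [seq eend x.1 x.2 | x <- s])) vertices].

Definition conn R : bool := all (conn1 R) vertices.

(** The graph of the cube is 3-edge-connected, here by computation; the search thereby skips the
    connectivity test for short lists. *)
Lemma conn_small R : {subset R <= edges} -> size R <= 2 -> conn R.
Proof.
have H : conn [::] && all (fun e => conn [:: e] && all (fun f => conn [:: e; f]) edges) edges.
  by vm_cast_no_check (erefl true).
case/andP: H => h0 /allP h; case: R => [|e [|f [|]]] // sR _.
  by case/andP: (h e (sR e (mem_head _ _))).
case/andP: (h e (sR e (mem_head _ _))) => _ /allP; apply.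
by apply: sR; rewrite !inE eqxx orbT.
Qed.

(* A state records, for each of the six faces in the order of [faces], whether
   the chord end on this face is [exposed] (list [tn]), [exposed] and
   [hex_strict] (list [th]), [exposed] and [nonhex_strict] (list [tm]). The list
   [sg] gives, for each axis, whether the sum of the two coordinates of the
   chord is at least 1, resp. at most 1, and [bd] tells for which chords the
   hypothesis of [bad_special] holds. *)
Definition aidx (a : axis) : nat := if a is Some b then if b then 2 else 1 else 0.
Definition idx (f : face) : nat :=
  let: (a, b) := f in if b then aidx a else 3 + aidx a.
Definition at_face (l : seq bool) (f : face) : bool := nth false l (idx f).
Definition le_at (sg : seq bool) (a : axis) : bool := nth false sg (aidx a).*2.
Definition ge_at (sg : seq bool) (a : axis) : bool := nth false sg (aidx a).*2.+1.
Definition bad_at (bd : seq bool) (a : axis) : bool := nth false bd (aidx a).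

Definition pairs : seq (face * face * axis) :=
  [:: ((X, true), (Y, true), Y); ((Y, true), (Z, true), Z); ((Z, true), (X, true), X);
      ((Y, false), (X, false), X); ((Z, false), (Y, false), Y);
      ((X, false), (Z, false), Z)].

Definition sign_ok tn th sg : bool :=
  all (fun a => le_at sg a || ge_at sg a) axes &&
  all (fun x : face * face * axis => let: (f, g, a) := x in
    if at_face tn f && at_face tn g then
      let lo := if f.2 then ge_at sg a else le_at sg a in
      let hi := if f.2 then le_at sg a else ge_at sg a in
      hi && ((at_face th f || at_face th g) ==> ~~ lo)
    else true) pairs.

(* How an exposed chord end is covered: by a direction of its own, by tilting the
   direction of its hex or nonhex edge, or by means of [resolve]. *)
Inductive choice : Type := Own | Hex | Non | Res.

(* Which of the three inequalities b1 < c1, c2 < a2, a3 < b3, identified by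
   the faces known to imply them, the frame [dframe a p] relies on. *)
Definition gives (f : face) : axis :=
  if f is (None, true) then X else if f is (Some true, false) then X
  else if f is (Some true, true) then Y else if f is (Some false, false) then Y
  else Z.
Definition needs (a : axis) (p : bool) : axis :=
  match a, p with
  | None, true => Z | None, false => X
  | Some false, true => Y | Some false, false => Z
  | Some true, true => X | Some true, false => Y
  end.
Definition known tn th tm (x : axis) : bool :=
  has (fun f => [&& at_face tn f, at_face th f || at_face tm f & gives f == x]) faces.

Definition is_own (c : choice) : bool := if c is Own then true else false.
Definition is_res (c : choice) : bool := if c is Res then true else false.

Definition owns (acc : seq (face * choice)) : seq face :=
  [seq x.1 | x <- acc & is_own x.2].
Definition resd (acc : seq (face * choice)) : seq face :=
  [seq x.1 | x <- acc & is_res x.2].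
Fixpoint marks (acc : seq (face * choice)) : seq (edge * face) :=
  match acc with
  | [::] => [::]
  | (f, Hex) :: acc' => (hexe f, f) :: marks acc'
  | (f, Non) :: acc' => (nonhexe f, f) :: marks acc'
  | _ :: acc' => marks acc'
  end.

Fixpoint subseqs (T : Type) (s : seq T) : seq (seq T * seq T) :=
  if s is x :: s' then
    [seq (x :: y.1, y.2) | y <- subseqs s'] ++ [seq (y.1, x :: y.2) | y <- subseqs s']
  else [:: ([::], [::])].

Definition legal tn th tm bd (ch : option (axis * bool)) (x : face * choice) : bool :=
  [&& at_face tn x.1, ~~ bad_at bd x.1.1 &
    match x.2 with
    | Own => true
    | Hex => ~~ at_face th x.1
    | Non => ~~ at_face tm x.1
    | Res => if ch is Some (a, _) then x.1.1 == a else false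
    end].

Definition frame_ok tn th tm sg bd (ch : option (axis * bool)) : bool :=
  if ch is Some (a, p) then
    [&& ~~ bad_at bd a, (if p then ge_at sg a else le_at sg a) &
        known tn th tm (needs a p)]
  else true.

(* [o] splits the list of resolved faces into those whose edge is dropped and
   those for which the opposite edge is tilted. *)
Definition outcome_ok tn bd (ch : option (axis * bool)) acc (o : seq face * seq face) :
    bool :=
  let w := if ch is Some (a, p) then dframe a p else [::] in
  let dr := [seq drope w f.2 | f <- o.1] in
  let mk := [seq x.1 | x <- marks acc] ++ [seq opposite w f.2 | f <- o.2] in
  [&& uniq (mk ++ dr),
      all (fun f => if at_face tn f then ~~ bad_at bd f.1 || (spece f \notin dr)
                    else (hexe f \notin dr) && (nonhexe f \notin dr)) faces &
      if size (mk ++ dr) <= 2 then true else conn (mk ++ dr)].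

(** The bound 2 is what fourteen directions leave beside the edges. The negated boolean is the
    direction of a starting vertex, spared when an own direction illuminates one; resolved ends do
    not count, as a dropped edge pays for each own direction they get. *)
Definition plan_ok tn th tm sg bd (ch : option (axis * bool)) acc : bool :=
  if size (owns acc) + ~~ has (fun f => at_face th f || at_face tm f) (owns acc) <= 2 then
  [&& all (legal tn th tm bd ch) acc,
      all (fun f => [&& at_face tn f & ~~ bad_at bd f.1] ==> (f \in [seq x.1 | x <- acc])) faces,
      frame_ok tn th tm sg bd ch,
      uniq (resd acc) &
      all (outcome_ok tn bd ch acc) (subseqs (resd acc))] else false.

Fixpoint dfs (try : seq (face * choice) -> bool) th tm (ch : option (axis * bool))
    (k : nat) (T : seq face) (acc : seq (face * choice)) : bool :=
  if T is f :: T' then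
    if (if k is k'.+1 then dfs try th tm ch k' T' ((f, Own) :: acc) else false)
    then true
    else if (if at_face th f then false else dfs try th tm ch k T' ((f, Hex) :: acc))
    then true
    else if (if at_face tm f then false else dfs try th tm ch k T' ((f, Non) :: acc))
    then true
    else if ch is Some (a, _) then
      if f.1 == a then dfs try th tm ch k T' ((f, Res) :: acc) else false
    else false
  else try acc.

Definition frames : seq (option (axis * bool)) :=
  None :: [seq Some (a, p) | a <- axes, p <- [:: true; false]].

(* Unlike [has], this does not evaluate the tail when the head is true. *)
Fixpoint lhas (T : Type) (Q : T -> bool) (s : seq T) : bool :=
  if s is x :: s' then if Q x then true else lhas Q s' else false.

Lemma lhasE (T : Type) (Q : T -> bool) s : lhas Q s = has Q s.
Proof. by elim: s => //= x s ->; case: (Q x). Qed.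

Definition search tn th tm sg bd : bool :=
  let T := [seq f <- faces | at_face tn f && ~~ bad_at bd f.1] in
  lhas (fun ch => if frame_ok tn th tm sg bd ch then
      dfs (plan_ok tn th tm sg bd ch) th tm ch 2 T [::] else false) frames.

Fixpoint allb (n : nat) (Q : seq bool -> bool) : bool :=
  if n is n'.+1 then
    if allb n' (fun l => Q (true :: l)) then allb n' (fun l => Q (false :: l))
    else false
  else Q [::].

Lemma allbP n Q : allb n Q -> forall l, size l = n -> Q l.
Proof.
elim: n Q => [|n IH] Q /=; first by move=> h [].
case: ifP => // h1 h2 [|[] l] // [] sl; [exact: IH h1 l sl|exact: IH h2 l sl].
Qed.

Definition bsub (s t : seq bool) : bool := all (fun x => x.1 ==> x.2) (zip s t).

(** [sign_ok] is tested as soon as its arguments are known, before [tm] and [bd] multiply the number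
    of states. *)
Definition all_states : bool :=
  allb 6 (fun tn => allb 6 (fun th => if bsub th tn then
    allb 6 (fun sg => if sign_ok tn th sg then
      allb 6 (fun tm => if bsub tm tn then
        allb 3 (fun bd => search tn th tm sg bd) else true) else true) else true)).

Lemma all_states_ok : all_states.
Proof. by vm_cast_no_check (erefl true). Qed.

(** Only the verdict of [try] on the plan found is kept, since [plan_ok] checks a plan completely,
    however it was found. *)
Lemma dfs_plan try th tm ch k T acc : dfs try th tm ch k T acc ->
  exists acc', try acc'.
Proof.
elim: T k acc => [|f T IH] k acc /=; first by exists acc.
case: ifP => [|_]; first by case: k => // k + _; exact: IH.
case: ifP => [|_]; first by case: (at_face th f) => // + _; exact: IH.
case: ifP => [|_]; first by case: (at_face tm f) => // + _; exact: IH.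
by case: ch IH => // -[a p] IH; case: ifP => // _; exact: IH.
Qed.

Lemma plan_exists tn th tm sg bd : size tn = 6 -> size th = 6 -> size tm = 6 ->
  size sg = 6 -> size bd = 3 -> bsub th tn -> bsub tm tn -> sign_ok tn th sg ->
  exists ch acc, plan_ok tn th tm sg bd ch acc.
Proof.
move=> s1 s2 s3 s4 s5 h1 h2 h3.
have := allbP all_states_ok s1 => /allbP /(_ _ s2); rewrite h1.
move=> /allbP /(_ _ s4); rewrite h3 => /allbP /(_ _ s3); rewrite h2.
move=> /allbP /(_ _ s5); rewrite /search lhasE => /hasP [ch _]; case: ifP => // _ /dfs_plan [acc].
by exists ch, acc.
Qed.

End Combinatorics.

(** * The geometric facts in the frames of all six faces *)

Section Indexed.
Variable R : realType.
Notation pt := (pt R).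
Notation par := (par R).
Local Notation X := (None : axis).
Local Notation Y := (Some false : axis).
Local Notation Z := (Some true : axis).
Local Notation f0 := ((X, true) : face).
Implicit Types (K I : pt -> Prop) (P : par) (f g : face) (e : edge) (a : axis).

Definition vpt (v : vertex) : pt := (bit R v.1.1, bit R v.1.2, bit R v.2).

Lemma gmap_vpt w v : exists v', gmap w (vpt v) = vpt v'.
Proof.
elim: w => [|g w [v' /= ->]]; first by exists v.
case: v' => [[x y] z]; rewrite /vpt.
case: g; [exists (z, x, y)|exists (~~ y, ~~ x, ~~ z)|exists (x, ~~ z, ~~ y)
  |exists (x, y, ~~ z)|exists (~~ x, y, z)]; by rewrite /= ?bitN.
Qed.

Definition markable I P e f : Prop := exists u, tilting I P e u /\
  ev (fun h => illum I (mv (edir P e) h u) (qpt P f)).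

Lemma markable_frame w I P e f :
  markable (fun p => I (gmap w p)) (gpar w P) e f ->
  markable I P (acte w e) (actf w f).
Proof.
move=> [u [hu hev]]; exists (glin w u); split; first exact: tilting_frame.
apply: ev_mono hev => h _ /illum_frame.
by rewrite glin_mv glin_edir gmap_qpt.
Qed.

Definition on_skeleton P f : Prop :=
  exists e t, [/\ 0 <= t, t <= 1 & qpt P f = ept e t].

Lemma on_skeleton_frame w P f : on_skeleton (gpar w P) f -> on_skeleton P (actf w f).
Proof.
move=> [e [t [t0 t1 et]]]; have [b hb] := gmap_ept R w e.
exists (acte w e), (flip b t); rewrite -gmap_qpt et hb; split=> //;
  by case: (b); rewrite /flip //; lra.
Qed.

Lemma not_inner K I P : cbody K I P -> ~ inner P -> on_skeleton P f0.
Proof.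
move=> hC hi; have [[/andP[A0 A1] /andP[B0 B1]] _ _] := par_bounds hC.
have [a20|a20] := eqVneq (a2 P) 0.
  by exists (Z, true, false), (a3 P); split=> //; rewrite /= a20.
have [a21|a21] := eqVneq (a2 P) 1.
  by exists (Z, true, true), (a3 P); split=> //; rewrite /= a21.
have [a30|a30] := eqVneq (a3 P) 0.
  by exists (Y, true, false), (a2 P); split=> //; rewrite /= a30.
have [a31|a31] := eqVneq (a3 P) 1.
  by exists (Y, true, true), (a2 P); split=> //; rewrite /= a31.
by case: hi; split; rewrite lt_neqAle ?A0 ?A1 ?B0 ?B1 ?andbT // eq_sym.
Qed.

Lemma actf_fframe f : actf (fframe f) f0 = f.
Proof. by move: f => [[[]|] []]. Qed.

Section Data.
Variables (K I : pt -> Prop) (P : par).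
Hypotheses (hC : cbody K I P) (hN : natural P).

Local Notation Kf w := (fun p => K (gmap w p)).
Local Notation If w := (fun p => I (gmap w p)).

Definition exposed_at f : Prop := exposed (Kf (fframe f)) (If (fframe f)) (gpar (fframe f) P).
Definition hex_strict_at f : Prop := hex_strict (If (fframe f)) (gpar (fframe f) P).
Definition nonhex_strict_at f : Prop := nonhex_strict (If (fframe f)) (gpar (fframe f) P).

Lemma natural_fframe f : natural (gpar (fframe f) P).
Proof.
move: f => [[[]|] []].
- exact: natural_cyc (natural_cyc hN).
- exact: natural_sig (natural_cyc hN).
- exact: natural_cyc hN.
- exact: natural_sig hN.
- exact: hN.
- exact: natural_sig (natural_cyc (natural_cyc hN)).
Qed.

Lemma not_exposed_at f : ~ exposed_at f ->
  [\/ on_skeleton P f, covers K I P (hexe f) f | covers K I P (nonhexe f) f].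
Proof.
move=> nt; have hF := cbody_frame (fframe f) hC.
have cf e : covers (Kf (fframe f)) (If (fframe f)) (gpar (fframe f) P) e f0 ->
    covers K I P (acte (fframe f) e) f.
  by move=> h; rewrite -{2}(actf_fframe f); apply/covers_frame.
have [h1|h1] := pselect (covers K I P (hexe f) f); first exact: Or32.
have [h2|h2] := pselect (covers K I P (nonhexe f) f); first exact: Or33.
apply: Or31; rewrite -(actf_fframe f); apply: on_skeleton_frame.
apply: (not_inner hF) => hi; apply: nt; split=> //.
  by move=> /cf.
by move=> /cf.
Qed.

Lemma mark_hexe f : exposed_at f -> ~ hex_strict_at f -> markable I P (hexe f) f.
Proof.
move=> [[_ _ h1 h2] _ _] /contrapT wI; rewrite -{2}(actf_fframe f).
apply: markable_frame.
have [u hu hev] := mark_hex (cbody_frame (fframe f) hC) h1 h2 wI.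
by exists u.
Qed.

Lemma mark_nonhexe f : exposed_at f -> ~ nonhex_strict_at f -> markable I P (nonhexe f) f.
Proof.
move=> [[_ _ h1 h2] _ _] /contrapT wI; rewrite -{2}(actf_fframe f).
apply: markable_frame.
apply: (markable_frame (w := [:: Rho]) (e := (Y, true, false)) (f := f0)).
have wI' := (weakI_rho _ _).2 wI.
have [||u hu hev] := mark_hex (cbody1 Rho (cbody_frame (fframe f) hC)) _ _ wI'.
- by rewrite /=; lra.
- by rewrite /=; lra.
by exists u.
Qed.

Lemma root_face f : exposed_at f -> hex_strict_at f \/ nonhex_strict_at f ->
  exists d v, illum I d (qpt P f) /\ illum I d (vpt v).
Proof.
move=> ht hs; have hF := cbody_frame (fframe f) hC.
have [d [v [h1 h2]]] : exists d v, illum (If (fframe f)) d (qpt (gpar (fframe f) P) f0) /\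
    illum (If (fframe f)) d (vpt v).
  case: hs => hs.
    have [d [h1 h2]] := hex_strict_root hF (natural_fframe f) ht hs.
    by exists d, (true, true, true).
  have [d [h1 h2]] := nonhex_strict_root hF (natural_fframe f) ht hs.
  by exists d, (true, true, false).
have [v' hv'] := gmap_vpt (fframe f) v.
exists (glin (fframe f) d), v'; split.
  by rewrite -{2}(actf_fframe f) -gmap_qpt; apply/illum_frame.
by rewrite -hv'; apply/illum_frame.
Qed.

Definition asum a : R :=
  match a with
  | None => a2 P + a3 P | Some false => b1 P + b3 P | Some true => c1 P + c2 P
  end.

Definition gap a : Prop :=
  match a with
  | None => c2 P < a2 P | Some false => b1 P < c1 P | Some true => a3 P < b3 P
  end.

Definition badp a : Prop :=
  match a with
  | None => a2 P < a3 P | Some false => b3 P < b1 P | Some true => c1 P < c2 P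
  end.

Lemma gives_gap f : exposed_at f -> hex_strict_at f \/ nonhex_strict_at f -> gap (gives f).
Proof.
move=> ht hs; have := strict_ca (cbody_frame (fframe f) hC) (natural_fframe f) ht hs.
by move: f {ht hs} => [[[]|] []] /=; lra.
Qed.

Lemma bad_covers f : exposed_at f -> badp f.1 -> covers K I P (spece f) f.
Proof.
move=> ht hb; rewrite -{2}(actf_fframe f); apply/covers_frame.
apply: (bad_special (cbody_frame (fframe f) hC) (natural_fframe f) ht).
by move: f {ht} hb => [[[]|] []] /=; lra.
Qed.

(** The pairs are ordered so that the parameters in the frame of [g] are those in the frame of [f]
    followed by [Cyc]; hence [pair_le] and [pair_lt] apply. *)
Lemma pair_sign f g a : (f, g, a) \in pairs -> exposed_at f -> exposed_at g ->
  (if f.2 then 1 <= asum a else asum a <= 1) /\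
  (hex_strict_at f \/ hex_strict_at g -> if f.2 then 1 < asum a else asum a < 1).
Proof.
have key (h k : face) : gpar1 Cyc (gpar (fframe h) P) = gpar (fframe k) P ->
    exposed_at h -> exposed_at k ->
    1 - b1 (gpar (fframe h) P) - b3 (gpar (fframe h) P) <= 0 /\
    (hex_strict_at h \/ hex_strict_at k -> 1 - b1 (gpar (fframe h) P) - b3 (gpar (fframe h) P) < 0).
  move=> hk th tk; have [hB _ [hc _]] := par_bounds (cbody_frame (fframe h) hC).
  have [V _] := exposed_le (cbody_frame (fframe h) hC) (natural_fframe h) th.
  have [V' _] := exposed_le (cbody_frame (fframe k) hC) (natural_fframe k) tk.
  have [ih _ _] := th; have [ik _ _] := tk; rewrite -hk in V' ik.
  have c1' : 0 <= 1 - c1 (gpar (fframe h) P) by lra.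
  split; first exact: (pair_le (natural_fframe h)).
  move=> hs; apply: (pair_lt (natural_fframe h)) => //.
  case: hs => hs; [left|right].
    exact: (hex_strict_lt (cbody_frame (fframe h) hC) (natural_fframe h) th).
  by rewrite hk; apply: (hex_strict_lt (cbody_frame (fframe k) hC) (natural_fframe k) tk).
rewrite !inE => /orP[|/orP[|/orP[|/orP[|/orP[|]]]]] /eqP [-> -> ->] hf hg;
  (have [|h1 h2] := key _ _ _ hf hg; first by case: (P));
  rewrite /= in h1 h2 *; (split; [lra|move=> /h2; lra]).
Qed.

(** Read in the frame [dframe a p], the failure of [badp], the sign of the sum and the gap are the
    three inequalities required by [resolve]. *)
Lemma resolve_face a p f : f.1 = a -> exposed_at f -> ~ badp a -> gap (needs a p) ->
  (if p then asum a <= 1 else 1 <= asum a) ->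
  dropdata (Kf (dframe a p)) (If (dframe a p)) (gpar (dframe a p) P) f.2 \/
  markable I P (opposite (dframe a p) f.2) f.
Proof.
move=> fa ht hb hg hs; have hF := cbody_frame (dframe a p) hC.
pose Q := gpar (dframe a p) P.
have [iQ q1 q2 q3] : [/\ inner Q, a3 Q <= a2 Q, a2 Q + a3 Q <= 1 & a3 Q < b3 Q].
  have [ii _ _] := ht; move: f fa ii {ht hF} => [[[]|] s] /= fa; rewrite -{}fa in Q hb hg hs *;
   case: p @Q hg hs; case: s => /=; rewrite /inner /= => hg hs [i1 i2 i3 i4];
   split; (try split); rewrite /=; move: hb => /=; lra.
have [|wI] := resolve f.2 hF iQ q1 q2 q3; [by left|right].
have af : actf (dframe a p) (X, f.2) = f.
  by move: f fa {ht wI} => [b s] /= ->; case: a {hb hg hs hF Q iQ q1 q2 q3} => [[]|]; case: p.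
rewrite -{2}af; apply: markable_frame; case: iQ => _ _ i3 i4.
case: (f.2) wI => wI.
  by have [u hu hev] := mark_hex hF i3 i4 wI; exists u.
apply: (markable_frame (w := [:: Xi]) (e := (Y, true, false)) (f := (X, true))).
have wI' : weakI (fun p0 => I (gmap (dframe a p) (gmap1 Xi p0)))
    (edir (gpar1 Xi Q) (Y, true, false)) (qpt (gpar1 Xi Q) f0).
  have := weakI_frame (If (dframe a p)) [:: Xi] (edir (gpar [:: Xi] Q) (Y, true, false))
    (qpt (gpar [:: Xi] Q) f0).
  by rewrite glin_edir gmap_qpt => ->.
have [//|//|u hu hev] := mark_hex (cbody1 Xi hF) _ _ wI'.
by exists u.
Qed.

End Data.
End Indexed.

(** * Building the list of directions edge by edge *)

Section Building.
Variable R : realType.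
Notation pt := (pt R).
Notation par := (par R).
Variables (K I : pt -> Prop) (P : par).
Hypotheses (hC : cbody K I P).
Implicit Types (L : seq pt) (e : edge) (f : face) (v : vertex).

Let hB : body K I := hC.

Definition eax e : pt :=
  match e.1.1 with
  | None => (1, 0, 0) | Some false => (0, 1, 0) | Some true => (0, 0, 1)
  end.

Lemma ept_mv e (t : R) : mv (ept e 0) t (eax e) = ept e t.
Proof. by move: e => [[[[]|] u] w]; apply: pt_eq => /=; ring. Qed.

Lemma ept_eend e b : ept e (bit R b) = vpt R (eend e b).
Proof. by move: e => [[[[]|] u] w]. Qed.

Lemma K_edge e (t : R) : 0 <= t -> t <= 1 ->
  K (mv (mv (ept e 0) t (eax e)) 1 (edir P e)).
Proof.
move=> t0 t1; move: e => [[[[]|] u] w].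
- by apply: conv_eq (cb_C hC t0 t1) _; apply: pt_eq => /=; ring.
- by apply: conv_eq (cb_B hC t0 t1) _; apply: pt_eq => /=; ring.
- by apply: conv_eq (cb_A hC t0 t1) _; apply: pt_eq => /=; ring.
Qed.

Definition Cov L (p : pt) : Prop := exists2 d, List.In d L & illum I d p.

Lemma Cov_open L : line_open (Cov L).
Proof.
move=> p u [d dL Ip]; have [e e0 he] := illum_open hB u Ip.
by exists e => // s se; exists d => //; exact: he.
Qed.

Lemma Cov_star L (l : R) (c p : pt) : K c -> Cov L p -> 0 < l -> l <= 1 ->
  Cov L (cmb l c p).
Proof. by move=> Kc [d dL Ip] l0 l1; exists d => //; exact: (illum_star hB). Qed.

Lemma Cov_cons d L p : Cov L p -> Cov (d :: L) p.
Proof. by move=> [d' dL Ip]; exists d' => //; right. Qed.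

(* Detours: segments from the end of an edge to a point illuminated from it. *)
Variable Dl : seq (edge * bool * pt).
Hypothesis hDl : forall x, List.In x Dl -> illum I (edir P x.1.1) x.2.

Record edge_covered L e : Prop := EdgeCovered {
  covered_edge : forall t : R, 0 <= t -> t <= 1 -> Cov L (ept e t);
  covered_face : forall f, illum I (edir P e) (qpt P f) -> Cov L (qpt P f);
  covered_detour : forall x, List.In x Dl -> x.1.1 = e ->
    forall l : R, 0 <= l -> l <= 1 -> Cov L (cmb l (ept e (bit R x.1.2)) x.2) }.

Lemma edge_covered_mono L L2 e : (forall p, Cov L p -> Cov L2 p) -> edge_covered L e -> edge_covered L2 e.
Proof.
move=> sub [h1 h2 h3]; split.
- by move=> t t0 t1; apply/sub/h1.
- by move=> f hf; apply/sub/h2.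
- by move=> x xD xe l l0 l1; apply/sub/h3.
Qed.

(** The edge, the chord ends it illuminates, its detours and the extra demand [Ex] of the caller are
    all served by every small [h], hence by a common one. *)
Lemma tilt_step L e m (t0 : R) (Ex : R -> Prop) : I m -> 0 <= t0 -> t0 <= 1 ->
  t0 = 0 \/ Cov L (ept e 0) -> t0 = 1 \/ Cov L (ept e 1) -> ev Ex ->
  exists2 h, Ex h &
    edge_covered (mv (edir P e) h (mv m (-1) (mv (ept e t0) 1 (edir P e))) :: L) e.
Proof.
move=> Im t00 t01 c0 c1 hEx.
pose dd h := mv (edir P e) h (mv m (-1) (mv (ept e t0) 1 (edir P e))).
have E1 := edge_cover hB (K_edge e) (@Cov_open L) Im t00 t01 c0.
rewrite ept_mv in E1; have {}E1 := E1 c1.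
have E2 : ev (fun h => forall f, List.In f faces ->
    illum I (edir P e) (qpt P f) -> illum I (dd h) (qpt P f)).
  apply: ev_seq => f _.
  have [hf|hf] := pselect (illum I (edir P e) (qpt P f)); last by apply: ev_true.
  apply: ev_mono (illum_dir_open hB (mv m (-1) (mv (ept e t0) 1 (edir P e))) hf).
  by [].
have E3 : ev (fun h => forall x, List.In x Dl -> x.1.1 = e ->
    forall l : R, 0 <= l -> l <= 1 ->
    illum I (dd h) (cmb l (ept e (bit R x.1.2)) x.2) \/
    Cov L (cmb l (ept e (bit R x.1.2)) x.2)).
  apply: ev_seq => x xD.
  have [xe|xe] := pselect (x.1.1 = e); last by apply: ev_true.
  have Ix := hDl xD; rewrite xe in Ix.
  have b01 : bit R x.1.2 = 0 \/ bit R x.1.2 = 1.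
    by case: (x.1.2); [right|left].
  have cb : t0 = bit R x.1.2 \/ Cov L (mv (ept e 0) (bit R x.1.2) (eax e)).
    by rewrite ept_mv; case: (x.1.2).
  have := detour_cover hB (K_edge e) (@Cov_open L) Im t00 t01 b01 Ix cb.
  by apply: ev_mono => h _ hh _ l l0 l1; have := hh l l0 l1; rewrite /tilt !ept_mv.
have [h [hx [h1 [h2 h3]]]] := ev_ex (ev_and hEx (ev_and E1 (ev_and E2 E3))).
exists h => //; split.
- move=> t tp tq; have := h1 t tp tq; rewrite /tilt !ept_mv.
  by case=> [It|Ct]; [exists (dd h) => //; left|exact: Cov_cons].
- move=> f hf; exists (dd h); first by left.
  by apply: h2 hf; move: f => [[[]|] []]; rewrite /faces /=; tauto.
- move=> x xD xe l l0 l1; case: (h3 x xD xe l l0 l1) => [It|Ct].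
    by exists (dd h) => //; left.
  exact: Cov_cons.
Qed.

(** With the tilt anchored at the end [b], the only dark part is at the other end, which is already
    covered. *)
Lemma step_tree L e (b : bool) : Cov L (vpt R (eend e (~~ b))) ->
  exists d, edge_covered (d :: L) e.
Proof.
rewrite -ept_eend => Ce; have [m Im] := body_ne hB.
have [||||| h _ hd] := @tilt_step L e m (bit R b) (fun _ => True) Im.
- by case: (b).
- by case: (b); rewrite /bit ?ler01 ?lexx.
- by case: b Ce => Ce; [right|left].
- by case: b Ce => Ce; [left|right].
- by apply: ev_true.
by exists (mv (edir P e) h (mv m (-1) (mv (ept e (bit R b)) 1 (edir P e)))).
Qed.

(** The anchor [t0] is now dictated by the chord end, so both ends of the edge have to be covered
    before; marked edges therefore come after the tree. *)
Lemma step_mark L e f : markable I P e f -> (forall v, Cov L (vpt R v)) ->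
  exists d, edge_covered (d :: L) e /\ Cov (d :: L) (qpt P f).
Proof.
move=> [u [[m [t0 [Im /andP[t00 t01] ->]]] hev]] hv.
have Ce b : Cov L (ept e (bit R b)) by rewrite ept_eend.
have [h hh hd] := tilt_step Im t00 t01 (or_intror (Ce false)) (or_intror (Ce true)) hev.
exists (mv (edir P e) h (mv m (-1) (mv (ept e t0) 1 (edir P e)))); split=> //.
by eexists; [left; reflexivity|].
Qed.

Lemma steps_tree (st : seq (edge * bool)) V L :
  (forall v, v \in V -> Cov L (vpt R v)) -> vsteps V st ->
  exists L2, [/\ size L2 = (size st + size L)%N, forall p, Cov L p -> Cov L2 p,
    forall e, e \in [seq x.1 | x <- st] -> edge_covered L2 e &
    forall v, v \in [seq eend x.1 x.2 | x <- st] -> Cov L2 (vpt R v)].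
Proof.
elim: st V L => [|[e b] st IH] V L hV /=; first by exists L.
case/andP => eV vs; have [d hd] := step_tree (hV _ eV).
have Cb : Cov (d :: L) (vpt R (eend e b)).
  by rewrite -ept_eend; apply: (covered_edge hd); case: (b); rewrite /bit ?ler01 ?lexx.
have [|L2 [sL2 sub hd2 hv2]] := IH (eend e b :: V) (d :: L) _ vs.
  by move=> v; rewrite inE => /orP[/eqP ->//|/hV]; exact: Cov_cons.
exists L2; split.
- by rewrite sL2 /= addnS.
- by move=> p Cp; exact/sub/Cov_cons.
- move=> e'; rewrite inE => /orP[/eqP ->|]; last exact: hd2.
  exact: edge_covered_mono sub hd.
- by move=> v; rewrite inE => /orP[/eqP ->|]; [exact: sub|exact: hv2].
Qed.

Lemma steps_mark (mk : seq (edge * face)) L :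
  (forall x, x \in mk -> markable I P x.1 x.2) -> (forall v, Cov L (vpt R v)) ->
  exists L2, [/\ size L2 = (size mk + size L)%N, forall p, Cov L p -> Cov L2 p &
    forall x, x \in mk -> edge_covered L2 x.1 /\ Cov L2 (qpt P x.2)].
Proof.
elim: mk L => [|x mk IH] L hm hv /=; first by exists L.
have [d [hd hq]] := step_mark (hm x (mem_head _ _)) hv.
have [||L2 [sL2 sub h2]] := IH (d :: L).
- by move=> y ym; apply: hm; rewrite inE ym orbT.
- by move=> v; exact: Cov_cons.
exists L2; split.
- by rewrite sL2 /= addnS.
- by move=> p Cp; exact/sub/Cov_cons.
- move=> y; rewrite inE => /orP[/eqP ->|]; last exact: h2.
  by split; [exact: edge_covered_mono sub hd|exact: sub].
Qed.

Lemma mem_edges e : e \in edges.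
Proof. by move: e => [[[[]|] []] []]. Qed.

Lemma mem_vertices v : v \in vertices.
Proof. by move: v => [[[] []] []]. Qed.

Lemma size_rest (S : seq edge) : uniq S -> (size S + size (rest S) = 12)%N.
Proof.
move=> uS; transitivity (size edges) => //.
rewrite -(count_predC (mem S) edges) /rest size_filter; congr (_ + _)%N.
rewrite -size_filter; apply/perm_size/uniq_perm => //.
  exact: filter_uniq.
by move=> e; rewrite mem_filter mem_edges andbT.
Qed.

Lemma tree_cover (mk : seq (edge * face)) (dr : seq edge) v L :
  uniq ([seq x.1 | x <- mk] ++ dr) -> conn ([seq x.1 | x <- mk] ++ dr) ->
  (forall x, x \in mk -> markable I P x.1 x.2) -> Cov L (vpt R v) ->
  exists L2, [/\ (size L2 + size dr = 12 + size L)%N, forall p, Cov L p -> Cov L2 p,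
    forall e, e \notin dr -> edge_covered L2 e & forall x, x \in mk -> Cov L2 (qpt P x.2)].
Proof.
set S := _ ++ dr => uS /allP /(_ v (mem_vertices v)) /and4P[hs /eqP sz hr hv] hm Cv.
have [|L1 [s1 sub1 d1 v1]] := @steps_tree _ [:: v] L _ hs.
  by move=> u; rewrite inE => /eqP ->; exact: Cv.
have V1 u : Cov L1 (vpt R u).
  have /orP[/eqP ->|] := allP hv u (mem_vertices u); last exact: v1.
  exact: sub1.
have [L2 [s2 sub2 h2]] := steps_mark hm V1.
exists L2; split.
- have := size_rest uS; rewrite /S size_cat size_map -sz.
  by move=> e; rewrite s2 s1 addnAC addnA e.
- by move=> p /sub1; exact: sub2.
- move=> e edr; have [em|em] := boolP (e \in [seq x.1 | x <- mk]).
    by case/mapP: em => x xm ->; have [] := h2 x xm.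
  apply: edge_covered_mono sub2 _; apply: d1; apply: (allP hr).
  by rewrite mem_filter mem_edges andbT /S mem_cat (negbTE em).
- by move=> x xm; have [] := h2 x xm.
Qed.

End Building.

(** * From a plan to fourteen directions *)

Section Conclusion.
Variable R : realType.
Notation pt := (pt R).
Notation par := (par R).
Local Notation X := (None : axis).
Local Notation Y := (Some false : axis).
Local Notation bot := ((X, false, true) : edge).
Local Notation top := ((X, true, true) : edge).

Lemma acte_inj w : injective (acte w).
Proof.
elim: w => [|g w IH] e e' //= h; apply: IH; move: h.
have inj : injective (acte1 g).
  case: g; [|apply: inv_inj|apply: inv_inj|apply: inv_inj|apply: inv_inj];
    try by move=> [[[[]|] []] []].
  apply: (can_inj (g := fun e => acte1 Cyc (acte1 Cyc e))).
  by move=> [[[[]|] u] v].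
exact: inj.
Qed.

Lemma filter_subseqs (T : eqType) (a : pred T) (s : seq T) :
  (seq.filter a s, seq.filter (predC a) s) \in subseqs s.
Proof.
elim: s => //= x s IH; rewrite mem_cat; case: (a x) => /=; apply/orP; [left|right].
  by apply/mapP; exists (seq.filter a s, seq.filter (predC a) s).
by apply/mapP; exists (seq.filter a s, seq.filter (predC a) s).
Qed.

Lemma at_face_map (g : face -> bool) f : at_face [seq g x | x <- faces] f = g f.
Proof. by move: f => [[[]|] []]. Qed.

Lemma mem_faces f : f \in faces.
Proof. by move: f => [[[]|] []]. Qed.

Lemma mem_marks acc x : x \in marks acc ->
  x.1 = hexe x.2 /\ List.In (x.2, Hex) acc \/ x.1 = nonhexe x.2 /\ List.In (x.2, Non) acc.
Proof.
elim: acc => // -[f c] acc IH.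
have H : x \in marks acc ->
    x.1 = hexe x.2 /\ List.In (x.2, Hex) ((f, c) :: acc) \/
    x.1 = nonhexe x.2 /\ List.In (x.2, Non) ((f, c) :: acc).
  by move=> /IH [[-> h]|[-> h]]; [left|right]; split=> //; right.
case: c H => H //=; rewrite inE => /orP[/eqP ->|/H //]; [left|right];
  by split=> //; left.
Qed.

Lemma all_In (T : Type) (q : pred T) s x : all q s -> List.In x s -> q x.
Proof. by elim: s => //= y s IH /andP[qy /IH h] [<-|]. Qed.

Lemma mem_owns acc f : f \in owns acc <-> List.In (f, Own) acc.
Proof.
elim: acc => //= -[g c] acc IH; rewrite /owns /=; case: c => /=.
- rewrite inE; split=> [/orP[/eqP ->|/IH]|[[->]|/IH ->]]; rewrite ?eqxx ?orbT //;
    by [left|right].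
- by rewrite IH; split=> [|[]//]; right.
- by rewrite IH; split=> [|[]//]; right.
- by rewrite IH; split=> [|[]//]; right.
Qed.

Lemma mem_resd acc f : f \in resd acc <-> List.In (f, Res) acc.
Proof.
elim: acc => //= -[g c] acc IH; rewrite /resd /=; case: c => /=.
- by rewrite IH; split=> [|[]//]; right.
- by rewrite IH; split=> [|[]//]; right.
- by rewrite IH; split=> [|[]//]; right.
- rewrite inE; split=> [/orP[/eqP ->|/IH]|[[->]|/IH ->]]; rewrite ?eqxx ?orbT //;
    by [left|right].
Qed.

Lemma marks_In acc f : List.In (f, Hex) acc \/ List.In (f, Non) acc ->
  exists e, (e, f) \in marks acc.
Proof.
elim: acc => [[]//|[g c] acc IH] /= [[[-> ->]|h]|[[-> ->]|h]].
- by exists (hexe f); rewrite mem_head.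
- have [e he] := IH (or_introl h).
  by exists e; case: c => //; rewrite inE he orbT.
- by exists (nonhexe f); rewrite mem_head.
- have [e he] := IH (or_intror h).
  by exists e; case: c => //; rewrite inE he orbT.
Qed.

Variables (K I : pt -> Prop) (P : par).
Hypotheses (hC : cbody K I P) (hN : natural P).

Let tnl := [seq `[< exposed_at K I P f >] | f <- faces].
Let thl := [seq `[< exposed_at K I P f /\ hex_strict_at I P f >] | f <- faces].
Let tml := [seq `[< exposed_at K I P f /\ nonhex_strict_at I P f >] | f <- faces].
Let sgl := flatten [seq [:: 1 <= asum P a; asum P a <= 1] | a <- axes].
Let bdl := [seq `[< badp P a >] | a <- axes].

Lemma bsub_map (g h : face -> bool) : (forall f, g f -> h f) ->
  bsub [seq g f | f <- faces] [seq h f | f <- faces].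
Proof. by move=> gh; rewrite /bsub zip_map all_map; apply/allP => f _; apply/implyP/gh. Qed.

Lemma state_signs : sign_ok tnl thl sgl.
Proof.
have leE a : le_at sgl a = (1 <= asum P a) by case: a => [[]|].
have geE a : ge_at sgl a = (asum P a <= 1) by case: a => [[]|].
apply/andP; split; first by apply/allP => a _; rewrite leE geE le_total.
apply/allP => -[[f g] a] fga; rewrite /tnl /thl !at_face_map leE geE.
case: asboolP => // tf; case: asboolP => // tg /=.
have [h1 h2] := pair_sign hC hN fga tf tg.
apply/andP; split; first by case: (f.2) h1.
apply/implyP => h; have hs : hex_strict_at I P f \/ hex_strict_at I P g.
  by case/orP: h => /asboolP[_ h]; [left|right].
by move: (h2 hs); case: (f.2); rewrite ltNge.
Qed.

Lemma illum_inward (p m : pt) : K p -> I m -> illum I (mv m (-1) p) p.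
Proof.
move=> _ Im; exists 1 => //; apply: conv_eq Im _.
by apply: pt_eq => /=; ring.
Qed.

Lemma K_qpt f : K (qpt P f).
Proof.
have bb (b : bool) : 0 <= bit R b /\ bit R b <= 1 by case: b; rewrite /bit ?lexx ?ler01.
move: f => [[[]|] b]; have [h1 h2] := bb b.
- exact: (cb_C hC h1 h2).
- exact: (cb_B hC h1 h2).
- exact: (cb_A hC h1 h2).
Qed.

(** [n] asserts that some end in [O] is strict; its own direction then illuminates a vertex as well
    and saves one. *)
Lemma root_directions (O : seq face) (n : bool) :
  (n -> exists2 f, f \in O & exposed_at K I P f /\ (hex_strict_at I P f \/ nonhex_strict_at I P f)) ->
  exists L v, [/\ size L = (size O + ~~ n)%N, Cov I L (vpt R v) &
    forall f, f \in O -> Cov I L (qpt P f)].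
Proof.
move=> hn; have [m Im] := body_ne hC.
have inw f : illum I (mv m (-1) (qpt P f)) (qpt P f) by exact: illum_inward (K_qpt f) Im.
case: n hn => [[//|f fO [tf hs]]|_].
  have [d [v [h1 h2]]] := root_face hC hN tf hs.
  pose dir g := if g == f then d else mv m (-1) (qpt P g).
  have dirO g : g \in O -> List.In (dir g) [seq dir g | g <- O].
    elim: (O) => // g' O' IH; rewrite inE => /orP[/eqP ->|/IH]; first by left.
    by right.
  exists [seq dir g | g <- O], v; split; first by rewrite size_map addn0.
    by exists d => //; have := dirO _ fO; rewrite /dir eqxx.
  move=> g gO; exists (dir g); first exact: dirO.
  by rewrite /dir; case: eqP => [->|].
have dirO g : g \in O -> List.In (mv m (-1) (qpt P g)) [seq mv m (-1) (qpt P g) | g <- O].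
  elim: (O) => // g' O' IH; rewrite inE => /orP[/eqP ->|/IH]; first by left.
  by right.
pose v : vertex := (true, true, true).
exists (mv m (-1) (vpt R v) :: [seq mv m (-1) (qpt P g) | g <- O]), v; split.
- by rewrite /= size_map addn1.
- exists (mv m (-1) (vpt R v)); first by left.
  by exists 1 => //; apply: conv_eq Im _; apply: pt_eq => /=; ring.
- by move=> g gO; exists (mv m (-1) (qpt P g)) => //; right; exact: dirO.
Qed.

Section Frame.
Variable w : seq gen.
Local Notation Kw := (fun p => K (gmap w p)).
Local Notation Iw := (fun p => I (gmap w p)).
Local Notation Q := (gpar w P).

(* The detours of [Dl] replace the edge {x = s, z = 1} of the frame w. *)
Definition dropped (Dl : seq (edge * bool * pt)) (s : bool) : Prop :=
  exists v2 v3 h y b b', [/\ [/\ 0 < h, h <= 1, 0 < y & y < 1],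
    forall p, Kw p -> v2 * (p.1.2 - a2 Q) + v3 * (p.2 - a3 Q) <= flip s p.1.1,
    [/\ 0 < - v2 * a2 Q + v3 * (1 - a3 Q), 0 < v2 * (1 - a2 Q) + v3 * (1 - a3 Q) &
      h <= v2 * (y - a2 Q) + v3 * (1 - a3 Q)],
    List.In (acte w bot, b, gmap w (flip s h, y, 1)) Dl /\
    ept (acte w bot) (bit R b) = gmap w (flip s 0, 0, 1) &
    List.In (acte w top, b', gmap w (flip s h, y, 1)) Dl /\
    ept (acte w top) (bit R b') = gmap w (flip s 0, 1, 1)].

Lemma ept_bit e (s : bool) : exists b, ept (acte w e) (bit R b) = gmap w (ept e (bit R s)).
Proof.
have [b hb] := gmap_ept R w e; exists (b (+) s); rewrite hb; congr ept.
by case: b {hb}; case: s; rewrite /bit /flip /=; ring.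
Qed.

Lemma dropped_cons x Dl s : dropped Dl s -> dropped (x :: Dl) s.
Proof.
move=> [v2 [v3 [h [y [b [b' [h1 h2 h3 [h4 h5] [h6 h7]]]]]]]].
by exists v2, v3, h, y, b, b'; split=> //; split=> //; right.
Qed.

Lemma detours (ss : seq bool) : (forall s, s \in ss -> dropdata Kw Iw Q s) ->
  exists Dl, (forall x, List.In x Dl -> illum I (edir P x.1.1) x.2) /\
    forall s, s \in ss -> dropped Dl s.
Proof.
elim: ss => [|s ss IH] hs; first by exists [::].
have [|Dl [h1 h2]] := IH; first by move=> t ht; apply: hs; rewrite inE ht orbT.
have [v2 [v3 [h [y [H1 H2 H3 H4 H5]]]]] := hs s (mem_head _ _).
have [b hb] := ept_bit bot s; have [b' hb'] := ept_bit top s.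
have rs : flip s 0 = bit R s by case: (s); rewrite /flip /bit ?subr0.
exists [:: (acte w bot, b, gmap w (flip s h, y, 1)), (acte w top, b', gmap w (flip s h, y, 1)) & Dl].
split.
  move=> x [<-|[<-|]]; last exact: h1.
    by rewrite /= -glin_edir; apply/illum_frame.
  by rewrite /= -glin_edir; apply/illum_frame.
move=> t; rewrite inE => /orP[/eqP ->|/h2 ht]; last exact/dropped_cons/dropped_cons.
exists v2, v3, h, y, b, b'; split=> //; split.
- by left.
- by rewrite hb rs.
- by right; left.
- by rewrite hb' rs.
Qed.

Lemma cover_from_edges (Dl : seq (edge * bool * pt)) (ss : seq bool) (L : seq pt) :
  (forall s, s \in ss -> dropped Dl s) ->
  (forall e, e \notin [seq drope w s | s <- ss] -> edge_covered I P Dl L e) ->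
  (forall f, on_skeleton P f \/ Cov I L (qpt P f)) ->
  forall p, K p -> Cov I L p.
Proof.
move=> hd hL hf.
have nd e : (forall s, s \in ss -> e <> (Y, s, true)) -> edge_covered I P Dl L (acte w e).
  by move=> he; apply: hL; apply/mapP => -[s /he h /acte_inj].
have hf' f : Cov I L (qpt P f).
  case: (hf f) => // -[e [t [t0 t1 et]]]; rewrite et.
  have [/mapP[s sS ed]|] := boolP (e \in [seq drope w s | s <- ss]); last first.
    by move=> /hL [h _ _]; exact: h.
  (* A chord end on a dropped edge would be a point of [K] strictly beyond the plane that cuts the
     edge off. *)
  exfalso; have [v2 [v3 [h [y [b [b' [_ cut [L0 L1 _] _ _]]]]]]] := hd s sS.
  have [c hc] := gmap_ept R w (Y, s, true).
  have ee : gmap w (ept (Y, s, true) (flip c t)) = ept e t.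
    by rewrite hc ed; congr ept; case: (c); rewrite /flip; ring.
  have := cut (ept (Y, s, true) (flip c t)); rewrite ee -et => /(_ (K_qpt f)) /=.
  have -> : flip s (bit R s) = 0 by case: (s); rewrite /flip /bit; ring.
  have : 0 <= flip c t <= 1 by case: (c); rewrite /flip; lra.
  move: (flip c t) => u /andP[u0 u1].
  have : 0 <= (1 - u) * (- v2 * a2 Q + v3 * (1 - a3 Q)) by apply: mulr_ge0; lra.
  have : 0 <= u * (v2 * (1 - a2 Q) + v3 * (1 - a3 Q)) by apply: mulr_ge0; lra.
  by have [u00|u00] := eqVneq u 0; [rewrite u00; lra|];
    have : 0 < u * (v2 * (1 - a2 Q) + v3 * (1 - a3 Q));
    [apply: mulr_gt0 => //; rewrite lt_neqAle eq_sym u00|lra].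
have side_s s : side Kw Q (fun p => Cov I L (gmap w p)) s.
  have rs : flip s 0 = bit R s by case: (s); rewrite /flip /bit ?subr0.
  have [sS|sS] := boolP (s \in ss); last first.
    left=> t t0 t1; have [b hb] := gmap_ept R w (Y, s, true).
    have [he _ _] := nd (Y, s, true) (fun s' s'S e => negP sS
      (eq_ind_r (fun x => x \in ss) s'S (congr1 (fun x : edge => x.1.2) e))).
    have -> : (flip s 0, t, 1) = ept (Y, s, true) t by rewrite rs.
    by rewrite hb; apply: he; case: (b); rewrite /flip; lra.
  right; have [v2 [v3 [h [y [b [b' [H1 H2 [L0 L1 Lh] [H4 H5] [H6 H7]]]]]]]] := hd s sS.
  exists v2, v3, h, y; split=> //; first by split=> //; exact: ltW.
  move=> l l0 l1; split.
    have [_ _ /(_ _ H4 erefl l l0 l1)] := nd bot (fun _ _ => ltac:(by [])).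
    rewrite /= H5 -gmap_cmb => Cl; apply: conv_eq Cl _; congr gmap.
    by apply: pt_eq; case: (s) => /=; rewrite /flip; ring.
  have [_ _ /(_ _ H6 erefl l l0 l1)] := nd top (fun _ _ => ltac:(by [])).
  rewrite /= H7 -gmap_cmb => Cl; apply: conv_eq Cl _; congr gmap.
  by apply: pt_eq; case: (s) => /=; rewrite /flip; ring.
move=> p Kp; have [q qp] := gmap_surj w p; rewrite -qp in Kp *.
apply: (cov_all (cbody_frame w hC) (Cov := fun p => Cov I L (gmap w p))) => //.
- by move=> l c x Kc Cx l0 l1; rewrite gmap_cmb; exact: (Cov_star hC).
- by move=> f; rewrite gmap_qpt.
- move=> e t t0 t1 e1 e2; have [b hb] := gmap_ept R w e; rewrite hb.
  have [he _ _] : edge_covered I P Dl L (acte w e).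
    by apply: nd => -[] _ h; [exact: e1|exact: e2].
  by apply: he; case: (b); rewrite /flip; lra.
Qed.

End Frame.

Lemma illum14 : exists2 L, (size L <= 14)%N & forall p, K p -> Cov I L p.
Proof.
have [|||||||| ch [acc]] := @plan_exists tnl thl tml sgl bdl; rewrite ?size_map //.
- by apply: bsub_map => f /asboolP[h _]; apply/asboolP.
- by apply: bsub_map => f /asboolP[h _]; apply/asboolP.
- exact: state_signs.
rewrite /plan_ok; case: ifP => // hsz /and5P[hleg /allP hcomp hfr hu /allP hout].
pose w := if ch is Some (a, p) then dframe a p else [::].
have bdE a : bad_at bdl a = `[< badp P a >] by case: a => [[]|].
have leg f c : List.In (f, c) acc -> exposed_at K I P f /\ ~ badp P f.1.
  move=> /(all_In hleg) /and3P[]; rewrite /tnl at_face_map /= bdE.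
  by move=> /asboolP h1 /asboolPn.
have hres f : f \in resd acc ->
    dropdata (fun p => K (gmap w p)) (fun p => I (gmap w p)) (gpar w P) f.2 \/
    markable I P (opposite w f.2) f.
  move=> /mem_resd fr; have [tf bf] := leg _ _ fr.
  have /and3P[_ _ /=] := all_In hleg fr.
  move: hfr @w; rewrite /frame_ok; case: ch {hout hleg} => // -[a p].
  case/and3P=> _ hsg /hasP[g _ /and3P[g1 g2 /eqP g3]] /eqP fa.
  apply: (resolve_face hC (a := a) (p := p)) => //; first by rewrite -fa.
    rewrite -g3; move: g1 g2; rewrite /tnl /thl /tml !at_face_map => /asboolP tg.
    by case/orP=> /asboolP[_ h]; apply: (gives_gap hC hN tg); [left|right].
  by move: hsg; case: (p) => //; case: (a) => [[]|].
pose dd := fun f : face =>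
  `[< dropdata (fun p => K (gmap w p)) (fun p => I (gmap w p)) (gpar w P) f.2 >].
pose D := seq.filter dd (resd acc); pose M := seq.filter (predC dd) (resd acc).
have /and3P[uq /allP hcov hconn] := hout _ (filter_subseqs dd (resd acc)).
rewrite -/w -/D -/M /= in uq hcov hconn.
pose dr := [seq drope w s | s <- [seq f.2 | f <- D]].
have drE : [seq drope w f.2 | f <- D] = dr by rewrite /dr -map_comp.
pose mk := marks acc ++ [seq (opposite w f.2, f) | f <- M].
have mkE : [seq x.1 | x <- marks acc] ++ [seq opposite w f.2 | f <- M] =
    [seq x.1 | x <- mk] by rewrite /mk map_cat -map_comp.
rewrite drE mkE in uq hconn; rewrite drE in hcov.
have [Dl [hDl hdrop]] : exists Dl, (forall x, List.In x Dl -> illum I (edir P x.1.1) x.2) /\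
    forall s, s \in [seq f.2 | f <- D] -> dropped w Dl s.
  apply: detours => s /mapP[f]; rewrite mem_filter => /andP[/asboolP h _] ->.
  exact: h.
have hmk x : x \in mk -> markable I P x.1 x.2.
  rewrite /mk mem_cat => /orP[/mem_marks|/mapP[f]].
    case: x => e f /= [[-> h]|[-> h]]; have [tf _] := leg _ _ h;
      have /and3P[_ _ /=] := all_In hleg h; rewrite /thl /tml at_face_map => /asboolPn nh.
      by apply: (mark_hexe hC) => // th; apply: nh.
    by apply: (mark_nonhexe hC) => // th; apply: nh.
  rewrite mem_filter => /andP[/asboolPn nd fr] -> /=.
  by case: (hres f fr).
pose n := has (fun f => at_face thl f || at_face tml f) (owns acc).
have [|L [v [sL Lv LO]]] := @root_directions (owns acc ++ D) n.
  move=> /hasP[f fo]; rewrite /thl /tml !at_face_map => hf; exists f.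
    by rewrite mem_cat fo.
  by case/orP: hf => /asboolP[h1 h2]; split=> //; [left|right].
have cn : conn ([seq x.1 | x <- mk] ++ dr).
  by move: hconn; case: ifP => // h _; apply: conn_small => // e _; exact: mem_edges.
have [L2 [s2 sub2 done2 mk2]] := tree_cover hC hDl uq cn hmk Lv.
exists L2.
  (* Each face in [D] adds an own direction and removes an edge, so [D] cancels from the count. *)
  have : (size L2 + size D <= 14 + size D)%N.
    move: s2; rewrite /dr !size_map => ->; rewrite sL size_cat.
    apply: (@leq_trans (12 + (2 + size D))%N); last by rewrite addnA.
    by rewrite leq_add2l addnAC leq_add2r.
  by rewrite leq_add2r.
apply: (cover_from_edges hdrop done2) => f.
have cv e : covers K I P e f -> e \notin dr -> Cov I L2 (qpt P f).
  move=> he /done2 [h1 h2 _]; case: he => [|[k [t [l [Kk /andP[t0 t1] /andP[l0 l1] ->]]]]].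
    exact: h2.
  by apply: (Cov_star hC) => //; exact: h1.
have := hcov f (mem_faces f); rewrite {1}/tnl at_face_map bdE; case: asboolP => tf.
  case: asboolP => bf /= hsp.
    by right; apply: cv hsp; exact: (bad_covers hC hN).
  right; have := hcomp f (mem_faces f); rewrite /tnl at_face_map bdE.
  case: asboolP => // _; case: asboolP => // _ /= fa.
  have [c hc] : exists c, List.In (f, c) acc.
    move: fa; elim: (acc) => // -[g c] acc' IH; rewrite inE => /orP[/eqP /= ->|/IH [c' h]].
      by exists c; left.
    by exists c'; right.
  case: c hc => hc.
  - by apply/sub2/LO; rewrite mem_cat; apply/orP; left; apply/mem_owns.
  - have [e he] := marks_In (or_introl hc).
    by apply: (mk2 (e, f)); rewrite mem_cat he.
  - have [e he] := marks_In (or_intror hc).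
    by apply: (mk2 (e, f)); rewrite mem_cat he.
  - have fr : f \in resd acc by apply/mem_resd.
    have [df|df] := boolP (dd f).
      by apply/sub2/LO; rewrite mem_cat mem_filter df fr orbT.
    apply: (mk2 (opposite w f.2, f)); rewrite mem_cat; apply/orP; right.
    by apply/mapP; exists f => //; rewrite mem_filter /= df.
case/andP=> h1 h2; have [h|h|h] := not_exposed_at hC tf; first by left.
  by right; exact: cv h1.
by right; exact: cv h2.
Qed.

End Conclusion.

(** * Affine coordinates from a maximal parallelepiped *)

Section AffineFrame.
Variable R : realType.
Notation pt := (pt R).
Notation par := (par R).
Implicit Types (p q d o u v w : pt).

Definition det3 u v w : R := dot u (cross v w).

Definition lin u v w d : pt := mv (mv (mv (0, 0, 0) d.1.1 u) d.1.2 v) d.2 w.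
Definition aff o u v w p : pt := mv o 1 (lin u v w p).

Lemma aff_mv o u v w p (s : R) d :
  aff o u v w (mv p s d) = mv (aff o u v w p) s (lin u v w d).
Proof. by apply: pt_eq => /=; ring. Qed.

Lemma aff_cmb o u v w (l : R) p q :
  aff o u v w (cmb l p q) = cmb l (aff o u v w p) (aff o u v w q).
Proof. by apply: pt_eq => /=; ring. Qed.

Lemma cramer u v w p : det3 u v w != 0 ->
  lin u v w (det3 p v w / det3 u v w, det3 u p w / det3 u v w,
             det3 u v p / det3 u v w) = p.
Proof.
move=> D0; have h (x y z a b c t : R) : x * a + y * b + z * c = t * det3 u v w ->
    0 + x / det3 u v w * a + y / det3 u v w * b + z / det3 u v w * c = t.
  move=> h; apply: (mulIf D0); rewrite -h; field; exact: D0.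
by apply: pt_eq; apply: h; rewrite /det3 /dot /cross /=; ring.
Qed.

Lemma body_aff (K I : pt -> Prop) o u v w : body K I -> det3 u v w != 0 ->
  body (fun p => K (aff o u v w p)) (fun p => I (aff o u v w p)).
Proof.
move=> [cK IK st oI [m Im]] D0; split.
- by move=> l p q l0 l1 Kp Kq; rewrite aff_cmb; exact: cK.
- by move=> p; exact: IK.
- by move=> l p q l0 l1 Kp Iq; rewrite aff_cmb; exact: st.
- move=> p d Ip; have [e e0 he] := oI _ (lin u v w d) Ip; exists e => // s se.
  by rewrite aff_mv; exact: he.
- have := cramer (mv m (-1) o) D0; set c := (_, _, _) => hc.
  exists c; apply: conv_eq Im _; rewrite /aff hc.
  by apply: pt_eq => /=; ring.
Qed.

(* Maximality of the volume bounds the coordinates of p - q, for p and q in K,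
   by 1 in absolute value; so K fits in a translate of the parallelepiped. *)
Lemma box_frame (K I : pt -> Prop) (x1 y1 x2 y2 x3 y3 : pt) :
  body K I -> K x1 -> K y1 -> K x2 -> K y2 -> K x3 -> K y3 ->
  let u := mv x1 (-1) y1 in let v := mv x2 (-1) y2 in let w := mv x3 (-1) y3 in
  det3 u v w != 0 ->
  (forall p q, K p -> K q -> [/\ `|det3 (mv p (-1) q) v w| <= `|det3 u v w|,
     `|det3 u (mv p (-1) q) w| <= `|det3 u v w| &
     `|det3 u v (mv p (-1) q)| <= `|det3 u v w|]) ->
  exists o P, cbody (fun p => K (aff o u v w p)) (fun p => I (aff o u v w p)) P.
Proof.
move=> hB Kx1 Ky1 Kx2 Ky2 Kx3 Ky3 u v w D0 hmax.
pose D := det3 u v w.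
pose f1 p := det3 p v w / D; pose f2 p := det3 u p w / D; pose f3 p := det3 u v p / D.
have f1B p q : f1 p - f1 q = det3 (mv p (-1) q) v w / D.
  by rewrite /f1 -mulrBl; congr (_ / _); rewrite /det3 /dot /=; ring.
have f2B p q : f2 p - f2 q = det3 u (mv p (-1) q) w / D.
  by rewrite /f2 -mulrBl; congr (_ / _); rewrite /det3 /dot /cross /=; ring.
have f3B p q : f3 p - f3 q = det3 u v (mv p (-1) q) / D.
  by rewrite /f3 -mulrBl; congr (_ / _); rewrite /det3 /dot /cross /=; ring.
have le1 (x : R) : `|x| <= `|D| -> x / D <= 1.
  move=> h; apply: le_trans (ler_norm _) _; rewrite normrM normfV.
  by rewrite ler_pdivrMr ?mul1r // normr_gt0.
have b1' p q : K p -> K q -> f1 p - f1 q <= 1.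
  by move=> Kp Kq; rewrite f1B; apply: le1; have [] := hmax p q Kp Kq.
have b2' p q : K p -> K q -> f2 p - f2 q <= 1.
  by move=> Kp Kq; rewrite f2B; apply: le1; have [] := hmax p q Kp Kq.
have b3' p q : K p -> K q -> f3 p - f3 q <= 1.
  by move=> Kp Kq; rewrite f3B; apply: le1; have [] := hmax p q Kp Kq.
have e1 : f1 x1 - f1 y1 = 1 by rewrite f1B divff.
have e2 : f2 x2 - f2 y2 = 1 by rewrite f2B divff.
have e3 : f3 x3 - f3 y3 = 1 by rewrite f3B divff.
have fK p : lin u v w (f1 p, f2 p, f3 p) = p by exact: cramer.
have f1l p : f1 (lin u v w p) = p.1.1.
  apply: (mulIf D0); rewrite divfK // /D /det3 /lin /dot /cross /=; ring.
have f2l p : f2 (lin u v w p) = p.1.2.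
  apply: (mulIf D0); rewrite divfK // /D /det3 /lin /dot /cross /=; ring.
have f3l p : f3 (lin u v w p) = p.2.
  apply: (mulIf D0); rewrite divfK // /D /det3 /lin /dot /cross /=; ring.
pose o := lin u v w (f1 y1, f2 y2, f3 y3).
have affE p : aff o u v w p = lin u v w (f1 y1 + p.1.1, f2 y2 + p.1.2, f3 y3 + p.2).
  by rewrite /aff /o; apply: pt_eq => /=; ring.
have bb : body (fun p => K (aff o u v w p)) (fun p => I (aff o u v w p)).
  exact: body_aff.
exists o, (Par (f2 y1 - f2 y2) (f3 y1 - f3 y3) (f1 y2 - f1 y1) (f3 y2 - f3 y3)
               (f1 y3 - f1 y1) (f2 y3 - f2 y2)).
have chord x y t : K x -> K y -> 0 <= t -> t <= 1 -> K (mv y t (mv x (-1) y)).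
  move=> Kx Ky t0 t1; apply: conv_eq (body_conv hB t0 t1 Ky Kx) _.
  by apply: pt_eq => /=; ring.
split=> //.
- move=> p; rewrite affE => Kp.
  have h1 := b1' _ _ Kp Ky1; have h1' := b1' _ _ Kx1 Kp.
  have h2 := b2' _ _ Kp Ky2; have h2' := b2' _ _ Kx2 Kp.
  have h3 := b3' _ _ Kp Ky3; have h3' := b3' _ _ Kx3 Kp.
  rewrite f1l f2l f3l /= in h1 h1' h2 h2' h3 h3'.
  by split; apply/andP; split; lra.
- move=> t t0 t1; rewrite affE; apply: conv_eq (chord _ _ _ Kx1 Ky1 t0 t1) _.
  transitivity (mv (lin u v w (f1 y1, f2 y1, f3 y1)) t u); first by rewrite fK.
  by apply: pt_eq => /=; ring.
- move=> t t0 t1; rewrite affE; apply: conv_eq (chord _ _ _ Kx2 Ky2 t0 t1) _.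
  transitivity (mv (lin u v w (f1 y2, f2 y2, f3 y2)) t v); first by rewrite fK.
  by apply: pt_eq => /=; ring.
- move=> t t0 t1; rewrite affE; apply: conv_eq (chord _ _ _ Kx3 Ky3 t0 t1) _.
  transitivity (mv (lin u v w (f1 y3, f2 y3, f3 y3)) t w); first by rewrite fK.
  by apply: pt_eq => /=; ring.
Qed.

(** Reflecting [x] and [z] settles two of the inequalities. The third compares [y]-coordinates;
    [Cyc] makes [y] the new first coordinate, which [Xi] reflects. *)
Lemma natural_frame (P : par) : exists k, natural (gpar k P).
Proof.
have [w1 h1] : exists k, b1 (gpar k P) <= c1 (gpar k P).
  have [h|h] := leP (b1 P) (c1 P); first by exists [::].
  by exists [:: Xi] => /=; lra.
have cat k k' : gpar (k ++ k') P = gpar k' (gpar k P) by rewrite /gpar foldl_cat.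
move: (gpar w1 P) (cat w1) h1 => Q catQ h1.
have [w2 [h2 h3]] : exists k, b1 (gpar k Q) <= c1 (gpar k Q) /\
    a3 (gpar k Q) <= b3 (gpar k Q).
  have [h|h] := leP (a3 Q) (b3 Q); first by exists [::].
  by exists [:: Rho] => /=; split; lra.
have cat2 k k' : gpar (k ++ k') Q = gpar k' (gpar k Q) by rewrite /gpar foldl_cat.
move: (gpar w2 Q) (cat2 w2) h2 h3 => S catS h2 h3.
have [w3 h] : exists k, natural (gpar k S).
  have [h|h] := leP (c2 S) (a2 S); first by exists [:: Cyc]; split => /=; lra.
  by exists [:: Cyc; Xi]; split => /=; lra.
by exists (w1 ++ (w2 ++ w3)); rewrite catQ catS.
Qed.

Lemma illum_aff (I : pt -> Prop) o u v w d p :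
  illum (fun p => I (aff o u v w p)) d p -> illum I (lin u v w d) (aff o u v w p).
Proof. by move=> [s s0]; rewrite aff_mv => h; exists s. Qed.

Lemma illum14_box (K I : pt -> Prop) (P : par) : cbody K I P ->
  exists2 L, (size L <= 14)%N & forall p, K p -> Cov I L p.
Proof.
move=> hC; have [k hN] := natural_frame P.
have [L sL hL] := illum14 (cbody_frame k hC) hN.
exists [seq glin k d | d <- L]; first by rewrite size_map.
move=> p Kp; have [q qp] := gmap_surj k p; rewrite -qp in Kp *.
have [d dL Id] := hL q Kp; exists (glin k d); last exact/illum_frame.
exact: List.in_map.
Qed.

Lemma illum14_aff (K I : pt -> Prop) o u v w (P : par) :
  det3 u v w != 0 ->
  cbody (fun p => K (aff o u v w p)) (fun p => I (aff o u v w p)) P ->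
  exists2 L, (size L <= 14)%N & forall p, K p -> Cov I L p.
Proof.
move=> D0 /illum14_box [L sL hL].
exists [seq lin u v w d | d <- L]; first by rewrite size_map.
move=> p Kp; have := cramer (mv p (-1) o) D0; set c := (_, _, _) => hc.
have pE : aff o u v w c = p.
  by rewrite /aff hc; apply: pt_eq => /=; ring.
rewrite -pE in Kp *; have [d dL Id] := hL c Kp.
by exists (lin u v w d); [exact: List.in_map|exact: illum_aff].
Qed.

End AffineFrame.

(** * Row vectors, compactness and the covering *)

Section Topology.
Variable R : realType.
Notation V := 'rV[R]_3.
Notation pt := (pt R).

Definition coords (v : V) : pt :=
  (v ord0 (@Ordinal 3 0 isT), v ord0 (@Ordinal 3 1 isT), v ord0 (@Ordinal 3 2 isT)).
Definition vec (p : pt) : V := \row_(j < 3) nth 0 [:: p.1.1; p.1.2; p.2] j.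

Lemma coordsK v : vec (coords v) = v.
Proof.
apply/rowP => -[[|[|[|//]]] hj]; rewrite mxE /=; congr (v _ _); exact: val_inj.
Qed.

Lemma vecK p : coords (vec p) = p.
Proof. by apply: pt_eq; rewrite /= mxE. Qed.

Lemma vec_mv p s d : vec (mv p s d) = vec p + s *: vec d.
Proof. by apply/rowP => -[[|[|[|//]]] hj]; rewrite !mxE. Qed.

Lemma vec_cmb l p q : vec (cmb l p q) = (1 - l) *: vec p + l *: vec q.
Proof. by apply/rowP => -[[|[|[|//]]] hj]; rewrite !mxE. Qed.

Lemma coords_sub x y : coords (x - y) = mv (coords x) (-1) (coords y).
Proof. by apply: pt_eq; rewrite /= !mxE mulN1r. Qed.

Lemma interior_ball (K : set V) x : K° x <-> exists2 e : R, 0 < e &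
  forall y, `|x - y| < e -> K y.
Proof.
rewrite /interior /=; split.
  move=> /nbhs_ballP [e /= e0 he]; exists e => // y xy; apply: he.
  by rewrite -ball_normE.
move=> [e e0 he]; apply/nbhs_ballP; exists e => //= y; rewrite -ball_normE.
exact: he.
Qed.

Variable K : set V.
Hypothesis hK : convex_body K.

Lemma convex_scale (l : R) x y : 0 <= l -> l <= 1 -> K x -> K y ->
  K ((1 - l) *: x + l *: y).
Proof.
have [/convex_setW cK _ _] := hK.
rewrite le_eqVlt => /orP[/eqP <- _ Kx _|l0]; first by rewrite subr0 scale1r scale0r addr0.
rewrite le_eqVlt => /orP[/eqP -> _ Ky|l1 Kx Ky]; first by rewrite subrr scale0r scale1r add0r.
have h : Itv.spec (@Itv.num_sem R) (Itv.Real `[0%Z, 1%Z]) l.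
  by apply/and3P; split; [exact: num_real|exact: ltW|exact: ltW].
have := cK y x _ _ (Itv.mk h); rewrite !inE /= => /(_ Ky Kx l0 l1).
by congr (K _); rewrite addrC.
Qed.

Lemma interior_star (l : R) x y : 0 < l -> l <= 1 -> K x -> K° y ->
  K° ((1 - l) *: x + l *: y).
Proof.
move=> l0 l1 Kx /interior_ball [e e0 he]; apply/interior_ball.
exists (l * e); first exact: mulr_gt0.
move=> z hz; pose d := l^-1 *: ((1 - l) *: x + l *: y - z).
have zE : z = (1 - l) *: x + l *: (y - d).
  rewrite scalerBr /d scalerA mulfV ?gt_eqF // scale1r.
  by rewrite addrA opprB addrC subrK.
rewrite zE; apply: convex_scale => //; first exact: ltW.
apply: he; rewrite opprB addrC subrK /d normrZ gtr0_norm ?invr_gt0 //.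
by rewrite ltr_pdivrMl.
Qed.

Lemma body_vec : body (fun p => K (vec p)) (fun p => K° (vec p)).
Proof.
have [_ _ [m Im]] := hK; split.
- by move=> l p q l0 l1 Kp Kq; rewrite vec_cmb; exact: convex_scale.
- by move=> p; exact: interior_subset.
- by move=> l p q l0 l1 Kp Iq; rewrite vec_cmb; exact: interior_star.
- move=> p d /nbhs_interior /interior_ball.
  move=> [e e0 he]; have D0 : 0 < `|vec d| + 1 by have := normr_ge0 (vec d); lra.
  exists (e / 2 / (`|vec d| + 1)); first by rewrite !divr_gt0.
  move=> s; rewrite ler_pdivlMr // => hs; rewrite vec_mv; apply: he.
  rewrite opprD addrA subrr add0r normrN normrZ.
  have := normr_ge0 s; have := normr_ge0 (vec d); nra.
- by exists (coords m); rewrite coordsK.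
Qed.

Lemma det_max : exists x1 y1 x2 y2 x3 y3 : V,
  let d3 := fun a b c : V => det3 (coords a) (coords b) (coords c) in
  [/\ [/\ K x1, K y1 & K x2], [/\ K y2, K x3 & K y3] &
   forall a1 b1 a2 b2 a3 b3, K a1 -> K b1 -> K a2 -> K b2 -> K a3 -> K b3 ->
     d3 (a1 - b1) (a2 - b2) (a3 - b3) <= d3 (x1 - y1) (x2 - y2) (x3 - y3)].
Proof.
have [_ cK [m Im]] := hK; have Km : K m by exact: interior_subset Im.
pose S := (K `*` K) `*` ((K `*` K) `*` (K `*` K)).
pose f (z : (V * V) * ((V * V) * (V * V))) :=
  det3 (coords (z.1.1 - z.1.2)) (coords (z.2.1.1 - z.2.1.2)) (coords (z.2.2.1 - z.2.2.2)).
have cf : continuous f.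
  have cfst (A B C : topologicalType) (g : A -> (B * C)%type) :
      continuous g -> continuous (fun z => (g z).1).
    by move=> cg z; apply: continuous_comp; [exact: cg|exact: cvg_fst].
  have csnd (A B C : topologicalType) (g : A -> (B * C)%type) :
      continuous g -> continuous (fun z => (g z).2).
    by move=> cg z; apply: continuous_comp; [exact: cg|exact: cvg_snd].
  have cid (A : topologicalType) : continuous (fun z : A => z) by move=> z.
  have cd (A : topologicalType) (g h : A -> V) j : continuous g -> continuous h ->
      continuous (fun z => (g z - h z) ord0 j).
    move=> cg ch z.
    apply: (@continuous_comp _ _ _ (fun z => g z - h z) (fun v : V => v ord0 j)).
      by apply: continuousB; [exact: cg|exact: ch].
    exact: coord_continuous.
  have cM (A : topologicalType) (g h : A -> R) : continuous g -> continuous h ->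
      continuous (fun z => g z * h z).
    by move=> cg ch z; apply: continuousM; [exact: cg|exact: ch].
  have cB (A : topologicalType) (g h : A -> R) : continuous g -> continuous h ->
      continuous (fun z => g z - h z).
    by move=> cg ch z; apply: (@continuousB _ R^o); [exact: cg|exact: ch].
  have cD (A : topologicalType) (g h : A -> R) : continuous g -> continuous h ->
      continuous (fun z => g z + h z).
    by move=> cg ch z; apply: (@continuousD _ R^o); [exact: cg|exact: ch].
  pose T : topologicalType := ((V * V) * ((V * V) * (V * V)))%type.
  have C1 j : continuous (fun z : T => (z.1.1 - z.1.2) ord0 j).
    exact: cd (cfst _ _ _ _ (cfst _ _ _ _ (cid T))) (csnd _ _ _ _ (cfst _ _ _ _ (cid T))).
  have C2 j : continuous (fun z : T => (z.2.1.1 - z.2.1.2) ord0 j).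
    exact: cd (cfst _ _ _ _ (cfst _ _ _ _ (csnd _ _ _ _ (cid T))))
      (csnd _ _ _ _ (cfst _ _ _ _ (csnd _ _ _ _ (cid T)))).
  have C3 j : continuous (fun z : T => (z.2.2.1 - z.2.2.2) ord0 j).
    exact: cd (cfst _ _ _ _ (csnd _ _ _ _ (csnd _ _ _ _ (cid T))))
      (csnd _ _ _ _ (csnd _ _ _ _ (csnd _ _ _ _ (cid T)))).
  exact: (cD _ _ _ (cD _ _ _
    (cM _ _ _ (C1 _) (cB _ _ _ (cM _ _ _ (C2 _) (C3 _)) (cM _ _ _ (C2 _) (C3 _))))
    (cM _ _ _ (C1 _) (cB _ _ _ (cM _ _ _ (C2 _) (C3 _)) (cM _ _ _ (C2 _) (C3 _)))))
    (cM _ _ _ (C1 _) (cB _ _ _ (cM _ _ _ (C2 _) (C3 _)) (cM _ _ _ (C2 _) (C3 _))))).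
have cS : compact S by do !apply: compact_setX.
have nS : S !=set0 by exists ((m, m), ((m, m), (m, m))).
have [[[x1 y1] [[x2 y2] [x3 y3]]]] := compact_EVT_max nS cS (continuous_subspaceT cf).
rewrite inE => -[[/= ? ?] [[/= ? ?] [/= ? ?]]] hmax.
exists x1, y1, x2, y2, x3, y3; split=> //.
move=> a1 b1 a2 b2 a3 b3 *; apply: (hmax ((a1, b1), ((a2, b2), (a3, b3)))).
by rewrite inE.
Qed.

Lemma illum14_vec : exists2 L : seq V, (size L <= 14)%N &
  forall x, K x -> exists2 d, d \in L & exists2 s : R, 0 < s & K° (x + s *: d).
Proof.
have [x1 [y1 [x2 [y2 [x3 [y3 [[Kx1 Ky1 Kx2] [Ky2 Kx3 Ky3] hmax]]]]]]] := det_max.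
have KE x : K x -> K (vec (coords x)) by rewrite coordsK.
have M a1 b1 a2 b2 a3 b3 : K (vec a1) -> K (vec b1) -> K (vec a2) -> K (vec b2) ->
    K (vec a3) -> K (vec b3) ->
    det3 (mv a1 (-1) b1) (mv a2 (-1) b2) (mv a3 (-1) b3) <=
    det3 (mv (coords x1) (-1) (coords y1)) (mv (coords x2) (-1) (coords y2))
         (mv (coords x3) (-1) (coords y3)).
  by move=> h1 h2 h3 h4 h5 h6; have := hmax _ _ _ _ _ _ h1 h2 h3 h4 h5 h6;
    rewrite !coords_sub !vecK.
set u := mv (coords x1) (-1) (coords y1) in M.
set v := mv (coords x2) (-1) (coords y2) in M.
set w := mv (coords x3) (-1) (coords y3) in M.
have hB := body_vec; have [m Im] := body_ne hB.
(* The interior leaves room for a small box at [m], whose positive volume the maximum cannot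
   undercut. *)
have D0 : 0 < det3 u v w.
  have [e1 e10 h1] := body_open hB (1, 0, 0) Im.
  have [e2 e20 h2] := body_open hB (0, 1, 0) Im.
  have [e3 e30 h3] := body_open hB (0, 0, 1) Im.
  have Km := body_sub hB Im.
  have k1 : K (vec (mv m e1 (1, 0, 0))).
    by apply: interior_subset; apply: h1; rewrite gtr0_norm.
  have k2 : K (vec (mv m e2 (0, 1, 0))).
    by apply: interior_subset; apply: h2; rewrite gtr0_norm.
  have k3 : K (vec (mv m e3 (0, 0, 1))).
    by apply: interior_subset; apply: h3; rewrite gtr0_norm.
  apply: lt_le_trans (M _ _ _ _ _ _ k1 Km k2 Km k3 Km).
  rewrite [X in _ < X](_ : _ = e1 * e2 * e3); last by rewrite /det3 /dot /cross /=; ring.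
  by rewrite !mulr_gt0.
(* Exchanging [p] and [q] changes the sign of the determinant, which turns maximality into a bound
   on absolute values. *)
have hmax' p q : K (vec p) -> K (vec q) -> [/\ `|det3 (mv p (-1) q) v w| <= `|det3 u v w|,
    `|det3 u (mv p (-1) q) w| <= `|det3 u v w| &
    `|det3 u v (mv p (-1) q)| <= `|det3 u v w|].
  move=> Kp Kq; rewrite (gtr0_norm D0).
  have k1 := KE _ Kx1; have k2 := KE _ Kx2; have k3 := KE _ Kx3.
  have k1' := KE _ Ky1; have k2' := KE _ Ky2; have k3' := KE _ Ky3.
  split; rewrite ler_norml; apply/andP; split; [|exact: M| |exact: M| |exact: M].
  - have := M _ _ _ _ _ _ Kq Kp k2 k2' k3 k3'; rewrite -/u -/v -/w lerNl.
    by congr (_ <= _); rewrite /det3 /dot /cross /=; ring.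
  - have := M _ _ _ _ _ _ k1 k1' Kq Kp k3 k3'; rewrite -/u -/v -/w lerNl.
    by congr (_ <= _); rewrite /det3 /dot /cross /=; ring.
  - have := M _ _ _ _ _ _ k1 k1' k2 k2' Kq Kp; rewrite -/u -/v -/w lerNl.
    by congr (_ <= _); rewrite /det3 /dot /cross /=; ring.
have [z0 [P hC]] := box_frame hB (KE _ Kx1) (KE _ Ky1) (KE _ Kx2) (KE _ Ky2)
  (KE _ Kx3) (KE _ Ky3) (lt0r_neq0 D0) hmax'.
have [L sL hL] := illum14_aff (K := fun p => K (vec p)) (I := fun p => K° (vec p))
  (lt0r_neq0 D0) hC.
exists [seq vec d | d <- L]; first by rewrite size_map.
move=> x Kx; have [d dL [s s0]] := hL _ (KE _ Kx).
rewrite vec_mv coordsK => h; exists (vec d); last by exists s.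
elim: (L) dL => //= d' L' IH [->|/IH h']; first exact: mem_head.
by rewrite inE h' orbT.
Qed.

Lemma cover14 : covered_by_translates K K° 14.
Proof.
have [L sL hL] := illum14_vec; have [_ cK _] := hK.
(* The points of [K] that some direction brings into the interior in time [1 / (n + 1)]. Within [K]
   these sets grow with [n], so a finite subcover yields one time for all points. *)
pose U (n : nat) : set V := [set x | exists2 d, d \in L & K° (x + n.+1%:R^-1 *: d)].
have mono n k x : (n <= k)%N -> K x -> U n x -> U k x.
  move=> nk Kx [d dL Id]; exists d; first exact: dL.
  have l0 : 0 < k.+1%:R^-1 / n.+1%:R^-1 :> R by rewrite divr_gt0 ?invr_gt0 ?ltr0n.
  have l1 : k.+1%:R^-1 / n.+1%:R^-1 <= 1 :> R.
    by rewrite ler_pdivrMr ?invr_gt0 ?ltr0n // mul1r lef_pV2 ?posrE ?ltr0n // ler_nat.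
  have := interior_star l0 l1 Kx Id; congr (K° _).
  by rewrite scalerDr addrA -scalerDl subrK scale1r scalerA divfK ?gt_eqF ?invr_gt0 ?ltr0n.
have oU n : setT n -> open (U n).
  move=> _; have -> : U n = \bigcup_(d in [set` L]) ((fun x => x + n.+1%:R^-1 *: d) @^-1` K°).
    by apply/seteqP; split => x [d dL Id]; exists d.
  apply: bigcup_open => d _; apply: open_comp; last exact: open_interior.
  move=> x _; apply: (@cvgD _ _ _ (nbhs x) _ id (fun=> n.+1%:R^-1 *: d) x).
    exact: cvg_id.
  exact: cvg_cst.
have KU : K `<=` cover setT U.
  move=> x Kx; have [d dL [s s0 Is]] := hL x Kx.
  have [n hn] : exists n, n.+1%:R^-1 <= s.
    exists (Num.truncn s^-1); rewrite -[leRHS]invrK lef_pV2 ?posrE ?ltr0n ?invr_gt0 //.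
    by apply/ltW/truncnS_gt.
  exists n; first by [].
  exists d; first exact: dL.
  have l0 : 0 < n.+1%:R^-1 / s by rewrite divr_gt0 ?invr_gt0 ?ltr0n.
  have l1 : n.+1%:R^-1 / s <= 1 by rewrite ler_pdivrMr // mul1r.
  have := interior_star l0 l1 Kx Is; congr (K° _).
  by rewrite scalerDr addrA -scalerDl subrK scale1r scalerA divfK ?gt_eqF.
move: cK; rewrite compact_cover => /(_ _ _ _ oU KU) [D _ KD].
have [N hN] : exists N, forall n, [set` D] n -> (n <= N)%N.
  exists (\max_(n <- enum_fset D) n) => n nD.
  by have := @leq_bigmax_seq _ (enum_fset D) xpredT id n nD isT.
(* The translates of the interior undo the motion, whence the sign; the default 0 of [nth] pads a
   list shorter than 14. *)
exists (fun i : 'I_14 => - (N.+1%:R^-1 *: nth 0 L i)) => x Kx.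
have [n nD Un] := KD x Kx; have [d dL Id] := mono _ _ _ (hN n nD) Kx Un.
have iL : (index d L < 14)%N by apply: leq_trans sL; rewrite index_mem.
exists (Ordinal iL) => //=; exists (x + N.+1%:R^-1 *: d) => //.
by rewrite nth_index // addrC addrK.
Qed.

End Topology.

Unset Implicit Arguments.

Theorem theorem1p1 (R : realType) (K : set 'rV[R]_3) (hK : convex_body K) :
  (covering_number R K K° <= 14%:E)%E.
Proof. by apply: ereal_inf_lbound; exists 14%N => //; exact: cover14. Qed.
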